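(* Let $A\subset\mathbb R^n$ be such that $c_*(A)=\infty$ and $\mathcal E^+(A)$ is strongly closed, and let $\omega$ be a (signed) measure such that either (i) $\omega\in\mathcal E$, or (ii) $\omega^+$ is bounded, $\sup_{x\in A}U^{|\omega|}(x)<\infty$, $U^\omega$ is (finite-valued and) continuous on $\overline{A}$, and $$\lim_{|x|\to\infty,\ x\in\overline{A}}U^{\omega^+}(x)=\lim_{|x|\to\infty,\ x\in\overline{A}}U^{\omega^-}(x)=0.$$ Put $f:=-U^\omega$, and let $\hat\omega^A$ be the inner pseudo-balayage of $\omega$ onto $A$. Then a minimizer $\lambda_{A,f}$ of $I_f(\mu)$ over $\mu\in\breve{\mathcal E}^+(A)$ exists if and only if $\hat{\omega}^A(\mathbb R^n)\geqslant1$. If moreover $\hat{\omega}^A(\mathbb R^n)>1$, then $$\lambda_{A,f}\ne\hat{\omega}^A,\quad w_f(A)\ne\hat{w}_f(A),\quad c_{A,f}\ne0.$$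
   Context: Let $n\geqslant2$, $0<\alpha<n$, and $\kappa_\alpha(x,y):=|x-y|^{\alpha-n}$ on $\mathbb R^n$. A measure is a real-valued (signed) Radon measure $\mu$ on $\mathbb R^n$ with Hahn--Jordan decomposition $\mu=\mu^+-\mu^-$ and $|\mu|:=\mu^++\mu^-$; $\mu$ is bounded if $|\mu|(\mathbb R^n)<\infty$. All measures considered are assumed to satisfy $\int_{|y|>1}|y|^{\alpha-n}\,d|\mu|(y)<\infty$. Potential: $U^\mu(x):=\int\kappa_\alpha(x,y)\,d\mu(y)$. Energy: $I(\mu):=\int\kappa_\alpha\,d(\mu\otimes\mu)$. $\mathcal E$ is the pre-Hilbert space of all measures of finite energy, with inner product $\langle\mu,\nu\rangle=\int\kappa_\alpha\,d(\mu\otimes\nu)$ and norm $\|\mu\|=\sqrt{I(\mu)}$; the norm topology is called strong. $\mathcal E^+$ is the cone of positive measures in $\mathcal E$. For $A\subset\mathbb R^n$ (not necessarily Borel), $\mathcal E^+(A)$ is the set of $\mu\in\mathcal E^+$ concentrated on $A$ (i.e. $\mathbb R^n\setminus A$ is $\mu$-negligible), and $\overline A$ is the closure of $A$ in $\mathbb R^n$. Inner capacity: $c_*(A):=\sup\{c(K):K\subset A\text{ compact}\}$, where $c(K):=1/\inf\{\|\mu\|^2:\mu\in\mathcal E^+(K),\ \mu(K)=1\}$ (with $\inf\varnothing=\infty$, $1/\infty=0$). For $f:=-U^\omega$: $\mathcal E^+_f(A)$ is the set of $\mu\in\mathcal E^+(A)$ for which $f$ is $\mu$-integrable; $I_f(\mu):=\|\mu\|^2+2\int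 f\,d\mu=\|\mu\|^2-2\int U^\omega\,d\mu$; $\hat w_f(A):=\inf_{\mu\in\mathcal E^+_f(A)}I_f(\mu)$. The inner pseudo-balayage $\hat\omega^A$ is the measure in $\mathcal E^+_f(A)$ with $I_f(\hat\omega^A)=\hat w_f(A)$; under the stated assumptions it exists and is unique. Further, $\breve{\mathcal E}^+(A):=\{\mu\in\mathcal E^+(A):\mu(\mathbb R^n)=1\}\subset\mathcal E^+_f(A)$ and $w_f(A):=\inf_{\mu\in\breve{\mathcal E}^+(A)}I_f(\mu)$. A minimizer $\lambda_{A,f}$ is unique if it exists; then $U_f^{\lambda_{A,f}}:=U^{\lambda_{A,f}}+f$ and the inner $f$-weighted equilibrium constant is $c_{A,f}:=\int U_f^{\lambda_{A,f}}\,d\lambda_{A,f}=w_f(A)-\int f\,d\lambda_{A,f}$. *)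

(* Defs.v *)
From HB Require Import structures.
From mathcomp Require Import all_boot all_order all_algebra.
From mathcomp Require Import all_classical all_reals all_analysis.

Set Implicit Arguments.
Unset Strict Implicit.
Unset Printing Implicit Defensive.

Import Order.TTheory GRing.Theory Num.Theory.
Import numFieldNormedType.Exports.

Local Open Scope classical_set_scope.
Local Open Scope ring_scope.

(* R^n as a type carrying both the usual topology and the Borel sigma-algebra.
   The library norm on row vectors is the sup norm; it gives the usual topology
   and the same bounded sets, but the Riesz kernel below uses [enorm]. *)
Definition Rn (R : realType) (n : nat) : Type := 'rV[R]_n.

HB.instance Definition _ (R : realType) (n : nat) :=
  NormedModule.on (Rn R n).

HB.instance Definition _ (R : realType) (n : nat) :=
  @isMeasurable.Build (sigma_display (@open (Rn R n))) (Rn R n)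
    <<s @open (Rn R n) >> (@sigma_algebra0 _ setT _)
    (@sigma_algebraC _ _) (@sigma_algebra_bigcup _ setT _).

Definition enorm (R : realType) (n : nat) (x : Rn R n) : R :=
  Num.sqrt (\sum_(i < n) (x ord0 i) ^+ 2).

(* The filter of neighbourhoods of infinity, |x| -> oo. *)
Definition at_infinity (R : realType) (n : nat) : set_system (Rn R n) :=
  filter_from [set: R] (fun M => [set x : Rn R n | M < enorm x]).

(* Positive Radon measures: Borel measures that are finite on compact sets
   (on R^n these are automatically regular). Sigma-finiteness is automatic as
   well, see the factory [Measure_isRadon]; it is part of the structure so that
   product measures can be formed. *)
HB.mixin Record isRadon (R : realType) (n : nat) (mu : set (Rn R n) -> \bar R)
  := { radon_compact : forall K : set (Rn R n), compact K -> (mu K < +oo)%E }.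

#[short(type="radon")]
HB.structure Definition Radon (R : realType) (n : nat) :=
  { mu of @SigmaFiniteMeasure _ (Rn R n) R mu & isRadon R n mu }.

HB.factory Record Measure_isRadon (R : realType) (n : nat)
    (mu : set (Rn R n) -> \bar R) & @isMeasure _ (Rn R n) R mu :=
  { radon_compact : forall K : set (Rn R n), compact K -> (mu K < +oo)%E }.

HB.builders Context R n mu & @Measure_isRadon R n mu.

Let cball (k : nat) : set (Rn R n) := [set x | `|x| <= k%:R].

Let cball_closed k : closed (cball k).
Proof.
apply: (@closed_comp _ _ (fun x : Rn R n => `|x|) [set r | r <= k%:R]).
  by move=> x _; exact: norm_continuous.
exact: closed_le.
Qed.

Let cball_compact k : compact (cball k).
Proof.
apply: bounded_closed_compact; last exact: cball_closed.
exists k%:R; split; first exact: num_real.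
by move=> r kr x /= /le_trans; apply; exact: ltW.
Qed.

Let radon_sigma_finite : sigma_finite setT mu.
Proof.
exists cball.
  apply/seteqP; split => // x _.
  by exists (Num.truncn `|x|).+1 => //; exact/ltW/truncnS_gt.
move=> k; split; last exact/radon_compact/cball_compact.
rewrite -[cball k]setCK; apply: measurableC; apply: sub_sigma_algebra.
exact/closed_openC/cball_closed.
Qed.

HB.instance Definition _ :=
  @Measure_isSigmaFinite.Build _ (Rn R n) R mu radon_sigma_finite.

HB.instance Definition _ := @isRadon.Build R n mu radon_compact.

HB.end.

Section riesz.
Context (R : realType) (n : nat).
Implicit Types (alpha : R) (A K : set (Rn R n)) (mu nu lam : radon R n).

Let radon_mzero (K : set (Rn R n)) :
  compact K -> (@mzero _ (Rn R n) R K < +oo)%E.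
Proof. by move=> _; exact: ltry. Qed.

HB.instance Definition _ := @isRadon.Build R n (@mzero _ (Rn R n) R) radon_mzero.

Section radon_add.
Variables mu nu : radon R n.

Definition radon_add := measure_add mu nu.

HB.instance Definition _ := Measure.on radon_add.

Let radon_add_compact (K : set (Rn R n)) :
  compact K -> (radon_add K < +oo)%E.
Proof.
move=> cK; rewrite /radon_add measure_addE.
by apply: lte_add_pinfty; exact: radon_compact.
Qed.

HB.instance Definition _ := @Measure_isRadon.Build R n radon_add radon_add_compact.
End radon_add.

(* A real-valued signed Radon measure, given by its Hahn-Jordan decomposition;
   both parts may have infinite total mass. *)
Record sradon := SRadon {
  spos : radon R n;
  sneg : radon R n;
  sradon_singular : exists P : set (Rn R n),
    [/\ measurable P, spos (~` P) = 0%E & sneg P = 0%E] }.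

Implicit Types omega : sradon.

Definition tvar (omega : sradon) : radon R n :=
  radon_add (spos omega) (sneg omega).

Lemma sradon_of_radon_singular mu : exists P : set (Rn R n),
  [/\ measurable P, mu (~` P) = 0%E & (@mzero _ (Rn R n) R : radon R n) P = 0%E].
Proof. by exists setT; split => //; rewrite setCT measure0. Qed.

Definition sradon_of_radon mu : sradon :=
  SRadon (sradon_of_radon_singular mu).

Definition radon_eq mu nu := forall B : set (Rn R n), measurable B -> mu B = nu B.

(* The diagonal value is +oo because [0 `^ (alpha - n)] is 0 in the library. *)
Definition riesz_kernel alpha (x y : Rn R n) : \bar R :=
  if x == y then +oo%E else (enorm (x - y) `^ (alpha - n%:R))%:E.

Definition potential alpha mu (x : Rn R n) : \bar R :=
  (\int[mu]_y riesz_kernel alpha x y)%E.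

(* Where both parts are +oo the potential is undefined in the literature; the
   library's convention (+oo - +oo = -oo) makes it infinite there, so that
   integrability or finiteness of [spotential] excludes such points. *)
Definition spotential alpha omega (x : Rn R n) : \bar R :=
  (potential alpha (spos omega) x - potential alpha (sneg omega) x)%E.

Definition mutual_energy alpha mu nu : \bar R :=
  (\int[mu \x nu]_z riesz_kernel alpha z.1 z.2)%E.

Definition energy alpha mu : \bar R := mutual_energy alpha mu mu.

Definition smutual_energy alpha (mu nu : sradon) : \bar R :=
  ((mutual_energy alpha (spos mu) (spos nu)
    + mutual_energy alpha (sneg mu) (sneg nu))
   - (mutual_energy alpha (spos mu) (sneg nu)
      + mutual_energy alpha (sneg mu) (spos nu)))%E.

Definition tail_finite alpha mu : Prop :=
  (\int[mu]_(y in [set y : Rn R n | (1 < enorm y)%R])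
     (enorm y `^ (alpha - n%:R))%:E < +oo)%E.

(* The space E: kappa_alpha is integrable for |mu (x) mu| = |mu| (x) |mu|. *)
Definition finite_energy alpha : set sradon :=
  [set mu | tail_finite alpha (tvar mu) /\ (energy alpha (tvar mu) < +oo)%E].

(* ||mu - nu|| in the pre-Hilbert space E, by bilinearity. *)
Definition strong_dist alpha (mu nu : sradon) : R :=
  Num.sqrt (fine (smutual_energy alpha mu mu
                  - 2%:E * smutual_energy alpha mu nu
                  + smutual_energy alpha nu nu)%E).

Definition Eplus alpha : set (radon R n) :=
  [set mu | tail_finite alpha mu /\ (energy alpha mu < +oo)%E].

Definition Eplus_on alpha A : set (radon R n) :=
  [set mu | Eplus alpha mu /\ mu.-negligible (~` A)].

(* A set S of positive measures is closed in E: every signed measure in E that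
   is a strong limit point of S is a positive measure belonging to S. *)
Definition strongly_closed alpha (S : set (radon R n)) : Prop :=
  forall mu : sradon, finite_energy alpha mu ->
    (forall e : R, 0 < e ->
       exists2 nu, S nu & strong_dist alpha mu (sradon_of_radon nu) < e) ->
    sneg mu setT = 0%E /\ S (spos mu).

Definition capacity alpha K : \bar R :=
  (ereal_inf [set energy alpha mu
             | mu in [set mu | Eplus_on alpha K mu /\ mu setT = 1%E]])^-1%E.

Definition inner_capacity alpha A : \bar R :=
  ereal_sup [set capacity alpha K | K in [set K | compact K /\ K `<=` A]].

Section external_field.
Implicit Type f : Rn R n -> \bar R.

Definition Eplus_field alpha f A : set (radon R n) :=
  [set mu | Eplus_on alpha A mu /\ mu.-integrable setT f].

Definition gauss alpha f mu : \bar R :=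
  (energy alpha mu + 2%:E * \int[mu]_x f x)%E.

Definition w_hat alpha f A : \bar R :=
  ereal_inf [set gauss alpha f mu | mu in Eplus_field alpha f A].

Definition Eplus_unit alpha A : set (radon R n) :=
  [set mu | Eplus_on alpha A mu /\ mu setT = 1%E].

Definition w_unit alpha f A : \bar R :=
  ereal_inf [set gauss alpha f mu | mu in Eplus_unit alpha A].

Definition is_weighted_minimizer alpha f A lam : Prop :=
  Eplus_unit alpha A lam /\ gauss alpha f lam = w_unit alpha f A.

Definition equilibrium_constant alpha f lam : \bar R :=
  (\int[lam]_x (potential alpha lam x + f x))%E.

End external_field.

Definition neg_potential alpha omega (x : Rn R n) : \bar R :=
  (- spotential alpha omega x)%E.

Definition is_pseudo_balayage alpha omega A mu : Prop :=
  let f := neg_potential alpha omega in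
  Eplus_field alpha f A mu /\ gauss alpha f mu = w_hat alpha f A.

(* The continuity of U^omega is that of its restriction to the closure of A. *)
Definition vanishing_field alpha omega A : Prop :=
  [/\ (spos omega setT < +oo)%E,
      (ereal_sup [set potential alpha (tvar omega) x | x in A] < +oo)%E,
      (forall x, closure A x -> spotential alpha omega x \is a fin_num)
        /\ {within closure A, continuous (spotential alpha omega)},
      potential alpha (spos omega) x
        @[x --> within (closure A) (@at_infinity R n)] --> 0%E
    & potential alpha (sneg omega) x
        @[x --> within (closure A) (@at_infinity R n)] --> 0%E].

End riesz.

(* Main.v *)
From HB Require Import structures.
From mathcomp Require Import all_boot all_order all_algebra.
From mathcomp Require Import all_classical all_reals all_analysis.
From mathcomp Require Import measurable_realfun ring lra.
Require Import Defs.

(** Write [J mu = ||mu||^2 + 2 \int f dmu] for the Gauss functional.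

    Three facts about the external field carry the proof. First, because A has
    infinite inner capacity, there are unit measures on A whose energy and field
    integral are as small as desired ([small_energy_unit], and the two lemmas
    named [..._spreading]). Second, f is integrable for every measure of finite
    energy and finite mass on A. Third, J is lower semicontinuous along the
    sequences met below ([weak_limit_of_field]). Granting them, the theorem is a
    convexity argument ([gauss_variational]):

    - If the pseudo-balayage has mass at most 1, the missing mass can be added in
      the form of a unit measure of tiny energy, so the infimum over unit measures
      is the infimum over the whole cone. When the mass is 1, the pseudo-balayage
      itself is a solution. When the mass is smaller, a solution would be a second
      minimizer over the cone; minimizers over the cone have equal masses by the
      parallelogram identity, so there is none.
    - If the pseudo-balayage has mass greater than 1, a minimizing sequence of unit
      measures is strongly Cauchy. A vague limit mu of it is also its strong limit,
      hence belongs to the strongly closed cone, and J mu is at most the infimum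
      over unit measures. Mass may have escaped to infinity, so mu has mass at most
      1; but a truncation of the pseudo-balayage has mass greater than 1 and J no
      larger than the same bound, and a convex combination of the two has mass
      exactly 1. It solves the problem.
    - In that case the two infima differ, since otherwise a solution would minimize
      over the whole cone and share its mass with the pseudo-balayage. Were the
      equilibrium constant zero, the optimality of lam among unit measures would
      give [J lam <= J nu] for every nu in the cone that is finite and nonzero,
      against the strict inequality between the infima.

    Potential theory enters through one device: the Riesz kernel is a mixture of
    products of Gaussians ([riesz_features]), [kappa(x, y) = \int phi(x, s) phi(y, s) dm(s)],
    so the energy of mu is the squared L^2 norm of its transform
    [s |-> \int phi(x, s) dmu(x)]. This gives the Cauchy-Schwarz inequality for
    measures of finite energy. Moreover a weight w with [\int phi(x, s) w(s) dm(s) = 1]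
    for all x recovers the total mass from the transform, so measures at distance
    zero have the same mass ([energy_eq_mass]); this is all the strict positivity of
    the energy that the argument uses. Finally, for fixed s the function phi(., s)
    is continuous and vanishes at infinity, so the transforms of a vaguely convergent
    sequence converge pointwise, which identifies vague and strong limits. *)

Set Implicit Arguments.
Unset Strict Implicit.
Unset Printing Implicit Defensive.

Import Order.TTheory GRing.Theory Num.Theory.
Import numFieldNormedType.Exports.

Local Open Scope classical_set_scope.
Local Open Scope ring_scope.

(** * Products of sigma-finite measures *)

(** The product of two sigma-finite measures, packaged with its own
    sigma-finiteness so that products can be iterated. *)
Section sigma_finite_product.
Context d1 d2 (T1 : measurableType d1) (T2 : measurableType d2) (R : realType).
Variables (m1 : {sigma_finite_measure set T1 -> \bar R})
  (m2 : {sigma_finite_measure set T2 -> \bar R}).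

Definition sigma_prod : set (T1 * T2) -> \bar R := (m1 \x m2)%E.

HB.instance Definition _ := Measure.on sigma_prod.

Let sigma_prod_sigma_finite : sigma_finite setT sigma_prod.
Proof.
have /sigma_finiteP[F [FT ndF Foo]] := sigma_finiteT m1.
have /sigma_finiteP[G [GT ndG Goo]] := sigma_finiteT m2.
exists (fun k => F k `*` G k) => [|k].
  apply/seteqP; split=> // -[x y] _.
  have [i _ Fx] : (\bigcup_k F k) x by rewrite -FT.
  have [j _ Gy] : (\bigcup_k G k) y by rewrite -GT.
  exists (maxn i j) => //; split => /=.
  - by move: x Fx; exact/subsetPset/ndF/leq_maxl.
  - by move: y Gy; exact/subsetPset/ndG/leq_maxr.
have [mF Fk] := Foo k; have [mG Gk] := Goo k.
split; first exact: measurableX.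
rewrite [sigma_prod _](product_measure1E m1 m2 mF mG).
by rewrite lte_mul_pinfty// ge0_fin_numE.
Qed.

HB.instance Definition _ :=
  Measure_isSigmaFinite.Build _ _ _ sigma_prod sigma_prod_sigma_finite.
End sigma_finite_product.

(** * Borel sets and the Euclidean norm *)

Section borel_Rn.
Context (R : realType).
Local Notation Rm := (measurableTypeR R).

Lemma open_Rn_measurable (n : nat) (U : set (Rn R n)) : open U -> measurable U.
Proof. exact: sub_sigma_algebra. Qed.

Lemma closed_Rn_measurable (n : nat) (C : set (Rn R n)) : closed C -> measurable C.
Proof.
move=> cC; rewrite -[C]setCK; apply: measurableC; apply: sub_sigma_algebra.
exact/closed_openC.
Qed.

Lemma continuous_Rn_measurable (n : nat) (f : Rn R n -> R) :
  continuous f -> measurable_fun setT (f : Rn R n -> Rm).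
Proof.
move=> cf; apply: (measurability _ (RGenOpens.measurableE R)) => //.
move=> _ [_ [x [y ->]] <-]; rewrite setTI; apply: open_Rn_measurable.
by apply: open_comp => [? _|]; [exact: cf|exact: interval_open].
Qed.

Lemma coord_continuous_Rn (n : nat) (i : 'I_n) : continuous (fun x : Rn R n => x ord0 i).
Proof. exact: (@coord_continuous R 1 n ord0 i). Qed.

Lemma enorm_sqr (n : nat) (x : Rn R n) : enorm x ^+ 2 = \sum_(i < n) x ord0 i ^+ 2.
Proof. by rewrite sqr_sqrtr// sumr_ge0// => i _; rewrite sqr_ge0. Qed.

Lemma enorm_ge0 (n : nat) (x : Rn R n) : 0 <= enorm x.
Proof. exact: sqrtr_ge0. Qed.

Lemma normr_le_enorm (n : nat) (x : Rn R n) : `|x| <= enorm x.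
Proof.
rewrite [leLHS]/Num.norm/= mx_normrE; apply: bigmax_le; first exact: enorm_ge0.
move=> [i j] _ /=; rewrite (ord1 i) -(sqrtr_sqr (x ord0 j)); apply: ler_wsqrtr.
by rewrite (bigD1 j)//= lerDl sumr_ge0// => k _; exact: sqr_ge0.
Qed.

Lemma enorm_sub_eq0 (n : nat) (x y : Rn R n) : (enorm (x - y) == 0) = (x == y).
Proof.
rewrite sqrtr_eq0; apply/idP/idP => [h|/eqP ->]; last first.
  by rewrite big1// => i _; rewrite subrr mxE expr0n.
have : \sum_(i < n) (x - y) ord0 i ^+ 2 == 0.
  by rewrite eq_le h sumr_ge0// => i _; rewrite sqr_ge0.
rewrite psumr_eq0 => [/allP H|i _]; last exact: sqr_ge0.
apply/eqP/rowP => i; have := H i (mem_index_enum i).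
by rewrite /= sqrf_eq0 !mxE subr_eq0 => /eqP.
Qed.

Lemma continuous_sum (T : topologicalType) (I : Type) (r : seq I) (f : I -> T -> R) :
  (forall i, continuous (f i)) -> continuous (fun x => \sum_(i <- r) f i x).
Proof.
move=> cf; elim: r => [|i r IH] x.
  by under eq_fun do rewrite big_nil; exact: cvg_cst.
rewrite [X in continuous_at _ X](_ : _ = fun x => f i x + \sum_(i <- r) f i x); last first.
  by apply/funext => y; rewrite big_cons.
by apply: cvgD; [exact: cf|exact: IH].
Qed.

Lemma continuous_enorm (n : nat) : continuous (@enorm R n).
Proof.
have cs : continuous (fun x : Rn R n => \sum_(i < n) x ord0 i ^+ 2).
  apply: continuous_sum => i x.
  apply: (continuous_comp (@coord_continuous_Rn n i x) (g := fun y : R => y ^+ 2)).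
  exact: exprn_continuous.
by move=> x; exact: (continuous_comp (cs x) (@sqrt_continuous R _)).
Qed.

Lemma measurable_enorm (n : nat) : measurable_fun setT (@enorm R n : Rn R n -> Rm).
Proof. exact: (continuous_Rn_measurable (@continuous_enorm n)). Qed.

End borel_Rn.

Section balls.
Context (R : realType) (n : nat).
Local Notation T := (Rn R n).

Definition cball (M : R) : set T := [set x | enorm x <= M].

Lemma closed_cball M : closed (cball M).
Proof.
apply: (@closed_comp _ _ (@enorm R n) [set y : R | y <= M]); last exact: closed_le.
by move=> x _; exact: continuous_enorm.
Qed.

Lemma measurable_cball M : measurable (cball M).
Proof. by apply: closed_Rn_measurable; exact: closed_cball. Qed.

Lemma compact_cball M : compact (cball M).
Proof.
apply: bounded_closed_compact; last exact: closed_cball.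
exists M; split; first exact: num_real.
move=> r kr x /= xk; apply: le_trans (ltW kr); apply: le_trans xk.
exact: normr_le_enorm.
Qed.

Lemma enorm_sub_le (x y : T) M : enorm x <= M -> enorm y <= M -> enorm (x - y) <= 2 * M.
Proof.
move=> xM yM; have M0 : 0 <= M by exact: le_trans (enorm_ge0 x) xM.
rewrite -(ler_pXn2r (ltn0Sn 1)) ?nnegrE ?enorm_ge0 ?mulr_ge0//.
apply: (@le_trans _ _ (2 * enorm x ^+ 2 + 2 * enorm y ^+ 2)).
  rewrite !enorm_sqr !mulr_sumr -big_split/=; apply: ler_sum => i _.
  rewrite !mxE; move: (x _ _) (y _ _) => a b.
  by have := sqr_ge0 (a + b); rewrite !expr2; lra.
have xx : enorm x ^+ 2 <= M ^+ 2 by rewrite ler_pXn2r ?nnegrE ?enorm_ge0.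
have yy : enorm y ^+ 2 <= M ^+ 2 by rewrite ler_pXn2r ?nnegrE ?enorm_ge0.
by rewrite exprMn; move: xx yy; move: (_ ^+ 2) (_ ^+ 2) (M ^+ 2) => *; lra.
Qed.

End balls.

(** * The Riesz kernel as a mixture of products of Gaussians *)

Section one_dim.
Context (R : realType).
Local Notation leb := (@lebesgue_measure R).
Local Notation Rm := (measurableTypeR R).

Lemma gauss_integral_shift (a b : R) : 0 < a ->
  (\int[leb]_z (expR (- (a * (b - z) ^+ 2)))%:E = (Num.sqrt (pi / a))%:E)%E.
Proof.
move=> a0; pose s : R := Num.sqrt (2 * a)^-1.
have s2 : s ^+ 2 = (2 * a)^-1 by rewrite sqr_sqrtr// invr_ge0 mulr_ge0// ltW.
have s0 : s != 0 by rewrite gt_eqF// sqrtr_gt0 invr_gt0 mulr_gt0.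
have K : 0 < @normal_peak R s by exact: normal_peak_gt0.
have := integral_normal_pdf b s.
under eq_integral => z _.
  rewrite normal_pdfE// /normal_fun EFinM s2.
  rewrite (_ : - (z - b) ^+ 2 / _ = - (a * (b - z) ^+ 2)); last first.
    by field; rewrite gt_eqF.
  over.
rewrite ge0_integralZl_EFin//=; last 2 first.
- apply/measurable_EFinP; apply: measurableT_comp => //=.
  apply: measurableT_comp => //=; apply: measurable_funM => //=.
  by apply: measurable_funX; apply: measurable_funB.
- exact: ltW.
move=> h.
have -> : Num.sqrt (pi / a) = (normal_peak s)^-1.
  by rewrite /normal_peak invrK s2; congr Num.sqrt; field; exact: lt0r_neq0.
have : ((normal_peak s)^-1%:E * ((normal_peak s)%:E * \int[leb]_x (expR (- (a * (b - x) ^+ 2)))%:E) = (normal_peak s)^-1%:E)%E by rewrite h mule1.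
by rewrite muleA -EFinM mulVf ?lt0r_neq0// mul1e.
Qed.

(** Lebesgue measure is determined by its values on intervals, so it equals c
    times its image under the inverse of the dilation by c. *)
Lemma ge0_integral_lebesgue_scale (c : R) (f : Rm -> \bar R) : 0 < c ->
  measurable_fun setT f -> (forall x, 0 <= f x)%E ->
  (\int[leb]_x f x = c%:E * \int[leb]_x f (c * x)%R)%E.
Proof.
move=> c0 mf f0.
have mc : measurable_fun setT (fun x : Rm => c * x : Rm).
  by apply: measurable_funM.
pose c' : {nonneg R} := NngNum (ltW c0).
pose pm : {measure set Rm -> \bar R} :=
  measure_function_pushforward__canonical__measure_function_Measure leb mc.
pose m := @mscale _ _ _ c' pm.
have mE (A : set Rm) : measurable A -> leb A = m A.
  move=> mA; apply: (lebesgue_measure_unique (mu := m)) => // _ [[a b]] _ <-.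
  transitivity (c%:E * leb ((fun x : Rm => (c * x)%R : Rm) @^-1` `]a, b]))%E => //.
  rewrite (_ : _ @^-1` _ = `](a / c), (b / c)]%classic); last first.
    apply/seteqP; split=> x /=; rewrite !in_itv/=.
      by rewrite ltr_pdivrMr// ler_pdivlMr// (mulrC x).
    by rewrite ltr_pdivrMr// ler_pdivlMr// (mulrC x).
  rewrite !lebesgue_measure_itv/= !lte_fin ltr_pM2r ?invr_gt0//.
  case: ifPn => _; last by rewrite mule0.
  by rewrite -!EFinD -EFinM -mulrBl mulrC divfK// gt_eqF.
rewrite (eq_measure_integral m); last by move=> A mA _; exact: mE.
rewrite /m ge0_integral_mscale//= ge0_integral_pushforward//.
Qed.

(** Comparison with a function of known integral: it makes the radial integral
    below converge. *)
Lemma exp_powR_bound (b : R) : 0 < b -> exists2 M : R, 0 <= M &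
  forall v : R, 0 <= v -> expR (- (v `^ b^-1)) <= M * (oneDsqr v)^-1.
Proof.
move=> b0; pose k := (Num.truncn (2 * b)).
have kb : 2 * b <= k.+1%:R by exact/ltW/truncnS_gt.
exists (2 + k.+1`!%:R); first by rewrite addr_ge0.
move=> v v0; rewrite ler_pdivlMr; last by rewrite /oneDsqr ltr_pwDl// sqr_ge0.
rewrite expRN mulrC ler_pdivrMr ?expR_gt0//.
set y := v `^ b^-1.
have y0 : 0 <= y by exact: powR_ge0.
have vy : v = y `^ b by rewrite /y -powRrM mulVf ?gt_eqF// powRr1.
have v2 : v ^+ 2 = y `^ (2 * b).
  by rewrite mulrC powRrM -vy powR_mulrn.
have e1 : 1 <= expR y by rewrite -expR0 ler_expR.
have h : v ^+ 2 <= 1 + y ^+ k.+1.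
  rewrite v2 -powR_mulrn//.
  have [y1|y1] := leP 1 y.
    by rewrite (le_trans (ler_powR y1 kb))// lerDr.
  have : y `^ (2 * b) <= 1.
    have /(le_trans _) : 1 `^ (2 * b) <= 1 :> R by rewrite powR1.
    apply; rewrite ge0_ler_powR// ?nnegrE// ?ltW//.
    by rewrite mulr_gt0.
  by move=> /le_trans; apply; rewrite lerDl powR_ge0.
have h2 := expR_ge1Dxn k y0.
have f0 : 0 < k.+1`!%:R :> R by rewrite ltr0n fact_gt0.
have h3 : y ^+ k.+1 <= k.+1`!%:R * expR y.
  rewrite -ler_pdivrMl// mulrC; apply: le_trans h2; by rewrite lerDr.
rewrite /oneDsqr mulrDl; lra.
Qed.

(** The substitution [t = v `^ b^-1] turns the Gamma integral of [t `^ (b - 1) *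
    exp (- t r)] into an integral against dv itself. In this form its dependence
    on r follows from dilation invariance, and C is the value at r = 1, namely
    Gamma (b + 1). *)
Lemma riesz_radial (b : R) : 0 < b -> exists2 C : R, 0 < C &
  forall r : R, 0 <= r ->
  (\int[leb]_(v in [set x : R | 0 < x]%R) (expR (- (v `^ b^-1 * r)))%:E =
   if r == 0%R then +oo else (C * r `^ (- b))%:E)%E.
Proof.
move=> b0.
pose D : set R := [set x : R | 0 < x]%R.
have DE : D = `]0, +oo[%classic.
  by apply/seteqP; split=> x; rewrite /D /= in_itv/= andbT.
have mD : measurable (D : set Rm) by rewrite DE; exact: measurable_itv.
pose J r := (\int[leb]_(v in D) (expR (- (v `^ b^-1 * r)))%:E)%E.
have mE (r : R) (E : set Rm) : measurable_fun E (fun v : Rm => (expR (- (v `^ b^-1 * r)))%:E).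
  apply: measurable_funTS; apply/measurable_EFinP; apply: measurableT_comp => //.
  by apply: measurableT_comp => //; apply: measurable_funM => //; exact: measurable_powR.
have Jfin : (J 1%R < +oo)%E.
  have [M M0 hM] := exp_powR_bound b0.
  apply: (@le_lt_trans _ _ (\int[leb]_(v in `[0%R, +oo[) (M%:E * (oneDsqr v)^-1%:E))%E).
    apply: (@le_trans _ _ (\int[leb]_(v in `[0%R, +oo[) (expR (- (v `^ b^-1 * 1)))%:E)%E).
      apply: ge0_subset_integral => //=.
      by move=> v /=; rewrite /D /= !in_itv/= !andbT; exact: ltW.
    apply: ge0_le_integral => //=.
    - by apply: measurable_funTS; apply: emeasurable_funM => //; apply/measurable_EFinP; by apply: continuous_measurable_fun; exact: continuous_oneDsqrV.
    - move=> v; rewrite in_itv/= andbT => v0; rewrite mulr1 -EFinM lee_fin; exact: hM.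
  rewrite ge0_integralZl_EFin//=; last first.
    by apply: measurable_funTS; apply/measurable_EFinP; by apply: continuous_measurable_fun; exact: continuous_oneDsqrV.
  by rewrite integral0y_oneDsqr -EFinM ltry.
have J0 : (0 < J 1%R)%E.
  have l1 : leb `]0%R, 1%R[%classic = 1%E.
    by rewrite lebesgue_measure_itv/= lte01 sube0.
  apply: (@lt_le_trans _ _ (\int[leb]_(v in `]0%R, 1%R[) (cst (expR (-1))%:E v))%E).
    by rewrite integral_cst//= l1 mule1 lte_fin expR_gt0.
  apply: (@le_trans _ _ (\int[leb]_(v in `]0%R, 1%R[) (expR (- (v `^ b^-1 * 1)))%:E)%E).
    apply: ge0_le_integral => //=.
    move=> v; rewrite in_itv/= => /andP[v0 v1]; rewrite lee_fin ler_expR lerN2 mulr1.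
    have /(le_trans _) : 1 `^ b^-1 <= 1 :> R by rewrite powR1.
    by apply; rewrite ge0_ler_powR ?invr_ge0 ?nnegrE// ltW.
  apply: ge0_subset_integral => //=.
  by move=> v /=; rewrite /D /= !in_itv/= => /andP[].
have Jscale (r : R) : 0 < r -> J r = ((r `^ (- b))%:E * J 1%R)%E.
  move=> r0; pose c := r `^ (- b).
  have c0 : 0 < c by exact: powR_gt0.
  rewrite /J integral_mkcond [in RHS]integral_mkcond (ge0_integral_lebesgue_scale c0); last 2 first.
  - by apply/(measurable_restrictT _ mD); exact: mE.
  - by move=> x; apply: erestrict_ge0 => v _; rewrite lee_fin expR_ge0.
  congr (_ * _)%E; apply: eq_integral => v _; rewrite !patchE.
  have vD : (c * v \in D) = (v \in D).
    by apply/idP/idP; rewrite !inE /D /= pmulr_rgt0.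
  rewrite vD; case: ifPn => // /[!inE] v0.
  rewrite powRM ?(ltW c0) ?(ltW v0)//.
  by rewrite -powRrM mulNr mulfV ?gt_eqF// powRN powRr1 ?ltW// mulr1 mulrAC mulVf ?mul1r ?gt_eqF.
have Jinfty : J 0 = +oo%E.
  rewrite /J; under eq_integral do rewrite mulr0 oppr0 expR0.
  rewrite integral_cst// mul1e.
  by transitivity (leb D) => //; rewrite DE lebesgue_measure_itv/= ltry.
have J1E : J 1 = (fine (J 1))%:E by rewrite fineK// ge0_fin_numE// ltW.
exists (fine (J 1)); first by rewrite -lte_fin -J1E.
move=> r r0; rewrite -/(J r); case: eqP => [->//|/eqP rn0].
by rewrite Jscale ?lt_neqAle 1?eq_sym ?rn0// J1E -EFinM mulrC.
Qed.
End one_dim.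

Section features.
Context (R : realType).
Local Notation leb := (@lebesgue_measure R).
Local Notation Rm := (measurableTypeR R).

(** Lebesgue measure on R^k, built by iterated products. All that matters about
    it is that integrals of products of functions of single coordinates factor.
    *)
Lemma lebesgue_power (k : nat) :
  exists (d : measure_display) (S : measurableType d)
    (m : {sigma_finite_measure set S -> \bar R}) (p : 'I_k -> S -> Rm),
    (forall i, measurable_fun setT (p i)) /\
    forall (g : 'I_k -> Rm -> R) (c : 'I_k -> R),
      (forall i, measurable_fun setT (g i)) -> (forall i z, 0 <= g i z) ->
      (forall i, \int[leb]_z (g i z)%:E = (c i)%:E)%E ->
      (\int[m]_s (\prod_(i < k) g i (p i s))%:E = (\prod_(i < k) c i)%:E)%E.
Proof.
elim: k => [|k [d [S [m [p [mp IH]]]]]].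
  exists _, unit, (@dirac _ _ tt R), (fun _ _ => 0); split; first by case.
  move=> g c _ _ _; rewrite !big_ord0.
  by rewrite integral_cst//= diracT mule1.
pose leb' : {sigma_finite_measure set Rm -> \bar R} := leb.
exists _, (S * Rm)%type, (sigma_prod m leb'),
  (fun i s => if unlift ord_max i is Some j then p j s.1 else s.2).
split=> [i|g c mg g0 gc].
  case: (unlift _ _) => [j|]; last exact: measurable_snd.
  by apply: measurableT_comp => //; exact: measurable_fst.
rewrite [LHS](@fubini_tonelli1 _ _ _ _ _ m leb')//=; last 2 first.
- apply/measurable_EFinP; apply: measurable_prod => i _.
  apply: measurableT_comp => //.
  case: (unlift _ _) => [j|]; last exact: measurable_snd.
  by apply: measurableT_comp => //; exact: measurable_fst.
- by move=> z; rewrite lee_fin prodr_ge0.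
rewrite /fubini_F/=.
transitivity (\int[m]_x ((\prod_(i < k) g (lift ord_max i) (p i x))%:E * (c ord_max)%:E))%E.
  apply: eq_integral => x _.
  rewrite -gc -ge0_integralZl_EFin//=; last 3 first.
  - by move=> z _; rewrite lee_fin.
  - by apply/measurable_EFinP.
  - exact: prodr_ge0.
  apply: eq_integral => z _; rewrite -EFinM big_ord_recr/= unlift_none.
  congr (_ * _)%:E; apply: eq_bigr => i _.
  by rewrite (_ : widen_ord _ i = lift ord_max i) ?liftK//; apply: val_inj; rewrite /= /bump leqNgt ltn_ord.
rewrite ge0_integralZr//=; last 3 first.
- apply/measurable_EFinP; apply: measurable_prod => i _.
  exact: measurableT_comp.
- by move=> x _; rewrite lee_fin prodr_ge0.
- by rewrite -gc; apply: integral_ge0 => z _; rewrite lee_fin.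
rewrite (IH (fun i => g (lift ord_max i)) (fun i => c (lift ord_max i)))//.
rewrite -EFinM big_ord_recr/=; congr (_ * _)%:E.
apply: eq_bigr => i _; congr c; apply: val_inj.
by rewrite /= /bump leqNgt ltn_ord.
Qed.

(** A feature space for the Riesz kernel. The kernel identity makes energies
    into squared L^2 norms; the weight [fwt] expresses the total mass of a
    measure through its transform; continuity and decay in x make transforms
    continuous for vague convergence. *)
Record riesz_features (n : nat) (alpha : R) := RieszFeatures {
  fdisp : measure_display;
  fspace : measurableType fdisp;
  fmu : {sigma_finite_measure set fspace -> \bar R};
  feat : Rn R n -> fspace -> R;
  fwt : fspace -> R;
  feat_ge0 : forall x s, 0 <= feat x s;
  measurable_feat : measurable_fun setT (fun z : Rn R n * fspace => feat z.1 z.2);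
  continuous_feat : forall s, continuous (feat ^~ s);
  feat_at_infinity : forall s (e : R), 0 < e ->
    exists M : R, forall x, M < enorm x -> feat x s <= e;
  feat_kernel : forall x y,
    (\int[fmu]_s (feat x s * feat y s)%:E = riesz_kernel alpha x y)%E;
  fwt_ge0 : forall s, 0 <= fwt s;
  measurable_fwt : measurable_fun setT fwt;
  fwt_total : forall x, (\int[fmu]_s (feat x s * fwt s)%:E = 1)%E }.

End features.
Arguments feat {R n alpha} r x s.
Arguments fwt {R n alpha} r s.
Arguments fmu {R n alpha} r.
Arguments fspace {R n alpha} r.
Arguments feat_kernel {R n alpha} r x y.
Arguments fwt_total {R n alpha} r x.
Arguments measurable_feat {R n alpha} r.
Arguments measurable_fwt {R n alpha} r.

Section features_exist.
Context (R : realType).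
Local Notation leb := (@lebesgue_measure R).
Local Notation Rm := (measurableTypeR R).

(** Completing the square: [(x - z)^2 + (y - z)^2 = (x - y)^2 / 2 + 2 ((x + y) /
    2 - z)^2]. *)
Lemma gauss_convolution (t x y : R) : 0 < t ->
  (\int[leb]_z (expR (- (2 * t * (x - z) ^+ 2)) * expR (- (2 * t * (y - z) ^+ 2)))%:E
   = (Num.sqrt (pi / 4) / Num.sqrt t * expR (- (t * (x - y) ^+ 2)))%:E)%E.
Proof.
move=> t0.
under eq_integral => z _.
  rewrite -expRD (_ : _ + _ = - (t * (x - y) ^+ 2) - 4 * t * ((x + y) / 2 - z) ^+ 2); last by field.
  rewrite expRD EFinM; over.
rewrite ge0_integralZl_EFin//=; last first.
  apply/measurable_EFinP; apply: measurableT_comp => //=.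
  apply: measurableT_comp => //=; apply: measurable_funM => //=.
  by apply: measurable_funX; apply: measurable_funB.
rewrite gauss_integral_shift ?mulr_gt0// -EFinM mulrC; congr (_ * _)%:E.
by rewrite -sqrtrV ?ltW// -sqrtrM ?divr_ge0 ?pi_ge0// invfM mulrA.
Qed.

(** The feature space is R^n x ]0, +oo[ and the feature at (u, v) is a multiple
    of [exp (- 2 t |x - u|^2)] with [t = v `^ b^-1] and [b = (n - alpha) / 2].
    Integrating the product of two features over u gives a multiple of [exp (- t
    |x - y|^2)], and integrating over v gives [|x - y|^(- 2 b)], which is the
    Riesz kernel. The weight is supported on v in [1, 2], where the integral
    over u of a feature is explicit. *)
Lemma riesz_features_exist (n : nat) (alpha : R) : 0 < alpha -> alpha < n%:R ->
  inhabited (riesz_features n alpha).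
Proof.
move=> alpha0 alphan; pose b := (n%:R - alpha) / 2.
have b0 : 0 < b by rewrite divr_gt0// subr_gt0.
have [C C0 radial] := riesz_radial b0.
have [d [S [m [p [mp prodE]]]]] := lebesgue_power R n.
pose t (v : R) := v `^ b^-1.
pose s1 : R := Num.sqrt (pi / 4). pose s2 : R := Num.sqrt (pi / 2).
have s10 : 0 < s1 by rewrite sqrtr_gt0 divr_gt0// pi_gt0.
have s20 : 0 < s2 by rewrite sqrtr_gt0 divr_gt0// pi_gt0.
(* e v is the normalization that cancels the factor t^(- n / 2) of the Gaussian
   integral over u; see e2 *)
pose e (v : R) := v `^ (n%:R / (4 * b)).
pose a0 : R := Num.sqrt (C * s1 ^+ n)^-1.
have C1 : 0 < C * s1 ^+ n by rewrite mulr_gt0// exprn_gt0.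
have a00 : 0 < a0 by rewrite sqrtr_gt0 invr_gt0.
have a02 : a0 ^+ 2 = (C * s1 ^+ n)^-1 by rewrite sqr_sqrtr// invr_ge0 ltW.
have t_gt0 v : 0 < v -> 0 < t v by move=> v0; exact: powR_gt0.
have e_gt0 v : 0 < v -> 0 < e v by move=> v0; exact: powR_gt0.
have e2 v : 0 < v -> Num.sqrt (t v) ^+ n = e v ^+ 2.
  move=> v0; rewrite -powR12_sqrt ?powR_ge0// -powR_mulrn ?powR_ge0// -powRrM /t -powRrM.
  rewrite /e -powR_mulrn ?powR_ge0// -powRrM; congr (_ `^ _).
  by field; rewrite gt_eqF.
pose D : set R := [set x : R | 0 < x].
have DE : D = `]0, +oo[%classic.
  by apply/seteqP; split=> x; rewrite /D /= in_itv/= andbT.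
have mD : measurable (D : set Rm) by rewrite DE; exact: measurable_itv.
(* with this constant the weighted integral over u is 1 for each v in [1, 2] *)
pose w0 := (a0 * s2 ^+ n)^-1.
pose D12 : set R := `[1, 2]%classic.
have mD12 : measurable (D12 : set Rm) by exact: measurable_itv.
pose q (x : Rn R n) (s : S * Rm) := \sum_(i < n) (x ord0 i - p i s.1) ^+ 2.
pose phi (x : Rn R n) (s : S * Rm) : R :=
  \1_D s.2 * (a0 * e s.2 * expR (- (2 * t s.2 * q x s))).
pose wt (s : S * Rm) : R := \1_D12 s.2 * (w0 * e s.2).
have phiE x s v : 0 < v -> phi x (s, v) = a0 * e v *
    \prod_(i < n) expR (- (2 * t v * (x ord0 i - p i s) ^+ 2)).
  move=> v0; rewrite /phi indicE mem_set// mul1r; congr (_ * _).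
  by rewrite /q/= -expR_sum sumrN -mulr_sumr.
have phi0 x s v : v <= 0 -> phi x (s, v) = 0.
  by move=> v0; rewrite /phi indicE memNset ?mul0r// /D /= ltNge v0.
have phi_ge0 x s : 0 <= phi x s.
  by rewrite /phi !mulr_ge0 ?expR_ge0 ?powR_ge0// ltW.
have wt_ge0 s : 0 <= wt s.
  by rewrite /wt !mulr_ge0 ?powR_ge0// invr_ge0 mulr_ge0 ?exprn_ge0// ltW.
have me : measurable_fun setT (e : Rm -> Rm) by exact: measurable_powR.
have mt : measurable_fun setT (t : Rm -> Rm) by exact: measurable_powR.
have mq : measurable_fun setT (fun z : Rn R n * (S * Rm) => q z.1 z.2).
  apply: measurable_sum => i; apply: measurable_funX; apply: measurable_funB.
    by apply: (measurableT_comp (continuous_Rn_measurable (@coord_continuous_Rn R n i))); exact: measurable_fst.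
  by apply: (measurableT_comp (mp i)); apply: measurableT_comp; [exact: measurable_fst|exact: measurable_snd].
have m2 : measurable_fun setT (fun z : Rn R n * (S * Rm) => z.2.2).
  by apply: (@measurableT_comp _ _ _ _ _ _ (@snd S Rm)); exact: measurable_snd.
have mphi : measurable_fun setT (fun z : Rn R n * (S * Rm) => phi z.1 z.2).
  rewrite /phi; apply: measurable_funM.
    by apply: (measurableT_comp (f := (\1_D : Rm -> R))) => //; exact: measurable_indic.
  apply: measurable_funM.
    by apply: measurable_funM => //; exact: (measurableT_comp me).
  apply: measurableT_comp => //; apply: measurableT_comp => //.
  apply: measurable_funM => //; apply: measurable_funM => //.
  exact: (measurableT_comp mt).
have mphix x : measurable_fun setT (phi x).
  have := measurableT_comp mphi (measurable_pair1 x).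
  exact.
have mwt : measurable_fun setT wt.
  rewrite /wt; apply: measurable_funM.
    by apply: (measurableT_comp (f := (\1_D12 : Rm -> R))) => //; exact: measurable_indic.
  by apply: measurable_funM => //; apply: (measurableT_comp me); exact: measurable_snd.
have mg (v c : R) : measurable_fun setT (fun z : Rm => expR (- (v * (c - z) ^+ 2))).
  apply: measurableT_comp => //=; apply: measurableT_comp => //=.
  by apply: measurable_funM => //=; apply: measurable_funX; apply: measurable_funB.
have kernelE x y : (\int[m \x leb]_s (phi x s * phi y s)%:E = riesz_kernel alpha x y)%E.
  rewrite fubini_tonelli2//=; last 2 first.
  - by apply/measurable_EFinP; apply: measurable_funM.
  - by move=> s; rewrite lee_fin mulr_ge0.
  rewrite /fubini_G.
  pose r := \sum_(i < n) (x ord0 i - y ord0 i) ^+ 2.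
  have rE : r = enorm (x - y) ^+ 2.
    by rewrite enorm_sqr; apply: eq_bigr => i _; rewrite !mxE.
  have r0 : 0 <= r by rewrite rE sqr_ge0.
  transitivity (\int[leb]_(v in D) (C^-1%:E * (expR (- (t v * r)))%:E))%E.
    rewrite [RHS]integral_mkcond; apply: eq_integral => v _; rewrite patchE.
    case: ifPn => [|/negP vD]; last first.
      apply: integral0_eq => s _; rewrite phi0 ?mul0r//.
      by rewrite leNgt; apply/negP => v0; apply: vD; rewrite inE.
    rewrite inE /D/= => v0.
    under eq_integral => s _ do rewrite !phiE// mulrACA -big_split/= EFinM.
    rewrite ge0_integralZl_EFin//=; last 3 first.
    - by move=> s _; rewrite lee_fin prodr_ge0// => i _; rewrite mulr_ge0// expR_ge0.
    - apply/measurable_EFinP; apply: measurable_prod => i _; apply: measurable_funM;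
        exact: (measurableT_comp (mg _ _) (mp i)).
    - by rewrite !mulr_ge0 ?powR_ge0// ltW.
    rewrite (prodE (fun i z => expR (- (2 * t v * (x ord0 i - z) ^+ 2)) * expR (- (2 * t v * (y ord0 i - z) ^+ 2)))
      (fun i => s1 / Num.sqrt (t v) * expR (- (t v * (x ord0 i - y ord0 i) ^+ 2)))); last 3 first.
    - by move=> i; apply: measurable_funM.
    - by move=> i z; rewrite mulr_ge0// expR_ge0.
    - by move=> i; apply: gauss_convolution; exact: t_gt0.
    rewrite -!EFinM big_split/= -expR_sum sumrN -mulr_sumr -/r prodr_const card_ord.
    rewrite mulrA; congr (_ * _)%:E.
    have ev0 := e_gt0 _ v0.
    have -> : a0 * e v * (a0 * e v) = (C * s1 ^+ n)^-1 * e v ^+ 2.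
      by rewrite mulrACA -!expr2 a02.
    rewrite expr_div_n e2//.
    by field; rewrite !gt_eqF ?exprn_gt0.
  rewrite ge0_integralZl_EFin//=; last 2 first.
  - apply: measurable_funTS; apply/measurable_EFinP; apply: measurableT_comp => //.
    by apply: measurableT_comp => //; apply: measurable_funM => //.
  - by rewrite invr_ge0 ltW.
  rewrite radial// /riesz_kernel rE sqrf_eq0 enorm_sub_eq0.
  case: eqP => _; first by rewrite gt0_muley// lte_fin invr_gt0.
  rewrite -EFinM mulKf ?gt_eqF//; congr (_%:E).
  rewrite -powR_mulrn ?enorm_ge0// -powRrM; congr (_ `^ _).
  by rewrite /b; field.
have wtE x : (\int[m \x leb]_s (phi x s * wt s)%:E = 1)%E.
  rewrite fubini_tonelli2//=; last 2 first.
  - by apply/measurable_EFinP; apply: measurable_funM.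
  - by move=> s; rewrite lee_fin mulr_ge0.
  rewrite /fubini_G.
  transitivity (\int[leb]_(v in D12) 1)%E; last first.
    rewrite integral_cst//= mul1e lebesgue_measure_itv/= lte_fin ltr1n.
    by rewrite -EFinD; congr (_%:E); ring.
  rewrite [RHS]integral_mkcond; apply: eq_integral => v _; rewrite patchE.
  case: ifPn => [|/negP vD]; last first.
    apply: integral0_eq => s _; rewrite /wt/= indicE memNset ?mul0r ?mulr0//.
    by move=> vD'; apply: vD; rewrite inE.
  rewrite inE => v12; have := v12; rewrite /D12/= in_itv/= => /andP[v1 _].
  have v0 : 0 < v by exact: lt_le_trans v1.
  under eq_integral => s _.
    rewrite (_ : phi x (s, v) * wt (s, v) = a0 * e v * (w0 * e v) *
        \prod_(i < n) expR (- (2 * t v * (x ord0 i - p i s) ^+ 2))); last first.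
      by rewrite phiE// /wt/= indicE (mem_set v12) mul1r mulrAC.
    rewrite EFinM.
    over.
  rewrite ge0_integralZl_EFin//=; last 3 first.
  - by move=> s _; rewrite lee_fin prodr_ge0// => i _; rewrite expR_ge0.
  - by apply/measurable_EFinP; apply: measurable_prod => i _; exact: (measurableT_comp (mg _ _) (mp i)).
  - by rewrite !mulr_ge0 ?powR_ge0// ?invr_ge0 ?mulr_ge0 ?exprn_ge0// ltW.
  rewrite (prodE (fun i z => expR (- (2 * t v * (x ord0 i - z) ^+ 2)))
      (fun i => s2 / Num.sqrt (t v))); last 3 first.
  - by move=> i; exact: mg.
  - by move=> i z; exact: expR_ge0.
  - move=> i; rewrite gauss_integral_shift ?mulr_gt0 ?t_gt0//; congr (_%:E).
    by rewrite invfM mulrA sqrtrM ?divr_ge0 ?pi_ge0// sqrtrV// ltW// t_gt0.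
  rewrite -EFinM prodr_const card_ord expr_div_n e2//; congr (_%:E).
  have ev0 := e_gt0 _ v0; have s2n : 0 < s2 ^+ n by rewrite exprn_gt0.
  by rewrite /w0; field; rewrite !gt_eqF.
have cphi s : continuous (phi ^~ s).
  have cq : continuous (q ^~ s).
    apply: continuous_sum => i x.
    apply: (continuous_comp (@coord_continuous_Rn R n i x)
      (g := fun y : R => (y - p i s.1) ^+ 2)).
    apply: (continuous_comp (f := fun y : R => y - p i s.1) (g := fun y : R => y ^+ 2)).
      by apply: cvgB; [exact: cvg_id|exact: cvg_cst].
    exact: exprn_continuous.
  have cg : continuous (fun y : R => \1_D s.2 * (a0 * e s.2 * expR (- (2 * t s.2 * y)))).
    move=> y; apply: cvgM; first exact: cvg_cst.
    apply: cvgM; first exact: cvg_cst.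
    have c1 : continuous (fun y : R => - (2 * t s.2 * y)).
      by move=> z; apply: cvgN; apply: cvgM; [exact: cvg_cst|exact: cvg_id].
    exact: (continuous_comp (c1 y) (@continuous_expR R _)).
  by move=> x; exact: (continuous_comp (cq x) (cg _)).
have phi_inf s (ep : R) : 0 < ep -> exists M : R, forall x, M < enorm x -> phi x s <= ep.
  move=> ep0; case: s => s v; have [v0|v0] := leP v 0.
    by exists 0 => x _; rewrite phi0// ltW.
  have tv0 := t_gt0 _ v0; have ev0 := e_gt0 _ v0.
  pose P := \sum_(i < n) (p i s) ^+ 2.
  pose B := a0 * e v * expR (2 * t v * P).
  have B0 : 0 < B by rewrite !mulr_gt0// expR_gt0.
  exists (Num.max 1 (B / (t v * ep))) => x; rewrite gt_max => /andP[x1 xB].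
  have qle : enorm x ^+ 2 / 2 - P <= q x (s, v).
    rewrite enorm_sqr /P /q mulr_suml -sumrB; apply: ler_sum => i _.
    rewrite -subr_ge0 (_ : _ - _ = (x ord0 i - 2 * p i s) ^+ 2 / 2); last by field.
    by rewrite divr_ge0// sqr_ge0.
  have x2 : B / (t v * ep) <= enorm x ^+ 2.
    rewrite (le_trans (ltW xB))// expr2 ler_peMl ?enorm_ge0//; exact: ltW.
  rewrite /phi/= indicE mem_set// mul1r.
  apply: (@le_trans _ _ (B * expR (- (t v * enorm x ^+ 2)))).
    rewrite /B -[leRHS]mulrA -expRD ler_pM2l ?mulr_gt0// ler_expR.
    have : t v * (enorm x ^+ 2 / 2 - P) <= t v * q x (s, v) by rewrite ler_pM2l.
    by lra.
  rewrite expRN ler_pdivrMr ?expR_gt0//.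
  have := expR_ge1Dx (t v * enorm x ^+ 2).
  rewrite ler_pdivrMr ?mulr_gt0// in x2.
  move=> hh; apply: (@le_trans _ _ (ep * (t v * enorm x ^+ 2))); first by lra.
  by rewrite ler_pM2l//; lra.
constructor.
exact: (@RieszFeatures R n alpha _ (S * Rm)%type (sigma_prod m leb) phi wt
  phi_ge0 mphi cphi phi_inf kernelE wt_ge0 mwt wtE).
Qed.
End features_exist.

(** * Vague limits along an ultrafilter *)

Section ultra.
Context (R : realType) (U : set_system nat) {UU : UltraFilter U}.
Implicit Types u v : nat -> R.

Lemma ultra_bounded_cvg u (a b : R) :
  (forall k, a <= u k <= b) -> exists2 l, a <= l <= b & u @ U --> l.
Proof.
move=> ub.
have FF : ProperFilter (u @ U) by apply: fmap_proper_filter.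
have Fab : (u @ U) `[a, b]%classic.
  by apply: (@filterE _ U) => k; rewrite /= in_itv/=; have := ub k.
have [l [lab cl]] := @segment_compact R a b (u @ U) FF Fab.
exists l; first by move: lab; rewrite /= in_itv.
move=> V Vl /=.
have [//|UV] := in_ultra_setVsetC (u @^-1` V) UU.
have UV' : (u @ U) (~` V) by [].
by have [x [? ?]] := cl _ _ UV' Vl.
Qed.

Definition ulim u : R := lim (u @ U).

Lemma ulim_cvg u (a b : R) : (forall k, a <= u k <= b) -> u @ U --> ulim u.
Proof.
move=> /ultra_bounded_cvg[l _ ul].
by rewrite /ulim (cvg_lim _ ul).
Qed.

Lemma ulim_eq u l : u @ U --> l -> ulim u = l.
Proof. by move=> /cvg_lim; apply. Qed.

End ultra.

Section limit_measure.
Context (R : realType) (n : nat) (U : set_system nat) {UU : UltraFilter U}.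
Variable mu_ : nat -> radon R n.
Hypothesis mu_le1 : forall k, (mu_ k setT <= 1)%E.
Local Notation T := (Rn R n).

Let mass k (E : set T) : R := fine (mu_ k E).

(** Limits along an ultrafilter exist for all bounded sequences, so this is a
    finitely additive content without passing to subsequences. It need not be
    countably additive; the Radon measure is obtained from it by inner
    regularization on compact sets and outer regularization on open sets. *)
Definition ucontent (E : set T) : R := ulim U (mass ^~ E).

Lemma mass_bounds k (E : set T) : measurable E -> 0 <= mass k E <= 1.
Proof.
move=> mE; rewrite /mass fine_ge0//=.
have h : (mu_ k E <= 1)%E.
  by apply: le_trans (mu_le1 k); apply: le_measure; rewrite ?inE.
by rewrite -lee_fin fineK// ge0_fin_numE// (le_lt_trans h)// ltry.
Qed.

Lemma massK k (E : set T) : measurable E -> ((mass k E)%:E = mu_ k E)%E.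
Proof.
move=> mE; rewrite /mass fineK// ge0_fin_numE//.
apply: (@le_lt_trans _ _ 1%E); last exact: ltry.
by apply: le_trans (mu_le1 k); apply: le_measure; rewrite ?inE.
Qed.

Lemma ucontent_cvg (E : set T) : measurable E -> mass ^~ E @ U --> ucontent E.
Proof. by move=> mE; apply: (@ulim_cvg _ _ _ _ 0 1) => k; exact: mass_bounds. Qed.

Lemma ucontent_ge0 (E : set T) : measurable E -> 0 <= ucontent E.
Proof.
move=> mE; apply: (ler_cvg_to (cvg_cst (0 : R)) (ucontent_cvg mE)).
by apply: filterE => k; have /andP[] := mass_bounds k mE.
Qed.

Lemma ucontent_le1 (E : set T) : measurable E -> ucontent E <= 1.
Proof.
move=> mE; apply: (ler_cvg_to (ucontent_cvg mE) (cvg_cst (1 : R))).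
by apply: filterE => k; have /andP[] := mass_bounds k mE.
Qed.

Lemma le_ucontent (E F : set T) : measurable E -> measurable F -> E `<=` F ->
  ucontent E <= ucontent F.
Proof.
move=> mE mF EF; apply: (ler_cvg_to (ucontent_cvg mE) (ucontent_cvg mF)).
apply: filterE => k; rewrite -lee_fin !massK//; apply: le_measure; rewrite ?inE//.
Qed.

Lemma ucontentU (E F : set T) : measurable E -> measurable F ->
  ucontent (E `|` F) <= ucontent E + ucontent F.
Proof.
move=> mE mF; apply: (ler_cvg_to (ucontent_cvg (measurableU _ _ mE mF)) (cvgD (ucontent_cvg mE) (ucontent_cvg mF))).
apply: filterE => k; rewrite -lee_fin EFinD !massK//; last exact: measurableU.
exact: measureU2.
Qed.

Lemma ucontent_disjU (E F : set T) : measurable E -> measurable F -> E `&` F = set0 ->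
  ucontent (E `|` F) = ucontent E + ucontent F.
Proof.
move=> mE mF EF0.
apply: ulim_eq; rewrite (_ : mass ^~ _ = (mass ^~ E) \+ (mass ^~ F)).
  exact: cvgD (ucontent_cvg mE) (ucontent_cvg mF).
apply/funext => k /=; apply: EFin_inj; rewrite EFinD !massK//; last exact: measurableU.
exact: measureU.
Qed.

Let cptm (K : set T) : compact K -> measurable K.
Proof. by move=> cK; apply: closed_Rn_measurable; apply: compact_closed. Qed.

Definition open_content (W : set T) : \bar R :=
  ereal_sup [set (ucontent K)%:E | K in [set K | compact K /\ K `<=` W]].

Lemma open_content_ge0 W : (0 <= open_content W)%E.
Proof.
apply: (@le_trans _ _ (ucontent set0)%:E); last first.
  by apply: ereal_sup_ubound; exists set0 => //; split => //; exact: compact0.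
by rewrite lee_fin ucontent_ge0.
Qed.

Lemma open_content_le W : open W -> (open_content W <= (ucontent W)%:E)%E.
Proof.
move=> oW; apply: ub_ereal_sup => _ [K [cK KW] <-]; rewrite lee_fin.
by apply: le_ucontent => //; [exact: cptm|exact: open_Rn_measurable].
Qed.

Lemma le_open_content W V : W `<=` V -> (open_content W <= open_content V)%E.
Proof.
move=> WV; apply: ub_ereal_sup => _ [K [cK KW] <-].
by apply: ereal_sup_ubound; exists K => //; split => //; exact: subset_trans WV.
Qed.

(** Normality separates the two parts of K that miss one of the open sets. *)
Lemma compact_split (K W V : set T) : compact K -> open W -> open V -> K `<=` W `|` V ->
  exists K1 K2, [/\ compact K1, compact K2, K1 `<=` W, K2 `<=` V & K = K1 `|` K2].
Proof.
move=> cK oW oV KWV.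
have clK : closed K by exact: compact_closed.
have c1 : closed (K `&` ~` W) by apply: closedI => //; exact: open_closedC.
have c2 : closed (K `&` ~` V) by apply: closedI => //; exact: open_closedC.
have d12 : (K `&` ~` W) `&` (K `&` ~` V) = set0.
  by rewrite -subset0 => x [[Kx nW] [_ nV]]; have [] := KWV _ Kx.
have [Q1 [Q2 [oO1 oO2 h1 h2 O12]]] :=
  (@normal_openP R _).1 (@pseudometric_normal R T) _ _ c1 c2 d12.
exists (K `&` ~` Q1), (K `&` ~` Q2); split.
- by apply: (subclosed_compact _ cK); [apply: closedI => //; exact: open_closedC|exact: subIsetl].
- by apply: (subclosed_compact _ cK); [apply: closedI => //; exact: open_closedC|exact: subIsetl].
- by move=> x [Kx nO]; apply: contrapT => nW; apply: nO; apply: h1.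
- by move=> x [Kx nO]; apply: contrapT => nW; apply: nO; apply: h2.
- by rewrite -setIUr -setCI O12 setC0 setIT.
Qed.

(** Inner regular contents are subadditive on open sets because a compact subset
    of a union splits into compact subsets of its members. *)
Lemma open_contentU W V : open W -> open V ->
  (open_content (W `|` V) <= open_content W + open_content V)%E.
Proof.
move=> oW oV; apply: ub_ereal_sup => _ [K [cK KWV] <-].
have [K1 [K2 [cK1 cK2 K1W K2V ->]]] := compact_split cK oW oV KWV.
apply: (@le_trans _ _ ((ucontent K1)%:E + (ucontent K2)%:E)%E).
  by rewrite -EFinD lee_fin ucontentU//; exact: cptm.
by apply: leeD; apply: ereal_sup_ubound; [exists K1|exists K2].
Qed.

Lemma open_content_bigcup (W : nat -> set T) : (forall i, open (W i)) ->
  (open_content (\bigcup_i W i) <= \sum_(i <oo) open_content (W i))%E.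
Proof.
move=> oW; apply: ub_ereal_sup => _ [K [cK KW] <-].
move: (cK); rewrite compact_cover => /(_ nat setT W (fun i _ => oW i)).
move=> /(_ KW)[D _ KD].
pose N := (\max_(i <- finmap.enum_fset D) i).+1.
have KN : K `<=` \big[setU/set0]_(i < N) W i.
  move=> x /KD[i /= iD Wix]; rewrite -bigcup_mkord; exists i => //=.
  by rewrite /N ltnS; apply: leq_bigmax_seq.
have fin m : open (\big[setU/set0]_(i < m) W i) /\
    (open_content (\big[setU/set0]_(i < m) W i) <= \sum_(i < m) open_content (W i))%E.
  elim: m => [|m [om IH]]; rewrite ?big_ord0 ?big_ord_recr/=.
    split; first exact: open0.
    apply: (le_trans (open_content_le open0)); rewrite lee_fin.
    by apply: (ler_cvg_to (ucontent_cvg measurable0) (cvg_cst (0 : R))); apply: filterE => k; rewrite /mass measure0.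
  split; first exact: openU.
  by apply: (le_trans (open_contentU om (oW m))); rewrite leeD2r.
apply: (@le_trans _ _ (open_content (\big[setU/set0]_(i < N) W i))).
  by apply: ereal_sup_ubound; exists K.
apply: (le_trans (fin N).2).
rewrite -(big_mkord xpredT (fun i => open_content (W i))).
by apply: nneseries_lim_ge => i _ _; exact: open_content_ge0.
Qed.

Definition outer_content (E : set T) : \bar R :=
  ereal_inf [set open_content W | W in [set W | open W /\ E `<=` W]].

Lemma outer_content_open W : open W -> outer_content W = open_content W.
Proof.
move=> oW; apply/eqP; rewrite eq_le; apply/andP; split.
  by apply: ereal_inf_lbound; exists W => //; split.
by apply: le_ereal_inf_tmp => _ [V [oV WV] <-]; exact: le_open_content.
Qed.

Lemma outer_content_ge0 E : (0 <= outer_content E)%E.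
Proof. by apply: le_ereal_inf_tmp => _ [V _ <-]; exact: open_content_ge0. Qed.

Lemma outer_content0 : outer_content set0 = 0%E.
Proof.
apply/eqP; rewrite eq_le outer_content_ge0 andbT outer_content_open; last exact: open0.
apply: (le_trans (open_content_le open0)); rewrite lee_fin.
by apply: (ler_cvg_to (ucontent_cvg measurable0) (cvg_cst (0 : R))); apply: filterE => k; rewrite /mass measure0.
Qed.

Lemma le_outer_content : {homo outer_content : A B / A `<=` B >-> (A <= B)%E}.
Proof.
move=> A B AB; apply: le_ereal_inf_tmp => _ [V [oV BV] <-].
by apply: ereal_inf_lbound; exists V => //; split=> //; exact: subset_trans BV.
Qed.

Lemma outer_content_fin E : outer_content E \is a fin_num.
Proof.
rewrite ge0_fin_numE ?outer_content_ge0//.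
apply: (@le_lt_trans _ _ (outer_content setT)); first exact: le_outer_content.
rewrite outer_content_open; last exact: openT.
by apply: (le_lt_trans (open_content_le openT)); rewrite ltry.
Qed.

Lemma outer_content_sigma_subadditive : sigma_subadditive outer_content.
Proof.
move=> F; apply/lee_addgt0Pr => e e0.
have hW i : exists W, [/\ open W, F i `<=` W &
    (open_content W <= outer_content (F i) + (e / (2 ^ i.+1)%:R)%:E)%E].
  have ei : 0 < e / (2 ^ i.+1)%:R by rewrite divr_gt0// ltr0n expn_gt0.
  have [_ [W [oW FW] <-] hW] := lb_ereal_inf_adherent ei (outer_content_fin (F i)).
  by exists W; split => //; exact: ltW.
pose W i := projT1 (cid (hW i)).
have WP i := projT2 (cid (hW i)).
apply: (@le_trans _ _ (open_content (\bigcup_i W i))).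
  rewrite -outer_content_open; last by apply: bigcup_open => i _; have [] := WP i.
  apply: le_outer_content; apply: subset_bigcup => i _; by have [] := WP i.
apply: (le_trans (open_content_bigcup _)); first by move=> i; have [] := WP i.
apply: (@le_trans _ _ (\sum_(i <oo) (outer_content (F i) + (e / (2 ^ i.+1)%:R)%:E))%E).
  by apply: lee_nneseries => i _ *; rewrite ?open_content_ge0//; have [] := WP i.
by apply: (epsilon_trick xpredT (fun i => outer_content_ge0 (F i)) (ltW e0)).
Qed.

HB.instance Definition _ := isOuterMeasure.Build R T outer_content
  outer_content0 outer_content_ge0 le_outer_content outer_content_sigma_subadditive.

(** Take a compact K nearly exhausting the part of V inside W, then a compact L
    nearly exhausting V minus K. They are disjoint, so their contents add up to
    at most that of V. *)
Lemma open_caratheodory W : open W -> outer_content.-caratheodory W.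
Proof.
move=> oW; apply: le_caratheodory_measurable => X.
apply: le_ereal_inf_tmp => _ [V [oV XV] <-].
apply: (@le_trans _ _ (outer_content (V `&` W) + outer_content (V `&` ~` W))%E).
  by apply: leeD; apply: le_outer_content; exact: setSI.
apply/lee_addgt0Pr => e e0.
have e2 : 0 < e / 2 by rewrite divr_gt0.
have oVW : open (V `&` W) by exact: openI.
have VWfin : open_content (V `&` W) \is a fin_num.
  by rewrite -outer_content_open// outer_content_fin.
have [_ [K [cK KVW] <-] hK] := ub_ereal_sup_adherent e2 VWfin.
have clK : closed K by exact: compact_closed.
have oVK : open (V `&` ~` K) by apply: openI => //; exact: closed_openC.
have VKfin : open_content (V `&` ~` K) \is a fin_num.
  by rewrite -outer_content_open// outer_content_fin.
have [_ [L [cL LVK] <-] hL] := ub_ereal_sup_adherent e2 VKfin.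
have KL : ucontent (K `|` L) = ucontent K + ucontent L.
  apply: ucontent_disjU; [exact: cptm|exact: cptm|].
  by rewrite -subset0 => x [Kx /LVK[]].
have hV : ((ucontent K + ucontent L)%:E <= open_content V)%E.
  rewrite -KL; apply: ereal_sup_ubound; exists (K `|` L) => //; split.
    exact: compactU.
  by move=> x [/KVW[]|/LVK[]].
rewrite outer_content_open//.
have h2 : (outer_content (V `&` ~` W) <= open_content (V `&` ~` K))%E.
  rewrite -outer_content_open//; apply: le_outer_content.
  by move=> x [Vx Wx]; split=> // /KVW[].
apply: (le_trans (leeD2l _ h2)).
apply: (@le_trans _ _ ((ucontent K + ucontent L)%:E + e%:E)%E); last by rewrite leeD2r.
move: hK hL; rewrite -/(open_content (V `&` W)) -/(open_content (V `&` ~` K)).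
rewrite -(fineK VWfin) -(fineK VKfin) -!EFinD !lte_fin lee_fin; lra.
Qed.

Lemma borel_caratheodory (B : set T) : measurable B -> outer_content.-caratheodory B.
Proof.
move=> mB.
pose C : set (set T) := outer_content.-caratheodory.
suff : measurable `<=` C by exact.
apply: smallest_sub; last by move=> W; exact: open_caratheodory.
split => [|A mA|F mF].
- exact: caratheodory_measurable_set0.
- by rewrite setTD; exact: caratheodory_measurable_setC.
- exact: caratheodory_measurable_bigcup.
Qed.

Lemma outer_content_semi_sigma_additive :
  semi_sigma_additive (outer_content : set T -> \bar R).
Proof.
move=> F mF tF mUF.
apply: (@caratheodory_measure_sigma_additive R T outer_content F) => //.
- by move=> i; exact: borel_caratheodory.
- exact: borel_caratheodory.
Qed.

(** The hypotheses are arguments so that the measure structure below can be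
    attached to this constant. *)
Definition limit_measure of UltraFilter U & (forall k, (mu_ k setT <= 1)%E) :=
  outer_content : set T -> \bar R.
Local Notation lim_mu := (limit_measure UU mu_le1).

HB.instance Definition _ := isMeasure.Build _ T R lim_mu
  outer_content0 outer_content_ge0 outer_content_semi_sigma_additive.

Lemma limit_measure_compact_fin (K : set T) : compact K -> (lim_mu K < +oo)%E.
Proof. by move=> _; rewrite -ge0_fin_numE ?outer_content_ge0// outer_content_fin. Qed.

HB.instance Definition _ :=
  @Measure_isRadon.Build R n lim_mu limit_measure_compact_fin.

(** The two inequalities are the portmanteau form of vague convergence. Mass may
    be lost at infinity, so no equality is available on the whole space. *)
Lemma vague_limit_exists : exists mu : radon R n,
  (forall K, compact K -> ((ucontent K)%:E <= mu K)%E) /\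
  (forall W, open W -> (mu W <= (ucontent W)%:E)%E).
Proof.
exists lim_mu; split=> [K cK|W oW].
  apply: le_ereal_inf_tmp => _ [V [oV KV] <-].
  by apply: ereal_sup_ubound; exists K.
rewrite [leLHS](_ : _ = outer_content W)// outer_content_open//.
exact: open_content_le.
Qed.

End limit_measure.

(** * Integrals along vague limits *)

Section staircase.
Context (R : realType).

Lemma cvg_sum_ord (I : Type) (F : set_system I) {FF : Filter F} (N : nat)
    (f : 'I_N -> I -> R) (l : 'I_N -> R) :
  (forall i, f i x @[x --> F] --> l i) ->
  \sum_(i < N) f i x @[x --> F] --> \sum_(i < N) l i.
Proof.
move=> fl; elim: N f l fl => [|N IH] f l fl.
  rewrite big_ord0; under eq_fun do rewrite big_ord0; exact: cvg_cst.
rewrite big_ord_recr; under eq_fun do rewrite big_ord_recr.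
by apply: cvgD => //; exact: IH.
Qed.

(** The layer-cake sum with step d, in terms of closed superlevel sets. Its
    terms are increasing multiples of d until y is reached, and zero afterwards.
    *)
Lemma staircase_le (d : R) (N : nat) (y : R) : 0 < d -> 0 <= y -> y < N%:R * d ->
  let S := \sum_(i < N) d * ((i.+1%:R * d <= y)%R)%:R in S <= y <= S + d.
Proof.
move=> d0 y0.
have H m : (m%:R * d <= y -> \sum_(i < m) d * ((i.+1%:R * d <= y)%R)%:R = m%:R * d) /\
  (y < m%:R * d -> \sum_(i < m) d * ((i.+1%:R * d <= y)%R)%:R <= y <=
    \sum_(i < m) d * ((i.+1%:R * d <= y)%R)%:R + d).
  elim: m => [|m [IH1 IH2]].
    by rewrite big_ord0 mul0r; split=> // /(le_lt_trans y0); rewrite ltxx.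
  rewrite big_ord_recr/=; split => [my|].
    have my' : m%:R * d <= y.
      by apply: le_trans my; rewrite ler_pM2r// ler_nat.
    by rewrite IH1// my mulr1 -natr1 mulrDl mul1r.
  rewrite ltNge => ym; rewrite (negbTE ym) mulr0 addr0.
  have [ym'|ym'] := ltP y (m%:R * d); first exact: IH2.
  rewrite IH1// ym' /=; move: ym; rewrite -ltNge -natr1 mulrDl mul1r; exact: ltW.
by move=> /(H N).2.
Qed.

(** The same sum with open superlevel sets; both forms are needed because
    compact and open sets satisfy opposite inequalities in the limit. *)
Lemma staircase_lt (d : R) (N : nat) (y : R) : 0 < d -> 0 <= y -> y <= N%:R * d ->
  let S := \sum_(i < N) d * ((i.+1%:R * d < y)%R)%:R in S <= y <= S + d.
Proof.
move=> d0 y0.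
have H m : (m%:R * d < y -> \sum_(i < m) d * ((i.+1%:R * d < y)%R)%:R = m%:R * d) /\
  (y <= m%:R * d -> \sum_(i < m) d * ((i.+1%:R * d < y)%R)%:R <= y <=
    \sum_(i < m) d * ((i.+1%:R * d < y)%R)%:R + d).
  elim: m => [|m [IH1 IH2]].
    rewrite !big_ord0 mul0r; split=> // y0'; rewrite y0 add0r.
    by rewrite (le_trans y0')// ltW.
  rewrite big_ord_recr/=; split => [my|].
    have my' : m%:R * d < y.
      by apply: le_lt_trans my; rewrite ler_pM2r// ler_nat.
    by rewrite IH1// my mulr1 -natr1 mulrDl mul1r.
  rewrite leNgt => ym; rewrite (negbTE ym) mulr0 addr0.
  have [ym'|ym'] := leP y (m%:R * d); first exact: IH2.
  rewrite IH1// (ltW ym') /=; move: ym; rewrite -leNgt -natr1 mulrDl mul1r; exact.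
by move=> /(H N).2.
Qed.

End staircase.

Section vanishing_at_infinity.
Context (R : realType) (n : nat).
Variables (C : set (Rn R n)) (h : Rn R n -> R).
Hypothesis C_closed : closed C.
Hypothesis ch : {within C, continuous h}.
Hypothesis h_infty :
  forall e, 0 < e -> exists M, forall x, C x -> M < enorm x -> h x <= e.

Lemma C0_superlevel_compact t : 0 < t -> compact (C `&` [set x | t <= h x]).
Proof.
move=> t0; apply: bounded_closed_compact.
  have [M hM] := h_infty (divr_gt0 t0 (ltr0n _ 2)).
  exists M; split; first exact: num_real.
  move=> r Mr x [Cx /= tx]; rewrite leNgt; apply/negP => rx.
  have := hM x Cx (lt_trans Mr (lt_le_trans rx (normr_le_enorm x))).
  by move: tx; lra.
have /continuous_closedP/(_ [set y | t <= y]) := ch.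
move=> /(_ (@closed_ge _ _)) /closed_subspaceP[V cV VE].
rewrite setIC (_ : [set x | t <= h x] = h @^-1` [set y | t <= y])// -VE.
exact: closedI.
Qed.

Lemma C0_bounded : exists M, forall x, C x -> h x <= M.
Proof.
have cK := C0_superlevel_compact ltr01.
have chK : {within C `&` [set x | 1 <= h x], continuous h}.
  by apply: continuous_subspaceW ch; exact: subIsetl.
have [M [_ /(_ (M + 1))]] := compact_bounded (continuous_compact chK cK).
rewrite ltrDl ltr01 => /(_ isT) hM.
exists (Num.max 1 (M + 1)) => x Cx; rewrite le_max.
have [//|h1] := leP (h x) 1.
apply: le_trans (ler_norm _) _; apply: hM.
by exists x => //; split => //=; exact: ltW.
Qed.

End vanishing_at_infinity.

Section portmanteau.
Context (R : realType) (n : nat) (U : set_system nat) {UU : UltraFilter U}.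
Variable mu_ : nat -> radon R n.
Hypothesis mu_le1 : forall k, (mu_ k setT <= 1)%E.
Local Notation T := (Rn R n).
Local Notation Rm := (measurableTypeR R).
Local Notation lam := (ucontent U mu_).
Variable mu : radon R n.
Hypothesis mu_compact : forall K, compact K -> ((lam K)%:E <= mu K)%E.
Hypothesis mu_open : forall W, open W -> (mu W <= (lam W)%:E)%E.

Lemma vague_limit_le1 : (mu setT <= 1)%E.
Proof. by apply: (le_trans (mu_open openT)); rewrite lee_fin; exact: ucontent_le1. Qed.

Section one_function.
Variables (C : set T) (h : T -> R) (M : R).
Hypothesis (C_closed : closed C) (mu_C : forall k, mu_ k (~` C) = 0%E).
Hypothesis (h_ge0 : forall x, C x -> 0 <= h x) (h_le : forall x, C x -> h x <= M).
Hypothesis (h_usc : forall t, 0 < t -> compact (C `&` [set x | t <= h x])).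
Hypothesis (h_lsc : forall t, exists2 V, open V & C `&` [set x | t < h x] = C `&` V).

Let mC : measurable C. Proof. exact: closed_Rn_measurable. Qed.

Let mh : measurable_fun C (h : T -> Rm).
Proof.
apply: (measurability _ (RGenOInfty.measurableE R)) => //.
move=> _ [_ [t ->] <-].
have [V oV CV] := h_lsc t.
rewrite (_ : _ `&` _ = C `&` V); last first.
  by rewrite -CV; apply/seteqP; split=> x /=; rewrite in_itv/= andbT.
by apply: measurableI => //; exact: open_Rn_measurable.
Qed.

Let stair_integral (nu : radon R n) (d : R) (N : nat) (E : nat -> set T) :
  (nu setT <= 1)%E -> 0 < d -> (forall i, measurable (E i)) -> (forall i, E i `<=` C) ->
  (forall x, C x -> \sum_(i < N) d * (\1_(E i) x) <= h x <= \sum_(i < N) d * (\1_(E i) x) + d) ->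
  \sum_(i < N) d * fine (nu (E i)) <= fine (\int[nu]_(x in C) (h x)%:E) <=
    \sum_(i < N) d * fine (nu (E i)) + d.
Proof.
move=> nu1 d0 mE EC hE.
have nufin (A : set T) : measurable A -> nu A = (fine (nu A))%:E.
  move=> mA; rewrite fineK// ge0_fin_numE//; apply: (@le_lt_trans _ _ 1%E); last exact: ltry.
  by apply: le_trans nu1; apply: le_measure; rewrite ?inE.
have sumE : (\int[nu]_(x in C) (\sum_(i < N) d * (\1_(E i) x))%:E =
    (\sum_(i < N) d * fine (nu (E i)))%:E)%E.
  under eq_integral do rewrite -sumEFin.
  rewrite ge0_integral_sum//; last 2 first.
  - by move=> i; apply/measurable_EFinP; apply: measurable_funM => //; exact: measurable_indic.
  - by move=> i x _; rewrite lee_fin mulr_ge0// ltW.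
  rewrite -sumEFin; apply: eq_bigr => i _.
  under eq_integral do rewrite EFinM.
  rewrite ge0_integralZl_EFin//=; last 2 first.
  - by apply/measurable_EFinP; exact: measurable_indic.
  - exact: ltW.
  rewrite integral_indic// EFinM -nufin//; congr (_ * nu _)%E.
  exact: setIidl.
have mS : measurable_fun C (fun x : T => \sum_(i < N) d * (\1_(E i) x) : R).
  by apply: measurable_sum => i; apply: measurable_funM => //; exact: measurable_indic.
have S0 x : 0 <= \sum_(i < N) d * (\1_(E i) x) :> R.
  by apply: sumr_ge0 => i _; rewrite mulr_ge0// ltW.
have lo : ((\sum_(i < N) d * fine (nu (E i)))%:E <= \int[nu]_(x in C) (h x)%:E)%E.
  rewrite -sumE; apply: ge0_le_integral => //=.
  - by move=> x _; rewrite lee_fin.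
  - by apply/measurable_EFinP.
  - by apply/measurable_EFinP.
  - by move=> x Cx; rewrite lee_fin; have /andP[] := hE x Cx.
have hi : (\int[nu]_(x in C) (h x)%:E <= (\sum_(i < N) d * fine (nu (E i)) + d)%:E)%E.
  apply: (@le_trans _ _ (\int[nu]_(x in C) ((\sum_(i < N) d * (\1_(E i) x))%:E + d%:E))%E).
    apply: ge0_le_integral => //=.
    - by apply/measurable_EFinP.
    - by apply: emeasurable_funD => //; apply/measurable_EFinP.
    - by move=> x Cx; rewrite -EFinD lee_fin; have /andP[] := hE x Cx.
  rewrite ge0_integralD//=; last 3 first.
  - by move=> x _; rewrite lee_fin.
  - by apply/measurable_EFinP.
  - by move=> x _; rewrite lee_fin ltW.
  rewrite sumE integral_cst// EFinD leeD2l// -[leRHS]mule1.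
  apply: lee_wpmul2l; first by rewrite lee_fin ltW.
  by apply: le_trans nu1; apply: le_measure; rewrite ?inE.
have Ifin : (\int[nu]_(x in C) (h x)%:E)%E \is a fin_num.
  rewrite ge0_fin_numE; first by rewrite (le_lt_trans hi)// ltry.
  by apply: integral_ge0 => x Cx; rewrite lee_fin; exact: h_ge0.
by rewrite -!lee_fin fineK// lo hi.
Qed.

(** Up to an error d, the integral of h is a layer-cake sum. With closed
    superlevel sets, which are compact, the limit is bounded above by mu; with
    relatively open ones it is bounded below. All the measures sit on C, so
    relatively open sets may be replaced by open ones. *)
Lemma vague_cvg_closed :
  fine (\int[mu_ k]_(x in C) (h x)%:E) @[k --> U] --> fine (\int[mu]_(x in C) (h x)%:E).
Proof.
pose I k := fine (\int[mu_ k]_(x in C) (h x)%:E).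
pose J := fine (\int[mu]_(x in C) (h x)%:E).
have key (d : R) : 0 < d -> exists L, [/\ I @ U --> L, L <= J + d & J <= L + d].
  move=> d0.
  pose N := (Num.truncn (M / d)).+1.
  have MN : M < N%:R * d by rewrite -ltr_pdivrMr//; exact: truncnS_gt.
  pose K i := C `&` [set x | i.+1%:R * d <= h x].
  pose O i := C `&` [set x | i.+1%:R * d < h x].
  have cK i : compact (K i) by apply: h_usc; rewrite mulr_gt0.
  have mK i : measurable (K i).
    by apply: closed_Rn_measurable; apply: compact_closed => //; exact: norm_hausdorff.
  have [V VP] : exists V : nat -> set T, forall i, open (V i) /\ O i = C `&` V i.
    have H i : exists Vi, open Vi /\ O i = C `&` Vi.
      by have [Vi oV VE] := h_lsc (i.+1%:R * d); exists Vi.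
    by exists (fun i => projT1 (cid (H i))) => i; exact: (projT2 (cid (H i))).
  have mV i : measurable (V i) by apply: open_Rn_measurable; have [] := VP i.
  have mO i : measurable (O i) by rewrite (VP i).2; exact: measurableI.
  have indicS (P : set T) x : C x -> \1_(C `&` P) x = (`[<P x>])%:R :> R.
    move=> Cx; rewrite indicE; have [Px|nPx] := pselect (P x).
      by rewrite mem_set ?asboolT.
    by rewrite memNset ?asboolF// => -[].
  have hK (nu : radon R n) : (nu setT <= 1)%E ->
    \sum_(i < N) d * fine (nu (K i)) <= fine (\int[nu]_(x in C) (h x)%:E) <=
      \sum_(i < N) d * fine (nu (K i)) + d.
    move=> nu1; apply: stair_integral => // [i x []//|x Cx].
    have := staircase_le d0 (h_ge0 Cx) (le_lt_trans (h_le Cx) MN).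
    by rewrite /= (eq_bigr (fun i : 'I_N => d * \1_(K i) x)) // => i _; rewrite indicS//= asboolb.
  have hO (nu : radon R n) : (nu setT <= 1)%E ->
    \sum_(i < N) d * fine (nu (O i)) <= fine (\int[nu]_(x in C) (h x)%:E) <=
      \sum_(i < N) d * fine (nu (O i)) + d.
    move=> nu1; apply: stair_integral => // [i x []//|x Cx].
    have := staircase_lt d0 (h_ge0 Cx) (ltW (le_lt_trans (h_le Cx) MN)).
    by rewrite /= (eq_bigr (fun i : 'I_N => d * \1_(O i) x)) // => i _; rewrite indicS//= asboolb.
  have cvgS (E : nat -> set T) : (forall i, measurable (E i)) ->
      \sum_(i < N) d * fine (mu_ k (E i)) @[k --> U] --> \sum_(i < N) d * lam (E i).
    by move=> mE; apply: cvg_sum_ord => i; apply: cvgM; [exact: cvg_cst|exact: ucontent_cvg].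
  have CO i k : fine (mu_ k (V i)) = fine (mu_ k (O i)).
    congr fine; rewrite (VP i).2 -[in LHS](setIT (V i)) -(setUv C) setIUr measureU; last 3 first.
    - exact: measurableI.
    - by apply: measurableI => //; exact: measurableC.
    - by rewrite setIACA setICr setI0.
    rewrite [X in (_ + X)%E](_ : _ = 0%E) ?adde0 1?setIC//.
    apply/eqP; rewrite eq_le measure_ge0 andbT -(mu_C k); apply: le_measure; rewrite ?inE.
    - by apply: measurableI => //; exact: measurableC.
    - exact: measurableC.
    - exact: subIsetl.
  have Ibnd k : 0 <= I k <= \sum_(i < N) d + d.
    have /andP[lo hi] := hK _ (mu_le1 k); apply/andP; split.
      by apply: fine_ge0; apply: integral_ge0 => x Cx; rewrite lee_fin; exact: h_ge0.
    apply: (le_trans hi); rewrite lerD2r; apply: ler_sum => i _.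
    rewrite -[leRHS]mulr1 ler_pM2l//.
    by have /andP[] := mass_bounds mu_le1 k (mK i).
  have [L _ IL] := ultra_bounded_cvg Ibnd.
  have finmu (E : set T) : measurable E -> mu E = (fine (mu E))%:E.
    move=> mE; rewrite fineK// ge0_fin_numE//; apply: (@le_lt_trans _ _ 1%E); last exact: ltry.
    by apply: le_trans vague_limit_le1; apply: le_measure; rewrite ?inE.
  have /andP[Klo Khi] := hK _ vague_limit_le1.
  have /andP[Olo Ohi] := hO _ vague_limit_le1.
  exists L; split => //.
    have h1 : L <= \sum_(i < N) d * lam (K i) + d.
      apply: (ler_cvg_to IL (cvgD (cvgS _ mK) (cvg_cst d))).
      by apply: filterE => k; have /andP[] := hK _ (mu_le1 k).
    apply: (le_trans h1); rewrite lerD2r; apply: le_trans Klo.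
    apply: ler_sum => i _; rewrite ler_pM2l//.
    by rewrite -lee_fin -finmu//; exact: mu_compact.
  have h1 : \sum_(i < N) d * lam (V i) <= L.
    apply: (ler_cvg_to (cvgS _ mV) IL).
    apply: filterE => k; have /andP[+ _] := hO _ (mu_le1 k).
    by under eq_bigr do rewrite -CO.
  apply: (le_trans Ohi); rewrite lerD2r; apply: le_trans h1.
  apply: ler_sum => i _; rewrite ler_pM2l// -lee_fin -finmu//.
  apply: le_trans (mu_open (VP i).1); apply: le_measure; rewrite ?inE//.
  by rewrite (VP i).2; exact: subIsetr.
have [L [IL _ _]] := key 1 ltr01.
suff LJ : L = J by rewrite -/J -LJ.
have H d : 0 < d -> `|L - J| <= d.
  move=> /key[L' [IL' h1 h2]].
  have -> : L = L' by rewrite -(cvg_lim _ IL)// -(cvg_lim _ IL').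
  by rewrite ler_norml; lra.
apply/eqP; rewrite -subr_eq0 -normr_le0; apply/ler_addgt0Pl => d d0.
by rewrite addr0 H.
Qed.
End one_function.

(** Vague convergence of measures of mass at most 1 extends from compactly
    supported functions to those vanishing at infinity, since escaping mass
    meets only small values. The measures sit on the closed set C, so only the
    restriction of h to C matters. *)
Lemma vague_cvg_C0 (C : set T) (h : T -> R) : closed C ->
  (forall k, mu_ k (~` C) = 0%E) -> {within C, continuous h} ->
  (forall x, C x -> 0 <= h x) ->
  (forall e, 0 < e -> exists M, forall x, C x -> M < enorm x -> h x <= e) ->
  fine (\int[mu_ k]_(x in C) (h x)%:E) @[k --> U] --> fine (\int[mu]_(x in C) (h x)%:E).
Proof.
move=> cC muC ch h0 hinf.
have cpt := C0_superlevel_compact cC ch hinf.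
have lsc t : exists2 V, open V & C `&` [set x | t < h x] = C `&` V.
  have /continuousP/(_ [set y | t < y]) := ch.
  have og : open [set y : R | t < y] by exact: open_gt.
  move=> /(_ og) /open_subspaceP[V oV VE].
  by exists V => //; rewrite setIC [RHS]setIC VE.
have [M hM] := C0_bounded cC ch hinf.
exact: (vague_cvg_closed cC muC h0 hM cpt lsc).
Qed.

End portmanteau.

(** * Sums, multiples and restrictions of Radon measures *)

Section radon_operations.
Context (R : realType) (n : nat).
Local Notation T := (Rn R n).
Implicit Types mu nu : radon R n.

Section scale.
Variables (c : {nonneg R}) (mu : radon R n).

Definition radon_scale := mscale c mu.

HB.instance Definition _ := Measure.on radon_scale.

Let radon_scale_compact (K : set T) : compact K -> (radon_scale K < +oo)%E.
Proof. by move=> cK; rewrite /radon_scale /mscale/= lte_mul_pinfty// ?lee_fin// radon_compact. Qed.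

HB.instance Definition _ := @Measure_isRadon.Build R n radon_scale radon_scale_compact.
End scale.

Section restriction.
Variables (D : set T) (mD : measurable D) (mu : radon R n).

Definition radon_restr := mrestr mu mD.

HB.instance Definition _ := Measure.on radon_restr.

Let radon_restr_compact (K : set T) : compact K -> (radon_restr K < +oo)%E.
Proof.
move=> cK; apply: (@le_lt_trans _ _ (mu K)); last exact: radon_compact.
have mK : measurable K by apply: closed_Rn_measurable; apply: compact_closed => //; exact: norm_hausdorff.
apply: le_measure; rewrite ?inE//; exact: measurableI.
Qed.

HB.instance Definition _ := @Measure_isRadon.Build R n radon_restr radon_restr_compact.

Lemma ge0_integral_restr (f : T -> \bar R) : measurable_fun setT f ->
  (forall x, 0 <= f x)%E -> (\int[radon_restr]_x f x = \int[mu]_(x in D) f x)%E.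
Proof.
move=> mf f0; rewrite -(setUv D) ge0_integral_setU//=; last 3 first.
- exact: measurableC.
- by rewrite setUv.
- by apply/disj_setPS; rewrite setICr.
rewrite [X in (_ + X)%E]null_set_integral ?adde0; last 3 first.
- exact: measurableC.
- exact: measurable_funTS.
- by transitivity (mu (~` D `&` D)) => //; rewrite setICl measure0.
apply: eq_measure_integral => A mA AD.
by transitivity (mu (A `&` D)) => //; rewrite setIidl.
Qed.

Lemma integral_restr (f : T -> \bar R) : measurable_fun setT f ->
  (\int[radon_restr]_x f x = \int[mu]_(x in D) f x)%E.
Proof.
move=> mf; rewrite integralE [RHS]integralE !ge0_integral_restr//.
- exact: measurable_funeneg.
- exact: measurable_funepos.
Qed.

End restriction.

Lemma radon_addE mu nu (E : set T) : radon_add mu nu E = (mu E + nu E)%E.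
Proof. exact: measure_addE. Qed.

Lemma radon_scaleE c mu (E : set T) : radon_scale c mu E = (c%:num%:E * mu E)%E.
Proof. by []. Qed.

Lemma negligible_radon_add mu nu (E : set T) :
  mu.-negligible E -> nu.-negligible E -> (radon_add mu nu).-negligible E.
Proof.
move=> [B1 [m1 h1 s1]] [B2 [m2 h2 s2]]; exists (B1 `&` B2); split.
- exact: measurableI.
- apply/eqP; rewrite eq_le measure_ge0 andbT radon_addE -(adde0 0%E); apply: leeD.
    by rewrite -h1; apply: le_measure; rewrite ?inE//; exact: measurableI.
  by rewrite -h2; apply: le_measure; rewrite ?inE//; exact: measurableI.
- by rewrite subsetI.
Qed.

Lemma negligible_radon_scale c mu (E : set T) :
  mu.-negligible E -> (radon_scale c mu).-negligible E.
Proof.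
by move=> [B [mB hB sB]]; exists B; split => //; rewrite radon_scaleE hB mule0.
Qed.

Lemma negligible_radon_restr D (mD : measurable D) mu (E : set T) :
  mu.-negligible E -> (radon_restr mD mu).-negligible E.
Proof.
move=> [B [mB hB sB]]; exists B; split => //.
apply/eqP; rewrite eq_le measure_ge0 andbT -hB; apply: le_measure; rewrite ?inE//.
exact: measurableI.
Qed.

Lemma ge0_integral_radon_add mu nu (f : T -> \bar R) : measurable_fun setT f ->
  (forall x, 0 <= f x)%E ->
  (\int[radon_add mu nu]_x f x = \int[mu]_x f x + \int[nu]_x f x)%E.
Proof. by move=> mf f0; exact: ge0_integral_measure_add. Qed.

Lemma integral_radon_add mu nu (f : T -> \bar R) :
  mu.-integrable setT f -> nu.-integrable setT f ->
  (radon_add mu nu).-integrable setT f /\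
  (\int[radon_add mu nu]_x f x = \int[mu]_x f x + \int[nu]_x f x)%E.
Proof.
move=> i1 i2; have mf := (measurable_int _ i1); split; last exact: integral_measure_add.
apply/integrableP; split=> //.
rewrite ge0_integral_radon_add//; last exact: measurableT_comp.
by apply: lte_add_pinfty; [have /integrableP[] := i1|have /integrableP[] := i2].
Qed.

Lemma ge0_integral_radon_scale c mu (f : T -> \bar R) : measurable_fun setT f ->
  (forall x, 0 <= f x)%E ->
  (\int[radon_scale c mu]_x f x = c%:num%:E * \int[mu]_x f x)%E.
Proof. by move=> mf f0; exact: ge0_integral_mscale. Qed.

Lemma integral_radon_scale c mu (f : T -> \bar R) :
  mu.-integrable setT f ->
  (radon_scale c mu).-integrable setT f /\
  (\int[radon_scale c mu]_x f x = c%:num%:E * \int[mu]_x f x)%E.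
Proof.
move=> i1; have mf := (measurable_int _ i1); split.
  apply/integrableP; split=> //.
  rewrite ge0_integral_radon_scale//; last exact: measurableT_comp.
  by rewrite lte_mul_pinfty ?lee_fin//; have /integrableP[] := i1.
rewrite integralE [X in _ = (_ * X)%E]integralE !ge0_integral_radon_scale//; last 2 first.
- exact: measurable_funeneg.
- exact: measurable_funepos.
rewrite -[in RHS](fineK (integrable_pos_fin_num _ i1))// -[in RHS](fineK (integrable_neg_fin_num _ i1))//.
by rewrite -EFinB -EFinM mulrBr EFinB !EFinM !fineK ?(integrable_pos_fin_num _ i1) ?(integrable_neg_fin_num _ i1).
Qed.

Lemma integrable_restr D (mD : measurable D) mu (f : T -> \bar R) :
  mu.-integrable setT f -> (radon_restr mD mu).-integrable setT f.
Proof.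
move=> i1; have mf := (measurable_int _ i1).
apply/integrableP; split=> //.
rewrite ge0_integral_restr//; last exact: measurableT_comp.
have /integrableP[_ h] := i1; apply: le_lt_trans h.
by apply: ge0_subset_integral => //; exact: measurableT_comp.
Qed.

End radon_operations.

(** * The energy as a squared L^2 norm *)

Section riesz_transform.
Context (R : realType) (n : nat) (alpha : R) (Phi : riesz_features n alpha).
Local Notation T := (Rn R n).
Local Notation S := (fspace Phi).
Local Notation m := (fmu Phi).
Local Notation phi := (feat Phi).
Implicit Types mu nu : radon R n.
Local Open Scope ereal_scope.

Definition rtrans mu (s : S) : \bar R := \int[mu]_x (phi x s)%:E.

Lemma measurable_feat1 (s : S) : measurable_fun setT (phi ^~ s).
Proof. exact: (measurableT_comp (measurable_feat Phi) (measurable_pair2 s)). Qed.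

Lemma measurable_feat2 (x : T) : measurable_fun setT (phi x).
Proof. exact: (measurableT_comp (measurable_feat Phi) (measurable_pair1 x)). Qed.

Lemma rtrans_ge0 mu s : 0 <= rtrans mu s.
Proof. by apply: integral_ge0 => x _; rewrite lee_fin feat_ge0. Qed.

Lemma measurable_rtrans mu : measurable_fun setT (rtrans mu).
Proof.
apply: (measurable_fun_fubini_tonelli_G (m1 := mu) (fun z => (phi z.1 z.2)%:E)) => //.
- by apply/measurable_EFinP; exact: measurable_feat.
- by move=> z; rewrite lee_fin feat_ge0.
Qed.

Lemma potentialE mu x : potential alpha mu x = \int[m]_s ((phi x s)%:E * rtrans mu s).
Proof.
rewrite /potential.
under eq_integral => y _ do rewrite -(feat_kernel Phi).
pose g (z : T * S) := (phi x z.2 * phi z.1 z.2)%:E.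
have mg : measurable_fun setT g.
  apply/measurable_EFinP; apply: measurable_funM; last exact: measurable_feat.
  by apply: (measurableT_comp (measurable_feat2 x)); exact: measurable_snd.
rewrite (fubini_tonelli g)//=; last by move=> z; rewrite lee_fin mulr_ge0 ?feat_ge0.
apply: eq_integral => s _; rewrite /g/=.
under eq_integral do rewrite EFinM.
rewrite ge0_integralZl_EFin//= ?feat_ge0//.
- by move=> y _; rewrite lee_fin feat_ge0.
- by apply/measurable_EFinP; exact: measurable_feat1.
Qed.

Lemma potential_ge0 mu x : 0 <= potential alpha mu x.
Proof.
rewrite potentialE; apply: integral_ge0 => s _.
by rewrite mule_ge0 ?rtrans_ge0// lee_fin feat_ge0.
Qed.

Lemma measurable_potential mu : measurable_fun setT (potential alpha mu).
Proof.
rewrite (_ : potential _ _ = fun x => \int[m]_s ((phi x s)%:E * rtrans mu s)); last first.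
  by apply/funext => x; exact: potentialE.
apply: (measurable_fun_fubini_tonelli_F (m2 := m) (fun z => (phi z.1 z.2)%:E * rtrans mu z.2)) => //.
- apply: emeasurable_funM; first by apply/measurable_EFinP; exact: measurable_feat.
  by apply: (measurableT_comp (measurable_rtrans mu)); exact: measurable_snd.
- by move=> z; rewrite mule_ge0 ?rtrans_ge0// lee_fin feat_ge0.
Qed.

Lemma integral_potential mu nu :
  \int[nu]_x potential alpha mu x = \int[m]_s (rtrans nu s * rtrans mu s).
Proof.
under eq_integral => x _ do rewrite potentialE.
pose g (z : T * S) := (phi z.1 z.2)%:E * rtrans mu z.2.
have mg : measurable_fun setT g.
  apply: emeasurable_funM; first by apply/measurable_EFinP; exact: measurable_feat.
  by apply: (measurableT_comp (measurable_rtrans mu)); exact: measurable_snd.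
rewrite (fubini_tonelli g)//=; last first.
  by move=> z; rewrite mule_ge0 ?rtrans_ge0// lee_fin feat_ge0.
apply: eq_integral => s _; rewrite /g/=.
rewrite ge0_integralZr//= ?rtrans_ge0//.
- by apply/measurable_EFinP; exact: measurable_feat1.
- by move=> y _; rewrite lee_fin feat_ge0.
Qed.

Lemma measurable_riesz_kernel :
  measurable_fun setT (fun z : T * T => riesz_kernel alpha z.1 z.2).
Proof.
rewrite (_ : (fun z => _) = fun z => \int[m]_s ((phi z.1 s * phi z.2 s)%:E)); last first.
  by apply/funext => z; rewrite (feat_kernel).
apply: (measurable_fun_fubini_tonelli_F (m2 := m)
  (fun w : (T * T) * S => (phi w.1.1 w.2 * phi w.1.2 w.2)%:E)) => //.
- apply/measurable_EFinP; apply: measurable_funM.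
    apply: (measurableT_comp (measurable_feat Phi)
      (g := fun w : (T * T) * S => (w.1.1, w.2))).
    apply/measurable_fun_pairP; split => /=.
      exact: measurableT_comp measurable_fst measurable_fst.
    exact: measurable_snd.
  apply: (measurableT_comp (measurable_feat Phi)
      (g := fun w : (T * T) * S => (w.1.2, w.2))).
  apply/measurable_fun_pairP; split => /=.
    exact: measurableT_comp measurable_snd measurable_fst.
  exact: measurable_snd.
- by move=> z; rewrite lee_fin mulr_ge0 ?feat_ge0.
Qed.

Lemma riesz_kernel_ge0 (x y : T) : 0 <= riesz_kernel alpha x y.
Proof.
by rewrite -(feat_kernel Phi); apply: integral_ge0 => s _; rewrite lee_fin mulr_ge0 ?feat_ge0.
Qed.

(** Integrating the mixture representation of the kernel, by the Fubini-Tonelli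
    theorem. *)
Lemma mutual_energyE mu nu :
  mutual_energy alpha mu nu = \int[m]_s (rtrans mu s * rtrans nu s).
Proof.
rewrite /mutual_energy fubini_tonelli1; last 2 first.
- exact: measurable_riesz_kernel.
- by move=> z; exact: riesz_kernel_ge0.
exact: integral_potential.
Qed.

Lemma mutual_energy_ge0 mu nu : 0 <= mutual_energy alpha mu nu.
Proof. by rewrite mutual_energyE; apply: integral_ge0 => s _; rewrite mule_ge0 ?rtrans_ge0. Qed.

Lemma mutual_energyC mu nu : mutual_energy alpha mu nu = mutual_energy alpha nu mu.
Proof. by rewrite !mutual_energyE; apply: eq_integral => s _; rewrite muleC. Qed.

Lemma integral_potentialE mu nu : \int[nu]_x potential alpha mu x = mutual_energy alpha nu mu.
Proof. by rewrite integral_potential mutual_energyE. Qed.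

Lemma rtransD mu nu s : rtrans (radon_add mu nu) s = rtrans mu s + rtrans nu s.
Proof.
apply: ge0_integral_radon_add; first by apply/measurable_EFinP; exact: measurable_feat1.
by move=> x; rewrite lee_fin feat_ge0.
Qed.

Lemma rtransZ c mu s : rtrans (radon_scale c mu) s = c%:num%:E * rtrans mu s.
Proof.
apply: ge0_integral_radon_scale; first by apply/measurable_EFinP; exact: measurable_feat1.
by move=> x; rewrite lee_fin feat_ge0.
Qed.

Lemma rtrans_restr (D : set T) (mD : measurable D) mu s :
  rtrans (radon_restr mD mu) s <= rtrans mu s.
Proof.
rewrite /rtrans ge0_integral_restr//; last 2 first.
- by apply/measurable_EFinP; exact: measurable_feat1.
- by move=> x; rewrite lee_fin feat_ge0.
apply: ge0_subset_integral => //.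
- by apply/measurable_EFinP; exact: measurable_feat1.
- by move=> x _; rewrite lee_fin feat_ge0.
Qed.

Lemma mutual_energyDl mu1 mu2 nu : mutual_energy alpha (radon_add mu1 mu2) nu =
  mutual_energy alpha mu1 nu + mutual_energy alpha mu2 nu.
Proof.
rewrite !mutual_energyE -ge0_integralD//; last 4 first.
- by move=> s _; rewrite mule_ge0 ?rtrans_ge0.
- by apply: emeasurable_funM; exact: measurable_rtrans.
- by move=> s _; rewrite mule_ge0 ?rtrans_ge0.
- by apply: emeasurable_funM; exact: measurable_rtrans.
by apply: eq_integral => s _; rewrite rtransD ge0_muleDl ?rtrans_ge0.
Qed.

Lemma mutual_energyZl c mu nu : mutual_energy alpha (radon_scale c mu) nu =
  c%:num%:E * mutual_energy alpha mu nu.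
Proof.
rewrite !mutual_energyE -ge0_integralZl_EFin//; last 2 first.
- by move=> s _; rewrite mule_ge0 ?rtrans_ge0.
- by apply: emeasurable_funM; exact: measurable_rtrans.
by apply: eq_integral => s _; rewrite rtransZ muleA.
Qed.

Lemma mutual_energyDr mu1 mu2 nu : mutual_energy alpha nu (radon_add mu1 mu2) =
  mutual_energy alpha nu mu1 + mutual_energy alpha nu mu2.
Proof. by rewrite mutual_energyC mutual_energyDl !(mutual_energyC nu). Qed.

Lemma mutual_energyZr c mu nu : mutual_energy alpha nu (radon_scale c mu) =
  c%:num%:E * mutual_energy alpha nu mu.
Proof. by rewrite mutual_energyC mutual_energyZl (mutual_energyC nu). Qed.

Lemma energy_restr (D : set T) (mD : measurable D) mu :
  energy alpha (radon_restr mD mu) <= energy alpha mu.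
Proof.
rewrite /energy !mutual_energyE; apply: ge0_le_integral => //.
- by move=> s _; rewrite mule_ge0 ?rtrans_ge0.
- by apply: emeasurable_funM; exact: measurable_rtrans.
- by apply: emeasurable_funM; exact: measurable_rtrans.
- by move=> s _; apply: lee_pmul; rewrite ?rtrans_ge0 ?rtrans_restr.
Qed.

(** Pointwise [2 a b <= a^2 + b^2] for the transforms; this is positive
    semidefiniteness of the energy without any finiteness assumption. *)
Lemma mutual_energy_amgm mu nu :
  2%:E * mutual_energy alpha mu nu <= energy alpha mu + energy alpha nu.
Proof.
rewrite /energy !mutual_energyE -ge0_integralZl_EFin//; last 2 first.
- by move=> s _; rewrite mule_ge0 ?rtrans_ge0.
- by apply: emeasurable_funM; exact: measurable_rtrans.
rewrite -ge0_integralD//; last 4 first.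
- by move=> s _; rewrite mule_ge0 ?rtrans_ge0.
- by apply: emeasurable_funM; exact: measurable_rtrans.
- by move=> s _; rewrite mule_ge0 ?rtrans_ge0.
- by apply: emeasurable_funM; exact: measurable_rtrans.
apply: ge0_le_integral => //.
- by move=> s _; rewrite !mule_ge0 ?rtrans_ge0.
- by apply: emeasurable_funM => //; apply: emeasurable_funM; exact: measurable_rtrans.
- by apply: emeasurable_funD; apply: emeasurable_funM; exact: measurable_rtrans.
move=> s _; move: (rtrans_ge0 mu s) (rtrans_ge0 nu s).
case: (rtrans mu s) => [a| |]//; case: (rtrans nu s) => [b| |]// a0 b0.
- by rewrite -!EFinM -EFinD lee_fin; have := sqr_ge0 (a - b)%R; rewrite sqrrB !expr2; lra.
- by rewrite mulyy [leRHS]addey ?leey.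
- by rewrite mulyy [leRHS]addye ?leey.
- by rewrite mulyy [leRHS]addye ?leey.
Qed.

End riesz_transform.
Arguments rtrans {R n alpha} Phi mu s.

Arguments measurable_rtrans {R n alpha} Phi mu.
Arguments rtrans_ge0 {R n alpha} Phi mu s.

(** The real value of the mutual energy, that is, the inner product of positive
    measures of finite energy. It is locked to keep unification from unfolding
    the integrals. *)
HB.lock Definition ip (R : realType) (n : nat) (alpha : R) (mu nu : radon R n) : R :=
  fine (mutual_energy alpha mu nu).

Section energy_form.
Context (R : realType) (n : nat) (alpha : R) (Phi : riesz_features n alpha).
Local Notation T := (Rn R n).
Local Notation S := (fspace Phi).
Local Notation m := (fmu Phi).
Implicit Types mu nu : radon R n.

Local Notation ip := (@ip R n alpha).
Local Notation fe mu := (energy alpha mu < +oo)%E.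

Lemma ipE mu nu : fe mu -> fe nu -> mutual_energy alpha mu nu = (ip mu nu)%:E.
Proof.
move=> fmu fnu; rewrite ip.unlock fineK// ge0_fin_numE; last exact: (mutual_energy_ge0 Phi).
have h : (2%:E * mutual_energy alpha mu nu < +oo)%E.
  by apply: (le_lt_trans (mutual_energy_amgm Phi mu nu)); exact: lte_add_pinfty.
move: h (mutual_energy_ge0 Phi mu nu); case: (mutual_energy _ _ _) => //= [r|].
  by move=> _ _; rewrite ltry.
by rewrite mulry gtr0_sg// mul1e.
Qed.

Lemma energyE mu : fe mu -> energy alpha mu = (ip mu mu)%:E.
Proof. by move=> fmu; exact: ipE. Qed.

Lemma ip_ge0 mu nu : 0 <= ip mu nu.
Proof. by rewrite ip.unlock; apply: fine_ge0; exact: (mutual_energy_ge0 Phi). Qed.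

Lemma ipC mu nu : ip mu nu = ip nu mu.
Proof. by rewrite ip.unlock (mutual_energyC Phi). Qed.

Lemma energy_lty_add mu nu : fe mu -> fe nu -> fe (radon_add mu nu).
Proof.
move=> fmu fnu; rewrite /energy (mutual_energyDl Phi) !(mutual_energyDr Phi) !ipE//.
by rewrite -!EFinD ltry.
Qed.

Lemma energy_lty_scale c mu : fe mu -> fe (radon_scale c mu).
Proof.
move=> fmu; rewrite /energy (mutual_energyZl Phi) (mutual_energyZr Phi) ipE//.
by rewrite -!EFinM ltry.
Qed.

Lemma energy_lty_restr (D : set T) (mD : measurable D) mu : fe mu -> fe (radon_restr mD mu).
Proof. by move=> fmu; apply: le_lt_trans fmu; exact: (energy_restr Phi). Qed.

Lemma ipDl mu1 mu2 nu : fe mu1 -> fe mu2 -> fe nu ->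
  ip (radon_add mu1 mu2) nu = ip mu1 nu + ip mu2 nu.
Proof.
move=> f1 f2 fnu; apply: EFin_inj; rewrite EFinD -!ipE//; last exact: energy_lty_add.
exact: (mutual_energyDl Phi).
Qed.

Lemma ipZl c mu nu : fe mu -> fe nu -> ip (radon_scale c mu) nu = c%:num * ip mu nu.
Proof.
move=> f1 fnu; apply: EFin_inj; rewrite EFinM -!ipE//; last exact: energy_lty_scale.
exact: (mutual_energyZl Phi).
Qed.

Lemma ipDr mu1 mu2 nu : fe mu1 -> fe mu2 -> fe nu ->
  ip nu (radon_add mu1 mu2) = ip nu mu1 + ip nu mu2.
Proof. by move=> *; rewrite ipC ipDl// !(ipC nu). Qed.

Lemma ipZr c mu nu : fe mu -> fe nu -> ip nu (radon_scale c mu) = c%:num * ip nu mu.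
Proof. by move=> *; rewrite ipC ipZl// (ipC nu). Qed.

Lemma ip_amgm mu nu : fe mu -> fe nu -> 2 * ip mu nu <= ip mu mu + ip nu nu.
Proof.
move=> fmu fnu; rewrite -lee_fin EFinM [in leRHS]EFinD -!ipE//.
exact: (mutual_energy_amgm Phi).
Qed.

(** Nonnegativity of the energy of mu - nu - c sigma. As c > 0 is free, this is
    the Cauchy-Schwarz bound on [ip (mu - nu) sigma] in a form that involves no
    square root. *)
Lemma ip_cont mu nu sigma (c : R) : fe mu -> fe nu -> fe sigma -> 0 < c ->
  2 * c * (ip mu sigma - ip nu sigma) <=
    (ip mu mu - 2 * ip mu nu + ip nu nu) + c ^+ 2 * ip sigma sigma.
Proof.
move=> fmu fnu fs c0; pose c' : {nonneg R} := NngNum (ltW c0).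
have fz := energy_lty_scale c' fs.
have := ip_amgm fmu (energy_lty_add fnu fz).
rewrite (ipDl fnu fz (energy_lty_add fnu fz)) !(ipDr fnu fz)// !(ipZl, ipZr)//=.
rewrite (ipC sigma nu); clear.
by move: (ip mu mu) (ip nu nu) (ip sigma sigma) (ip mu sigma) (ip nu sigma) (ip mu nu) => *; lra.
Qed.

Definition rdist2 mu nu (s : S) : R := (fine (rtrans Phi mu s) - fine (rtrans Phi nu s)) ^+ 2.

Lemma measurable_rdist2 mu nu : measurable_fun setT (rdist2 mu nu).
Proof.
have mf nu1 : measurable_fun setT (fun s => fine (rtrans Phi nu1 s)).
  exact: (measurableT_comp (fine_measurable measurableT) (measurable_rtrans Phi nu1)).
by apply: measurable_funX; exact: measurable_funB.
Qed.

Lemma rdist2_ge0 mu nu s : 0 <= rdist2 mu nu s.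
Proof. exact: sqr_ge0. Qed.

Lemma rtrans_fin mu : fe mu -> {ae m, forall s, rtrans Phi mu s \is a fin_num}.
Proof.
move=> fmu.
have i : m.-integrable setT (fun s => rtrans Phi mu s * rtrans Phi mu s)%E.
  apply/integrableP; split.
    by apply: emeasurable_funM; exact: measurable_rtrans.
  under eq_integral do rewrite gee0_abs ?mule_ge0 ?rtrans_ge0//.
  by rewrite -(mutual_energyE Phi).
have := integrable_ae measurableT i.
apply: filterS => s /(_ Logic.I); have := (rtrans_ge0 Phi mu s).
by case: (rtrans Phi mu s) => [r| |].
Qed.

(** The L^2 distance of the transforms is the distance in the energy norm.
    Transforms are finite almost everywhere, so passing to real values loses
    nothing. *)
Lemma rdist2_energy mu nu : fe mu -> fe nu ->
  (\int[m]_s (rdist2 mu nu s)%:E = (ip mu mu - 2 * ip mu nu + ip nu nu)%:E)%E.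
Proof.
move=> fmu fnu.
have mr2 := measurable_rdist2 mu nu.
have mm nu1 nu2 : measurable_fun setT (fun s => rtrans Phi nu1 s * rtrans Phi nu2 s)%E.
  by apply: emeasurable_funM; exact: measurable_rtrans.
have mm0 nu1 nu2 s : (0 <= rtrans Phi nu1 s * rtrans Phi nu2 s)%E.
  by rewrite mule_ge0 ?rtrans_ge0.
have E : (\int[m]_s (rdist2 mu nu s)%:E + 2%:E * mutual_energy alpha mu nu =
    energy alpha mu + energy alpha nu)%E.
  rewrite /energy !(mutual_energyE Phi) -ge0_integralZl_EFin// -!ge0_integralD//; last 4 first.
  - by move=> s _; rewrite lee_fin rdist2_ge0.
  - exact/measurable_EFinP.
  - by move=> s _; rewrite mule_ge0.
  - by apply: emeasurable_funM.
  apply: ge0_ae_eq_integral => //.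
  - apply: emeasurable_funD; first exact/measurable_EFinP.
    by apply: emeasurable_funM.
  - by apply: emeasurable_funD.
  - move=> s _; apply: adde_ge0; first by rewrite lee_fin rdist2_ge0.
    by rewrite mule_ge0 ?mm0.
  - by move=> s _; rewrite adde_ge0.
  apply: filterS2 (rtrans_fin fmu) (rtrans_fin fnu) => s /fineK h1 /fineK h2 _.
  by rewrite -h1 -h2 -!EFinM -!EFinD; congr (_%:E); rewrite /rdist2 -h1 -h2/=; ring.
have := E; rewrite (ipE fmu fnu) (energyE fmu) (energyE fnu).
rewrite (_ : 2%:E * (ip mu nu)%:E = (2 * ip mu nu)%:E)%E//. case: (\int[m]_s _)%E => [r| |]//.
rewrite -!EFinD => -[]; clear.
by move: (ip mu mu) (ip nu nu) (ip mu nu) => a b c h; congr (_%:E); lra.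
Qed.

(** Exchange the order of integration: the weighted integral of each feature is
    1. *)
Lemma rtrans_mass mu : (\int[m]_s (rtrans Phi mu s * (fwt Phi s)%:E) = mu setT)%E.
Proof.
pose g (z : T * S) := (feat Phi z.1 z.2 * fwt Phi z.2)%:E.
have mg : measurable_fun setT g.
  apply/measurable_EFinP; apply: measurable_funM; first exact: measurable_feat.
  by apply: (measurableT_comp (measurable_fwt Phi)); exact: measurable_snd.
have g0 z : (0 <= g z)%E by rewrite lee_fin mulr_ge0 ?feat_ge0 ?fwt_ge0.
transitivity (\int[m]_s \int[mu]_x g (x, s))%E.
  apply: eq_integral => s _; rewrite /g/=.
  under [RHS]eq_integral do rewrite EFinM.
  rewrite ge0_integralZr//=.
  - by apply/measurable_EFinP; exact: measurable_feat1.
  - by move=> x _; rewrite lee_fin feat_ge0.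
  - by rewrite lee_fin fwt_ge0.
rewrite -(fubini_tonelli g)//.
under eq_integral do rewrite fwt_total.
by rewrite integral_cst// mul1e.
Qed.

(** Measures at energy distance zero have almost everywhere equal transforms,
    and the mass is a weighted integral of the transform. *)
Lemma energy_eq_mass mu nu : fe mu -> fe nu ->
  ip mu mu + ip nu nu <= 2 * ip mu nu -> mu setT = nu setT.
Proof.
move=> fmu fnu le2.
have I0 : (\int[m]_s (rdist2 mu nu s)%:E = 0)%E.
  rewrite rdist2_energy//; congr (_%:E); apply/eqP; rewrite eq_le.
  by have := ip_amgm fmu fnu; lra.
have mr2 := measurable_rdist2 mu nu.
have : ae_eq m setT (EFin \o rdist2 mu nu) (cst 0%E).
  apply/ae_eq_integral_abs => //; first exact/measurable_EFinP.
  by rewrite -[RHS]I0; apply: eq_integral => s _; rewrite gee0_abs// lee_fin rdist2_ge0.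
move=> ae0; rewrite -!rtrans_mass.
apply: ge0_ae_eq_integral => //.
- by apply: emeasurable_funM; [exact: measurable_rtrans|apply/measurable_EFinP; exact: measurable_fwt].
- by apply: emeasurable_funM; [exact: measurable_rtrans|apply/measurable_EFinP; exact: measurable_fwt].
- by move=> s _; rewrite mule_ge0 ?rtrans_ge0// lee_fin fwt_ge0.
- by move=> s _; rewrite mule_ge0 ?rtrans_ge0// lee_fin fwt_ge0.
apply: filterS3 (rtrans_fin fmu) (rtrans_fin fnu) ae0 => s /fineK h1 /fineK h2 h _.
have /eqP := h Logic.I; rewrite /= eqe sqrf_eq0 subr_eq0 => /eqP h'.
by rewrite -h1 -h2 h'.
Qed.

End energy_form.
Arguments rdist2 {R n alpha} Phi mu nu s.

(** * The Gauss functional on the cone *)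

Section measure_classes.
Context (R : realType) (n : nat) (alpha : R) (Phi : riesz_features n alpha).
Hypothesis alpha_le : alpha <= n%:R.
Local Notation T := (Rn R n).
Local Notation Rm := (measurableTypeR R).
Implicit Types (mu nu : radon R n) (A : set T).

Let tail_set : set T := [set y | 1 < enorm y].
Let tail_fun (y : T) : \bar R := (enorm y `^ (alpha - n%:R))%:E.

Let m_tail_set : measurable tail_set.
Proof.
apply: open_Rn_measurable; rewrite /tail_set.
apply: (@open_comp _ _ (@enorm R n) [set y : R | 1 < y]); last exact: open_gt.
by move=> x _; exact: continuous_enorm.
Qed.

Let m_tail_fun : measurable_fun setT tail_fun.
Proof.
apply/measurable_EFinP.
exact: (measurableT_comp (measurable_powR (alpha - n%:R)) (@measurable_enorm R n)).
Qed.

Lemma tail_finite_of_mass mu : (mu setT < +oo)%E -> tail_finite alpha mu.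
Proof.
move=> fmu; apply: le_lt_trans fmu; rewrite -[leRHS]mul1e -integral_cst//.
apply: (@le_trans _ _ (\int[mu]_(y in tail_set) 1)%E).
  apply: ge0_le_integral => //.
  - by move=> y _; rewrite lee_fin powR_ge0.
  - exact: measurable_funTS.
  move=> y y1; rewrite lee_fin; apply: (@le_trans _ _ (enorm y `^ 0)); last by rewrite powRr0.
  apply: ler_powR.
    exact: ltW.
  by rewrite subr_le0.
exact: ge0_subset_integral.
Qed.

Lemma tail_finiteD mu nu : tail_finite alpha mu -> tail_finite alpha nu ->
  tail_finite alpha (radon_add mu nu).
Proof.
move=> tmu tnu; rewrite /tail_finite ge0_integral_measure_add//.
- exact: lte_add_pinfty.
- by move=> y _; rewrite lee_fin powR_ge0.
- exact: measurable_funTS m_tail_fun.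
Qed.

Lemma tail_finiteZ c mu : tail_finite alpha mu -> tail_finite alpha (radon_scale c mu).
Proof.
move=> tmu; rewrite /tail_finite ge0_integral_mscale//.
- by apply: lte_mul_pinfty => //; rewrite lee_fin.
- exact: measurable_funTS m_tail_fun.
- by move=> y _; rewrite lee_fin powR_ge0.
Qed.

Lemma tail_finite_restr (D : set T) (mD : measurable D) mu :
  tail_finite alpha mu -> tail_finite alpha (radon_restr mD mu).
Proof.
apply: le_lt_trans; rewrite [leLHS]integral_mkcond [leRHS]integral_mkcond.
have mf : measurable_fun setT (tail_fun \_ tail_set).
  by apply/(measurable_restrictT _ m_tail_set); exact: measurable_funTS.
have f0 x : (0 <= (tail_fun \_ tail_set) x)%E.
  by apply: erestrict_ge0 => y _; rewrite lee_fin powR_ge0.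
rewrite ge0_integral_restr//; exact: ge0_subset_integral.
Qed.

Lemma Eplus_onD A mu nu : Eplus_on alpha A mu -> Eplus_on alpha A nu ->
  Eplus_on alpha A (radon_add mu nu).
Proof.
move=> [[t1 e1] n1] [[t2 e2] n2]; split; last exact: negligible_radon_add.
by split; [exact: tail_finiteD|exact: (energy_lty_add Phi)].
Qed.

Lemma Eplus_onZ A c mu : Eplus_on alpha A mu -> Eplus_on alpha A (radon_scale c mu).
Proof.
move=> [[t1 e1] n1]; split; last exact: negligible_radon_scale.
by split; [exact: tail_finiteZ|exact: (energy_lty_scale Phi)].
Qed.

Lemma Eplus_on_restr A (D : set T) (mD : measurable D) mu :
  Eplus_on alpha A mu -> Eplus_on alpha A (radon_restr mD mu).
Proof.
move=> [[t1 e1] n1]; split; last exact: negligible_radon_restr.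
by split; [exact: tail_finite_restr|exact: (energy_lty_restr Phi)].
Qed.

Lemma Eplus_on_energy_lty A mu : Eplus_on alpha A mu -> (energy alpha mu < +oo)%E.
Proof. by move=> [[]]. Qed.

End measure_classes.

Section gauss_functional.
Context (R : realType) (n : nat) (alpha : R) (Phi : riesz_features n alpha).
Local Notation T := (Rn R n).
Variables (f : T -> \bar R) (A : set T).
Implicit Types mu nu : radon R n.
Local Notation P := (Eplus_field alpha f A).
Local Notation ip := (@ip R n alpha).

Definition field_integral mu : R := fine (\int[mu]_x f x).
Local Notation L := field_integral.

Definition rgauss mu : R := ip mu mu + 2 * L mu.
Local Notation J := rgauss.

Lemma Eplus_field_energy_lty mu : P mu -> (energy alpha mu < +oo)%E.
Proof. by move=> [[[]]]. Qed.

Lemma field_integralE mu : P mu -> (\int[mu]_x f x = (L mu)%:E)%E.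
Proof. by move=> [_ i]; rewrite /L fineK// integrable_fin_num. Qed.

Lemma gaussE mu : P mu -> gauss alpha f mu = (J mu)%:E.
Proof.
move=> Pmu; rewrite /gauss (energyE Phi) ?field_integralE//; exact: Eplus_field_energy_lty.
Qed.

Lemma field_integral_add mu nu : P mu -> P nu ->
  P (radon_add mu nu) /\ L (radon_add mu nu) = L mu + L nu.
Proof.
move=> Pmu Pnu; have [[E1 i1] [E2 i2]] := (Pmu, Pnu).
have [i E] := integral_radon_add i1 i2.
have Padd : P (radon_add mu nu) by split => //; exact: (Eplus_onD Phi).
split => //; apply: EFin_inj.
by rewrite EFinD -!field_integralE.
Qed.

Lemma field_integral_scale c mu : P mu ->
  P (radon_scale c mu) /\ L (radon_scale c mu) = c%:num * L mu.
Proof.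
move=> Pmu; have [E1 i1] := Pmu.
have [i E] := integral_radon_scale c i1.
have Pz : P (radon_scale c mu) by split => //; exact: (Eplus_onZ Phi).
split => //; apply: EFin_inj.
by rewrite EFinM -!field_integralE.
Qed.

Definition lin_comb (a b : {nonneg R}) mu nu : radon R n :=
  radon_add (radon_scale a mu) (radon_scale b nu).

Lemma lin_comb_mass a b mu nu :
  (lin_comb a b mu nu setT = a%:num%:E * mu setT + b%:num%:E * nu setT)%E.
Proof. exact: (radon_addE (radon_scale a mu) (radon_scale b nu) setT). Qed.

Lemma lin_comb_field a b mu nu : P mu -> P nu -> P (lin_comb a b mu nu).
Proof.
move=> Pmu Pnu; have [P1 _] := field_integral_scale a Pmu; have [P2 _] := field_integral_scale b Pnu.
by have [] := field_integral_add P1 P2.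
Qed.

Lemma rgauss_comb a b mu nu : P mu -> P nu ->
  J (lin_comb a b mu nu) = a%:num ^+ 2 * ip mu mu + b%:num ^+ 2 * ip nu nu +
    2 * a%:num * b%:num * ip mu nu + 2 * (a%:num * L mu + b%:num * L nu).
Proof.
move=> Pmu Pnu; have [P1 L1] := field_integral_scale a Pmu; have [P2 L2] := field_integral_scale b Pnu.
have [P3 L3] := field_integral_add P1 P2.
have [fm fn] := (Eplus_field_energy_lty Pmu, Eplus_field_energy_lty Pnu).
have [f1 f2] := (Eplus_field_energy_lty P1, Eplus_field_energy_lty P2).
rewrite /rgauss L3 L1 L2 (ipDl Phi f1 f2 (Eplus_field_energy_lty P3)) !(ipDr Phi f1 f2)//.
rewrite !(ipZl Phi, ipZr Phi)// (ipC Phi nu mu).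
by move: (ip mu mu) (ip nu nu) (ip mu nu) (L mu) (L nu) (a%:num) (b%:num) => *; ring.
Qed.

(** The parallelogram identity. The defect of linearity is the squared distance
    of mu and nu, which is what makes minimizing sequences Cauchy. *)
Lemma rgauss_convex a b mu nu : a%:num + b%:num = 1 -> P mu -> P nu ->
  J (lin_comb a b mu nu) = a%:num * J mu + b%:num * J nu -
    a%:num * b%:num * (ip mu mu + ip nu nu - 2 * ip mu nu).
Proof.
move=> ab Pmu Pnu; rewrite rgauss_comb// /rgauss.
have -> : b%:num = 1 - a%:num by rewrite -ab addrC addKr.
by move: (ip mu mu) (ip nu nu) (ip mu nu) (L mu) (L nu) (a%:num) => *; ring.
Qed.

Lemma w_hat_le mu : P mu -> (w_hat alpha f A <= (J mu)%:E)%E.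
Proof. by move=> Pmu; apply: ereal_inf_lbound; exists mu => //; exact: gaussE. Qed.

(** The midpoint of two minimizers has a smaller value of J, by a quarter of
    their squared distance; so this distance is zero. *)
Lemma minimizer_mass mu nu : P mu -> P nu ->
  gauss alpha f mu = w_hat alpha f A -> gauss alpha f nu = w_hat alpha f A ->
  mu setT = nu setT.
Proof.
move=> Pmu Pnu; rewrite !gaussE// => wm wn.
apply: (energy_eq_mass Phi (Eplus_field_energy_lty Pmu) (Eplus_field_energy_lty Pnu)).
have h0 : 0 <= 2^-1 :> R by [].
have := w_hat_le (lin_comb_field (NngNum h0) (NngNum h0) Pmu Pnu).
rewrite rgauss_convex//=; last by field.
have : J mu = J nu by apply: EFin_inj; rewrite wm wn.
rewrite -wm lee_fin; clear.
move: (ip mu mu) (ip nu nu) (ip mu nu) (J mu) (J nu) => *; lra.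
Qed.

(** A measure in the cone may have infinite mass. Restricting it to large balls
    does not increase the energy and changes the field integral little. *)
Lemma truncation mu (c : \bar R) (e : R) : P mu -> (c < mu setT)%E -> 0 < e ->
  exists nu, [/\ P nu, (nu setT < +oo)%E, (c < nu setT)%E & J nu <= J mu + e].
Proof.
move=> Pmu cmu e0; have [Emu imu] := Pmu.
have mf := measurable_int _ imu.
pose nu k : radon R n := radon_restr (measurable_cball k%:R) mu.
have Pnu k : P (nu k).
  by split; [exact: (Eplus_on_restr Phi)|exact: integrable_restr].
have nuT k : nu k setT = mu (cball k%:R).
  by transitivity (mu (setT `&` cball k%:R)) => //; rewrite setTI.
have cT : \bigcup_k cball k%:R = setT :> set T.
  apply/seteqP; split => // x _; exists (Num.truncn (enorm x)).+1 => //.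
  exact/ltW/truncnS_gt.
have mass : nu k setT @[k --> \oo] --> mu setT.
  rewrite (_ : (fun k => nu k setT) = mu \o (fun k => cball k%:R)); last by apply/funext => k; exact: nuT.
  have := @nondecreasing_cvg_mu _ _ _ mu (fun k => cball k%:R); rewrite cT; apply => //; first by move=> i; exact: measurable_cball.
  move=> i j ij; apply/subsetPset => x /= /le_trans; apply.
  by rewrite ler_nat.
have field : (\int[nu k]_x f x)%E @[k --> \oo] --> (\int[mu]_x f x)%E.
  rewrite (_ : (fun k => _) = fun k => (\int[mu]_x (f \_ (cball k%:R)) x)%E); last first.
    by apply/funext => k; rewrite integral_restr// integral_mkcond.
  have [//|||//||_ _] := @dominated_convergence _ _ _ mu setT measurableT
    (fun k => f \_ (cball k%:R)) f (fun x => `|f x|%E).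
  - by move=> k; apply/(measurable_restrictT _ (measurable_cball k%:R)); exact: measurable_funTS.
  - exact: mf.
  - apply: aeW => x _; apply: cvg_near_cst.
    exists (Num.truncn (enorm x)).+1 => // k /= xk.
    rewrite patchE mem_set// /cball /=; apply: le_trans (ltW (truncnS_gt _)) _.
    by rewrite ler_nat.
  - by apply: integrable_abse.
  - by apply: aeW => x k _; rewrite patchE; case: ifPn => // _; rewrite abse0.
  exact.
have [k0 ck0] : exists k, (c < nu k setT)%E.
  apply: contrapT => /forallNP h.
  have : (limn (fun k => nu k setT) <= c)%E.
    apply: lime_le; first by apply/cvg_ex; exists (mu setT).
    by apply: nearW => k; rewrite leNgt; apply/negP.
  by rewrite (cvg_lim _ mass)// leNgt cmu.
have Lcvg : L (nu k) @[k --> \oo] --> L mu.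
  by apply: fine_cvg; rewrite -field_integralE.
have e2 : 0 < e / 2 by rewrite divr_gt0.
have /cvgrPdist_le /(_ _ e2) [k1 _ hk1] := Lcvg.
pose k := maxn k0 k1; exists (nu k); split => //.
- by rewrite nuT; exact/radon_compact/compact_cball.
- apply: (lt_le_trans ck0); rewrite !nuT; apply: le_measure; rewrite ?inE; try exact: measurable_cball.
  by move=> x /= /le_trans; apply; rewrite ler_nat leq_maxl.
have hi : ip (nu k) (nu k) <= ip mu mu.
  rewrite -lee_fin -!(energyE Phi) ?(Eplus_field_energy_lty Pmu) ?(Eplus_field_energy_lty (Pnu k))//.
  exact: (energy_restr Phi).
have := hk1 k (leq_maxr _ _); rewrite ler_norml => /andP[h1 h2].
have ee : e / 2 + e / 2 <= e by rewrite -splitr.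
rewrite /rgauss; move: h1 h2 hi ee; move: (e / 2) (ip _ _) (ip _ _) (L _) (L _); clear.
by move=> *; lra.
Qed.

End gauss_functional.

(** * The minimum problem over unit measures *)

Fact tangent_arith (R : realType) (i j k l m : R) :
  i + l = 0 -> 0 <= k + m -> 2 * k <= i + j -> i + 2 * l <= j + 2 * m.
Proof. by move=> *; lra. Qed.

Fact midpoint_arith (R : realType) (a b w : R) :
  a <= b + (w - b) / 2 -> 0 < (w - b) / 2 -> a < w.
Proof. by move=> *; lra. Qed.

Fact small_step_arith (R : realType) (b t d : R) :
  0 < t -> d < 0 -> b + t <= - d -> - b <= 2 * d -> False.
Proof. by move=> *; lra. Qed.

Fact derivative_arith (R : realType) (x1 x2 x3 x4 x5 x6 x7 : R) : 0 <= x1 ->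
  x7 + 2 * - x7 <= x7 - 2 * x4 + x2 + x3 + (x5 - x1) + 2 * (- x7 + x4 + x6) ->
  - x3 - x2 <= x5 + 2 * x6.
Proof. by move=> *; lra. Qed.

(** The convexity argument, for any field f with the three properties assumed
    below. *)
Section gauss_variational.
Context (R : realType) (n : nat) (alpha : R) (Phi : riesz_features n alpha).
Local Notation T := (Rn R n).
Variables (f : T -> \bar R) (A : set T).
Implicit Types mu nu lam tau : radon R n.
Local Notation P := (Eplus_field alpha f A).
Local Notation ip := (@ip R n alpha).
Local Notation L := (field_integral f).
Local Notation J := (rgauss alpha f).

Hypothesis finite_mass_field : forall mu,
  Eplus_on alpha A mu -> (mu setT < +oo)%E -> mu.-integrable setT f.

Hypothesis spreading : forall e : R, 0 < e ->
  exists tau, [/\ Eplus_unit alpha A tau, ip tau tau <= e & L tau <= e].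

Hypothesis weak_limit : forall mu_ : nat -> radon R n,
  (forall k, Eplus_unit alpha A (mu_ k)) ->
  (forall k, ip (mu_ k) (mu_ k) + ip (mu_ k.+1) (mu_ k.+1)
             - 2 * ip (mu_ k) (mu_ k.+1) <= 4^-1 ^+ k) ->
  exists mu, [/\ Eplus_on alpha A mu, (mu setT <= 1)%E &
    forall (e : R) N, 0 < e -> exists2 k, (N <= k)%N & J mu <= J (mu_ k) + e].

Variable omega_hat : radon R n.
Hypothesis P_hat : P omega_hat.
Hypothesis hat_min : gauss alpha f omega_hat = w_hat alpha f A.

Lemma unit_field mu : Eplus_unit alpha A mu -> P mu.
Proof. by move=> [E1 m1]; split => //; apply: finite_mass_field => //; rewrite m1 ltry. Qed.

Lemma w_hatE : w_hat alpha f A = (J omega_hat)%:E.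
Proof. by rewrite -hat_min (gaussE Phi P_hat). Qed.

Lemma J_ge_hat mu : P mu -> J omega_hat <= J mu.
Proof. by move=> Pmu; rewrite -lee_fin -w_hatE; exact: (w_hat_le Phi). Qed.

Definition wu : R := fine (w_unit alpha f A).

Lemma w_unitE : w_unit alpha f A = wu%:E.
Proof.
rewrite /wu fineK//.
have [tau [U1 _ _]] := spreading ltr01.
have hi : (w_unit alpha f A <= (J tau)%:E)%E.
  by apply: ereal_inf_lbound; exists tau => //; apply: (gaussE Phi); exact: unit_field.
have lo : ((J omega_hat)%:E <= w_unit alpha f A)%E.
  apply: le_ereal_inf_tmp => _ [mu Umu <-].
  by rewrite (gaussE Phi (unit_field Umu)) lee_fin J_ge_hat//; exact: unit_field.
by rewrite fin_numE; apply/andP; split; apply/eqP => h; rewrite h in hi lo.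
Qed.

Lemma wu_le mu : Eplus_unit alpha A mu -> wu <= J mu.
Proof.
move=> Umu; rewrite -lee_fin -w_unitE; apply: ereal_inf_lbound.
by exists mu => //; apply: (gaussE Phi); exact: unit_field.
Qed.

Lemma w_hat_le_w_unit : J omega_hat <= wu.
Proof.
rewrite -lee_fin -w_unitE; apply: le_ereal_inf_tmp => _ [mu Umu <-].
by rewrite (gaussE Phi (unit_field Umu)) lee_fin J_ge_hat//; exact: unit_field.
Qed.

Lemma minimizerP lam : is_weighted_minimizer alpha f A lam <->
  Eplus_unit alpha A lam /\ J lam = wu.
Proof.
split=> -[U1 h]; split=> //.
  by apply: EFin_inj; rewrite -(gaussE Phi (unit_field U1)) h w_unitE.
by rewrite (gaussE Phi (unit_field U1)) h w_unitE.
Qed.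

Lemma unit_minimizing_mass lam : Eplus_on alpha A lam -> (lam setT < +oo)%E ->
  J lam <= J omega_hat -> lam setT = omega_hat setT.
Proof.
move=> E1 fm h; have Plam : P lam by split => //; exact: finite_mass_field.
apply: (minimizer_mass Phi Plam P_hat) => //.
rewrite (gaussE Phi Plam) w_hatE; congr (_%:E); apply/eqP.
by rewrite eq_le h J_ge_hat.
Qed.

Lemma lin_comb_unit a b mu nu : Eplus_on alpha A mu -> Eplus_on alpha A nu ->
  (a%:num%:E * mu setT + b%:num%:E * nu setT = 1)%E ->
  Eplus_unit alpha A (lin_comb a b mu nu).
Proof.
move=> E1 E2 h; split; last by rewrite lin_comb_mass.
by apply: (Eplus_onD Phi); exact: (Eplus_onZ Phi).
Qed.

(** Complete the pseudo-balayage to mass 1 by a multiple of a unit measure tau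
    with tiny energy and field integral. The cross term is controlled by a
    weighted arithmetic-geometric mean inequality with parameter t. *)
Lemma w_unit_le_w_hat : (omega_hat setT <= 1)%E -> wu <= J omega_hat.
Proof.
move=> m1; apply/ler_addgt0Pr => e e0.
have mf : omega_hat setT \is a fin_num.
  by rewrite ge0_fin_numE// (le_lt_trans m1)// ltry.
pose q := fine (omega_hat setT).
have qE : omega_hat setT = q%:E by rewrite fineK.
have q0 : 0 <= q by rewrite fine_ge0.
have q1 : q <= 1 by rewrite -lee_fin -qE.
have c0 : 0 <= 1 - q by rewrite subr_ge0.
pose I := ip omega_hat omega_hat.
have I0 : 0 <= I by exact: (ip_ge0 Phi).
pose t := e / (4 * (I + 1)).
have t0 : 0 < t by rewrite divr_gt0// mulr_gt0// ltr_wpDl.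
pose e' := Num.min (e / 8) (t * e / 4).
have e'0 : 0 < e' by rewrite lt_min !divr_gt0//= mulr_gt0.
have [tau [U1 It Lt]] := spreading e'0.
have Ptau := unit_field U1.
have one0 : 0 <= 1 :> R by [].
have Uc : Eplus_unit alpha A (lin_comb (NngNum one0) (NngNum c0) omega_hat tau).
  apply: lin_comb_unit => /=; [by case: P_hat|by case: U1|].
  by have [_ ->] := U1; rewrite mule1 mul1e qE -EFinD addrC subrK.
apply: (le_trans (wu_le Uc)).
rewrite (rgauss_comb Phi _ _ P_hat Ptau)//= expr1n !mul1r mulr1 /rgauss -/I.
have amgm : 2 * ip omega_hat tau <= t * I + t^-1 * ip tau tau.
  pose t' : {nonneg R} := NngNum (ltW t0).
  have fh := Eplus_field_energy_lty P_hat; have ft := Eplus_field_energy_lty Ptau.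
  have := ip_amgm Phi (energy_lty_scale Phi t' fh) ft.
  rewrite !(ipZl Phi, ipZr Phi)//=; last exact: (energy_lty_scale Phi t' fh).
  rewrite -/I => h; rewrite -(ler_pM2l t0) mulrDr mulrCA (mulrA t t^-1).
  by rewrite mulfV ?gt_eqF// mul1r.
have tI : t * I <= e / 4.
  rewrite /t mulrAC ler_pdivrMr; last by rewrite mulr_gt0// ltr_wpDl.
  by move: (mulr_ge0 (ltW e0) I0); lra.
have itau0 : 0 <= ip tau tau by exact: (ip_ge0 Phi).
have h1 : ip tau tau <= e / 8 by apply: (le_trans It); rewrite ge_min lexx.
have h2 : t^-1 * ip tau tau <= e / 4.
  rewrite ler_pdivrMl// mulrA; apply: (le_trans It).
  by rewrite ge_min lexx orbT.
have h3 : L tau <= e / 8 by apply: (le_trans Lt); rewrite ge_min lexx.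
have c1 : 1 - q <= 1 by rewrite lerBlDr lerDl.
have ipo0 : 0 <= ip omega_hat tau by exact: (ip_ge0 Phi).
have p1 : (1 - q) ^+ 2 * ip tau tau <= e / 8.
  apply: le_trans h1; rewrite -[leRHS]mul1r ler_wpM2r// expr_le1//.
have p2 : 2 * (1 - q) * ip omega_hat tau <= e / 2.
  apply: (@le_trans _ _ (2 * ip omega_hat tau)); last by lra.
  by rewrite -mulrA ler_pM2l// -[leRHS]mul1r ler_wpM2r.
have p3 : (1 - q) * L tau <= e / 8.
  apply: (@le_trans _ _ ((1 - q) * (e / 8))); first by rewrite ler_wpM2l.
  by rewrite -[leRHS]mul1r ler_wpM2r// divr_ge0// ltW.
move: p1 p2 p3; move: (_ * ip tau tau) (_ * ip omega_hat tau) (_ * L tau) => *; lra.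
Qed.

Lemma minimizer_mass_ge1 lam : is_weighted_minimizer alpha f A lam ->
  (1 <= omega_hat setT)%E.
Proof.
move=> /minimizerP[U1 Jl]; rewrite leNgt; apply/negP => m1.
have [E1 lm1] := U1.
have : lam setT = omega_hat setT.
  apply: unit_minimizing_mass => //; first by rewrite lm1 ltry.
  by rewrite Jl; apply: w_unit_le_w_hat; exact: ltW.
by rewrite lm1 => h; rewrite -h ltxx in m1.
Qed.

Lemma minimizing_sequence (e_ : nat -> R) : (forall k, 0 < e_ k) ->
  exists mu_ : nat -> radon R n, forall k,
    Eplus_unit alpha A (mu_ k) /\ J (mu_ k) <= wu + e_ k.
Proof.
move=> e0.
have H k : exists mu, Eplus_unit alpha A mu /\ J mu <= wu + e_ k.
  have wf : w_unit alpha f A \is a fin_num by rewrite w_unitE.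
  have [_ [mu Umu <-]] := lb_ereal_inf_adherent (e0 k) wf.
  rewrite -/(w_unit alpha f A) w_unitE (gaussE Phi (unit_field Umu)) -EFinD lte_fin.
  by move=> h; exists mu; split => //; exact: ltW.
by exists (fun k => projT1 (cid (H k))) => k; exact: (projT2 (cid (H k))).
Qed.

(** The limit mu of a minimizing sequence has mass at most 1 and a truncation nu
    of the pseudo-balayage has mass more than 1. Both satisfy [J <= w_unit], and
    some convex combination has mass 1. *)
Lemma minimizer_exists_gt1 : (1 < omega_hat setT)%E ->
  exists lam, is_weighted_minimizer alpha f A lam.
Proof.
move=> m1.
have e0 k : 0 < 4^-1 ^+ k / 4 :> R by rewrite divr_gt0// exprn_gt0// invr_gt0.
have [mu_ mu_P] := minimizing_sequence e0.
have U_ k := (mu_P k).1; have J_ k := (mu_P k).2.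
have P_ k := unit_field (U_ k).
have h0 : 0 <= 2^-1 :> R by [].
have dist k : ip (mu_ k) (mu_ k) + ip (mu_ k.+1) (mu_ k.+1)
             - 2 * ip (mu_ k) (mu_ k.+1) <= 4^-1 ^+ k.
  have Um : Eplus_unit alpha A (lin_comb (NngNum h0) (NngNum h0) (mu_ k) (mu_ k.+1)).
    apply: lin_comb_unit => /=; [by case: (U_ k)|by case: (U_ k.+1)|].
    have [_ ->] := U_ k; have [_ ->] := U_ k.+1.
    by rewrite !mule1 -EFinD; congr (_%:E); field.
  have ab : (NngNum h0)%:num + (NngNum h0)%:num = 1 :> R by rewrite /=; field.
  have := wu_le Um; rewrite (rgauss_convex Phi ab (P_ k) (P_ k.+1))/=.
  have := J_ k; have := J_ k.+1.
  have : 4^-1 ^+ k.+1 <= 4^-1 ^+ k :> R.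
    by rewrite exprS ler_piMl ?exprn_ge0// invf_le1// ler1n.
  move: (4^-1 ^+ k.+1) (4^-1 ^+ k) (J (mu_ k)) (J (mu_ k.+1)) (ip (mu_ k) (mu_ k)) (ip (mu_ k.+1) (mu_ k.+1)) (ip (mu_ k) (mu_ k.+1)) wu; clear.
  by move=> *; lra.
have [mu [Emu mu1 lsc]] := weak_limit U_ dist.
have fmu : (mu setT < +oo)%E by rewrite (le_lt_trans mu1)// ltry.
have Pmu : P mu by split => //; exact: finite_mass_field.
have Jmu : J mu <= wu.
  apply/ler_addgt0Pr => e epos.
  have e2 : 0 < e / 2 by rewrite divr_gt0.
  have : 4^-1 ^+ k @[k --> \oo] --> (0 : R).
    by apply: cvg_expr; rewrite ger0_norm// invf_lt1// ltr1n.
  move=> /cvgrPdist_le /(_ _ e2)[N _ hN].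
  have [k Nk hk] := lsc _ N e2.
  have := hN k Nk; rewrite /= sub0r normrN ger0_norm ?exprn_ge0// => hk2.
  have ee : e / 2 + e / 2 <= e by rewrite -splitr.
  have := J_ k; move: hk hk2 e2 ee; move: (e / 2) (J mu) (J (mu_ k)) (_ ^+ k) wu; clear.
  by move=> *; lra.
have [wh|wh] := leP wu (J omega_hat).
  have := unit_minimizing_mass Emu fmu (le_trans Jmu wh) => h.
  by move: m1; rewrite -h ltNge mu1.
have eJ : 0 < wu - J omega_hat by rewrite subr_gt0.
have [nu [Pnu fnu nu1 Jnu]] := truncation Phi P_hat m1 eJ.
rewrite addrC subrK in Jnu.
have mE : mu setT = (fine (mu setT))%:E by rewrite fineK// ge0_fin_numE.
have nE : nu setT = (fine (nu setT))%:E by rewrite fineK// ge0_fin_numE.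
pose q := fine (mu setT); pose v := fine (nu setT).
have q1 : q <= 1 by rewrite -lee_fin -mE.
have v1 : 1 < v by rewrite -lte_fin -nE.
have qv : 0 < v - q by rewrite subr_gt0 (le_lt_trans q1).
(* t solves (1 - t) q + t v = 1 *)
pose t := (1 - q) / (v - q).
have t0 : 0 <= t by rewrite divr_ge0 ?(ltW qv)// subr_ge0.
have t1 : 0 <= 1 - t.
  by rewrite subr_ge0 /t ler_pdivrMr// mul1r lerD2r ltW.
exists (lin_comb (NngNum t1) (NngNum t0) mu nu); apply/minimizerP.
have Uc : Eplus_unit alpha A (lin_comb (NngNum t1) (NngNum t0) mu nu).
  apply: lin_comb_unit => //=; first by case: Pnu.
  rewrite mE nE -!EFinM -EFinD -/q -/v; congr (_%:E).
  by rewrite /t; field; rewrite gt_eqF.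
split => //; apply/eqP; rewrite eq_le wu_le// andbT.
have ab : (NngNum t1)%:num + (NngNum t0)%:num = 1 :> R by rewrite /= subrK.
rewrite (rgauss_convex Phi ab Pmu Pnu)/=.
have d0 : 0 <= ip mu mu + ip nu nu - 2 * ip mu nu.
  by rewrite subr_ge0; apply: (ip_amgm Phi); [exact: Eplus_field_energy_lty Pmu|exact: Eplus_field_energy_lty Pnu].
have p1 : (1 - t) * J mu <= (1 - t) * wu by rewrite ler_wpM2l.
have p2 : t * J nu <= t * wu by rewrite ler_wpM2l.
have p3 := mulr_ge0 (mulr_ge0 t1 t0) d0.
move: p1 p2 p3; move: (_ * (_ - _)) (_ * J mu) (_ * J nu) => *; lra.
Qed.

(** Were the two infima equal, a solution of mass 1 would minimize over the
    cone, where all minimizers have the mass of the pseudo-balayage. *)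
Lemma w_hat_lt_w_unit : (1 < omega_hat setT)%E -> J omega_hat < wu.
Proof.
move=> m1; rewrite ltNge; apply/negP => wh.
have [lam /minimizerP[[E1 l1] Jl]] := minimizer_exists_gt1 m1.
have h : lam setT = omega_hat setT.
  by apply: unit_minimizing_mass => //; [rewrite l1 ltry|rewrite Jl].
by move: m1; rewrite -h l1 ltxx.
Qed.

Lemma equilibrium_ip lam : is_weighted_minimizer alpha f A lam ->
  equilibrium_constant alpha f lam = (ip lam lam + L lam)%:E.
Proof.
move=> /minimizerP[U1 _]; have Pl := unit_field U1.
have fl := Eplus_field_energy_lty Pl.
have pE : (\int[lam]_x potential alpha lam x = (ip lam lam)%:E)%E.
  by rewrite (integral_potentialE Phi) (ipE Phi).
have ipot : lam.-integrable setT (potential alpha lam).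
  apply/integrableP; split; first exact: (measurable_potential Phi).
  under eq_integral do rewrite gee0_abs ?(potential_ge0 Phi)//.
  by rewrite pE ltry.
rewrite /equilibrium_constant integralD//; last by case: Pl.
by rewrite pE (field_integralE Pl).
Qed.

(** When the constant vanishes, [L lam = - ip lam lam]. The derivative of J at
    lam towards the unit measure nu / v is then a positive multiple of [ip lam
    nu + L nu], so this number is nonnegative; convexity gives [J lam <= J nu]
    whatever the mass of nu. Taking for nu a truncation of the pseudo-balayage
    contradicts the strict inequality between the infima. *)
Lemma equilibrium_neq0 lam : (1 < omega_hat setT)%E ->
  is_weighted_minimizer alpha f A lam -> equilibrium_constant alpha f lam <> 0%E.
Proof.
move=> m1 lmin; rewrite equilibrium_ip// => c0'; have c0 := EFin_inj c0'.
have /minimizerP[U1 Jl] := lmin; have Pl := unit_field U1.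
have [El l1] := U1.
have eJ : 0 < (wu - J omega_hat) / 2 by rewrite divr_gt0// subr_gt0 w_hat_lt_w_unit.
have [nu [Pnu fnu nu1 Jnu]] := truncation Phi P_hat m1 eJ.
have nE : nu setT = (fine (nu setT))%:E by rewrite fineK// ge0_fin_numE.
pose v := fine (nu setT).
have v1 : 1 < v by rewrite -lte_fin -nE.
have v0 : 0 < v by exact: lt_trans v1.
have fl := Eplus_field_energy_lty Pl; have fn := Eplus_field_energy_lty Pnu.
have deriv : 0 <= ip lam nu + L nu.
  pose D := ip lam nu / v + L nu / v.
  have Dv : ip lam nu + L nu = D * v by rewrite /D; field; rewrite gt_eqF.
  suff D0 : 0 <= D by rewrite Dv mulr_ge0// ltW.
  pose B := ip nu nu / v ^+ 2 + ip lam lam.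
  have B0 : 0 <= B by rewrite addr_ge0 ?divr_ge0 ?exprn_ge0 ?(ip_ge0 Phi)// ltW.
  (* compare J at lam and at (1 - t) lam + (t / v) nu, and divide by t *)
  have key t : 0 < t -> t <= 1 -> - B * t <= 2 * D.
    move=> t0 t1.
    have tv : 0 <= t / v by rewrite divr_ge0// ltW.
    have t1' : 0 <= 1 - t by rewrite subr_ge0.
    have Uc : Eplus_unit alpha A (lin_comb (NngNum t1') (NngNum tv) lam nu).
      apply: lin_comb_unit => //=; first by case: Pnu.
      rewrite l1 nE -!EFinM -EFinD mulr1 -/v; congr (_%:E).
      by field; rewrite gt_eqF.
    rewrite -(ler_pM2r t0); have := wu_le Uc; rewrite -Jl (rgauss_comb Phi _ _ Pl Pnu)//= /rgauss.
    have -> : L lam = - ip lam lam by apply/eqP; rewrite -addr_eq0 addrC c0.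
    have -> : 2 * D * t = 2 * t * (ip lam nu / v) + 2 * (t / v * L nu) by rewrite /D; field; rewrite gt_eqF.
    have -> : - B * t * t = - ((t / v) ^+ 2 * ip nu nu) - t ^+ 2 * ip lam lam.
      by rewrite /B; field; rewrite gt_eqF.
    have -> : 2 * (1 - t) * (t / v) * ip lam nu = 2 * t * (ip lam nu / v) - 2 * t ^+ 2 * (ip lam nu / v) by field; rewrite gt_eqF.
    have h : 0 <= 2 * t ^+ 2 * (ip lam nu / v).
      by rewrite !mulr_ge0 ?exprn_ge0 ?(ip_ge0 Phi) ?invr_ge0// ltW.
    have -> : (1 - t) ^+ 2 * ip lam lam = ip lam lam - 2 * (t * ip lam lam) + t ^+ 2 * ip lam lam by ring.
    have -> : (1 - t) * - ip lam lam = - ip lam lam + t * ip lam lam by ring.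
    move: h; move: (2 * t ^+ 2 * _) => x1; move: (t ^+ 2 * _) ((t / v) ^+ 2 * _) => x2 x3.
    move: (t * ip lam lam) (2 * t * _) (t / v * _) => x4 x5 x6; move: (ip lam lam) => x7.
    exact: derivative_arith.
  rewrite leNgt; apply/negP => D0.
  pose t := Num.min 1 (- D / (B + 1)).
  have B1 : 0 < B + 1 by rewrite ltr_wpDl.
  have t0 : 0 < t by rewrite lt_min ltr01 divr_gt0// oppr_gt0.
  have t1 : t <= 1 by rewrite ge_min lexx.
  have tD : t * (B + 1) <= - D by rewrite -ler_pdivlMr// ge_min lexx orbT.
  by have := key t t0 t1; rewrite mulNr; apply: small_step_arith t0 D0 _; rewrite -(mulrC t) -[X in _ + X]mulr1 -mulrDr.
have amgm := ip_amgm Phi fl fn.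
have : J lam <= J nu.
  exact: tangent_arith c0 deriv amgm.
by rewrite Jl; apply/negP; rewrite -ltNge; exact: midpoint_arith Jnu eJ.
Qed.

Theorem gauss_variational :
  ((exists lam : radon R n, is_weighted_minimizer alpha f A lam)
     <-> (1 <= omega_hat setT)%E)
  /\ ((1 < omega_hat setT)%E ->
      w_unit alpha f A <> w_hat alpha f A
      /\ forall lam : radon R n, is_weighted_minimizer alpha f A lam ->
           ~ radon_eq lam omega_hat
           /\ equilibrium_constant alpha f lam <> 0%E).
Proof.
split; [split=> [[lam /minimizer_mass_ge1//]|]|].
  rewrite le_eqVlt => /predU1P[m1|]; last exact: minimizer_exists_gt1.
  exists omega_hat; apply/minimizerP; split; first by split => //; case: P_hat.
  by apply/eqP; rewrite eq_le w_hat_le_w_unit w_unit_le_w_hat// -m1.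
move=> m1; split=> [|lam lmin].
  rewrite w_unitE w_hatE => h.
  by have := w_hat_lt_w_unit m1; rewrite (EFin_inj h) ltxx.
split; last exact: equilibrium_neq0.
move=> /(_ setT measurableT) h; have [[_ l1] _] := lmin.
by move: m1; rewrite -h l1 ltxx.
Qed.

End gauss_variational.

(** * Strong limits of vaguely convergent sequences *)

Section strong_vague_limit.
Context (R : realType) (n : nat) (alpha : R) (Phi : riesz_features n alpha).
Hypothesis alpha_le : alpha <= n%:R.
Local Notation T := (Rn R n).
Local Notation S := (fspace Phi).
Local Notation m := (fmu Phi).
Local Notation ip := (@ip R n alpha).
Local Notation fe mu := (energy alpha mu < +oo)%E.
Implicit Types mu nu : radon R n.

(** The squared distance in the energy norm, expanded by bilinearity. *)
Definition energy_dist2 mu nu : R := ip mu mu - 2 * ip mu nu + ip nu nu.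
Local Notation Q := energy_dist2.

(** A feature is bounded, being continuous and vanishing at infinity. *)
Lemma rtrans_fin_mass mu s : (mu setT < +oo)%E -> rtrans Phi mu s \is a fin_num.
Proof.
move=> fmu; rewrite ge0_fin_numE; last exact: rtrans_ge0.
have ch : {within setT, continuous (feat Phi ^~ s)}.
  by apply: continuous_subspaceT => x; exact: continuous_feat.
have hinf (e : R) : 0 < e -> exists M, forall x : T, setT x -> M < enorm x -> feat Phi x s <= e.
  by move=> /(feat_at_infinity (r := Phi) s)[M hM]; exists M => x _; exact: hM.
have [M hM] := C0_bounded closedT ch hinf.
apply: (@le_lt_trans _ _ (M%:E * mu setT)%E); last first.
  rewrite lte_mul_pinfty// lee_fin.
  by apply: le_trans (hM 0 Logic.I); exact: feat_ge0.
rewrite -integral_cst//; apply: ge0_le_integral => //.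
- by move=> x _; rewrite lee_fin feat_ge0.
- by apply/measurable_EFinP; exact: measurable_feat1.
Qed.

Section cauchy_sequence.
Variables (A : set T) (mu_ : nat -> radon R n).
Hypothesis mu_E : forall k, Eplus_on alpha A (mu_ k).
Hypothesis mu_1 : forall k, (mu_ k setT <= 1)%E.
Hypothesis mu_dist : forall k, Q (mu_ k) (mu_ k.+1) <= 4^-1 ^+ k.
Variables (U : set_system nat) (UU : UltraFilter U).
Hypothesis U_oo : forall N, U [set k | (N <= k)%N].
Variable mu : radon R n.
Hypothesis mu_compact : forall K, compact K -> ((ucontent U mu_ K)%:E <= mu K)%E.
Hypothesis mu_open : forall W, open W -> (mu W <= (ucontent U mu_ W)%:E)%E.

Let fe_ k : fe (mu_ k). Proof. exact: (Eplus_on_energy_lty (mu_E k)). Qed.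

Let mu_le1 : (mu setT <= 1)%E.
Proof. exact: (vague_limit_le1 mu_1 mu_open). Qed.

Let F k s : R := fine (rtrans Phi (mu_ k) s).

(** Features vanish at infinity, so escaping mass does not affect the limit of
    the transforms. *)
Lemma rtrans_cvg s : F k s @[k --> U] --> fine (rtrans Phi mu s).
Proof.
apply: (vague_cvg_C0 (UU := UU) mu_1 mu_compact mu_open closedT).
- by move=> k; rewrite setCT measure0.
- by apply: continuous_subspaceT => x; exact: continuous_feat.
- by move=> x _; exact: feat_ge0.
- by move=> e /(feat_at_infinity (r := Phi) s)[M hM]; exists M => x _; exact: hM.
Qed.

(** Iterate [(a + b)^2 <= 2 a^2 + 2 b^2]. The weights 2^i are harmless against
    distances of order 4^-i. *)
Lemma rdist2_telescope j N s :
  rdist2 Phi (mu_ (j + N)) (mu_ j) s <=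
  \sum_(0 <= i < N) 2 ^+ i.+1 * rdist2 Phi (mu_ (j + i)) (mu_ (j + i).+1) s.
Proof.
elim: N j => [|N IH] j; first by rewrite big_nil addn0 /rdist2 subrr expr0n.
rewrite big_nat_recl// addn0 expr1.
have := IH j.+1; rewrite addSnnS => h.
apply: (@le_trans _ _ (2 * rdist2 Phi (mu_ j) (mu_ j.+1) s +
    2 * rdist2 Phi (mu_ (j + N.+1)) (mu_ j.+1) s)).
  rewrite /rdist2; move: (fine _) (fine _) (fine _) => a b c.
  by have := sqr_ge0 (b + c - 2 * a); rewrite !expr2; lra.
rewrite lerD2l (le_trans (ler_wpM2l _ h))// mulr_sumr.
by under [leRHS]eq_bigr do rewrite addnS -addSn exprS -mulrA.
Qed.

Let G j s : \bar R :=
  (\sum_(0 <= i <oo) (2 ^+ i.+1 * rdist2 Phi (mu_ (j + i)) (mu_ (j + i).+1) s)%:E)%E.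

Let term_ge0 j i s : 0 <= 2 ^+ i.+1 * rdist2 Phi (mu_ (j + i)) (mu_ (j + i).+1) s.
Proof. by apply: mulr_ge0; [exact: exprn_ge0|exact: rdist2_ge0]. Qed.

(** The telescoping bound does not depend on its upper end, so it survives the
    limit along the ultrafilter. *)
Lemma rdist2_limit_le j s : ((rdist2 Phi mu (mu_ j) s)%:E <= G j s)%E.
Proof.
have h k : (j <= k)%N -> ((rdist2 Phi (mu_ k) (mu_ j) s)%:E <= G j s)%E.
  move=> jk; rewrite -(subnKC jk); apply: (@le_trans _ _
    (\sum_(0 <= i < k - j) (2 ^+ i.+1 * rdist2 Phi (mu_ (j + i)) (mu_ (j + i).+1) s)%:E)%E).
    by rewrite sumEFin lee_fin; exact: rdist2_telescope.
  by apply: nneseries_lim_ge => i _ _; rewrite lee_fin.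
have : (0 <= G j s)%E by apply: nneseries_ge0 => i _ _; rewrite lee_fin.
move: h; case: (G j s) => [g h _| _ _|//]; last by rewrite leey.
have c1 : rdist2 Phi (mu_ k) (mu_ j) s @[k --> U] --> rdist2 Phi mu (mu_ j) s.
  rewrite /rdist2 expr2; under eq_fun do rewrite expr2.
  by apply: cvgM; apply: cvgB; (try exact: cvg_cst); exact: rtrans_cvg.
have c2 : g @[_ --> U] --> g by exact: cvg_cst.
rewrite lee_fin; apply: (ler_cvg_to c1 c2).
by apply: filterS (U_oo j) => k /h; rewrite lee_fin.
Qed.

Let integral_G j : (\int[m]_s G j s <= (4 * 4^-1 ^+ j)%:E)%E.
Proof.
rewrite integral_nneseries//; last 2 first.
- move=> i; apply/measurable_EFinP; apply: measurable_funM => //.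
  exact: measurable_rdist2.
- by move=> i s _; rewrite lee_fin.
apply: lime_le; first by apply: is_cvg_nneseries => i _ _; apply: integral_ge0 => s _; rewrite lee_fin.
apply: nearW => N.
suff : (\sum_(0 <= i < N) \int[m]_s (2 ^+ i.+1 * rdist2 Phi (mu_ (j + i)) (mu_ (j + i).+1) s)%:E
   <= (4^-1 ^+ j * (4 - 4 * 2^-1 ^+ N))%:E)%E.
  move=> /le_trans; apply; rewrite lee_fin mulrC ler_wpM2r ?exprn_ge0//.
  by rewrite gerBl mulr_ge0// exprn_ge0.
elim: N => [|N IH]; first by rewrite big_nil expr0 mulr1 subrr mulr0.
rewrite big_nat_recr//=.
have -> : (\int[m]_s (2 ^+ N.+1 * rdist2 Phi (mu_ (j + N)) (mu_ (j + N).+1) s)%:E =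
   (2 ^+ N.+1 * Q (mu_ (j + N)) (mu_ (j + N).+1))%:E)%E.
  under eq_integral do rewrite EFinM.
  rewrite ge0_integralZl_EFin//=.
  - by rewrite (rdist2_energy Phi (fe_ _) (fe_ _)).
  - by move=> s _; rewrite lee_fin rdist2_ge0.
  - by apply/measurable_EFinP; exact: measurable_rdist2.
apply: (le_trans (leeD IH (lexx _))); rewrite -EFinD lee_fin.
have h : 2 ^+ N.+1 * Q (mu_ (j + N)) (mu_ (j + N).+1) <= 2 ^+ N.+1 * 4^-1 ^+ (j + N).
  by rewrite ler_pM2l ?exprn_gt0.
apply: (le_trans (lerD (lexx _) h)); rewrite exprD (exprS 2) (exprS 2^-1).
have -> : 4^-1 ^+ N = 2^-1 ^+ N * 2^-1 ^+ N :> R.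
  by rewrite -exprMn; congr (_ ^+ _); field.
rewrite [2 ^+ N](_ : _ = (2^-1 ^+ N)^-1); last by rewrite exprVn invrK.
have : 2^-1 ^+ N != 0 :> R by rewrite expf_eq0 invr_eq0 (_ : (2 == 0 :> R) = false) ?andbF// pnatr_eq0.
move: (2^-1 ^+ N) (4^-1 ^+ j) => a b a0.
by rewrite le_eqVlt; apply/orP; left; apply/eqP; field.
Qed.

Let integral_rdist2_limit j : (\int[m]_s (rdist2 Phi mu (mu_ j) s)%:E <= (4 * 4^-1 ^+ j)%:E)%E.
Proof.
apply: le_trans (integral_G j); apply: ge0_le_integral => //.
- by move=> s _; rewrite lee_fin rdist2_ge0.
- by apply/measurable_EFinP; exact: measurable_rdist2.
- apply: ge0_emeasurable_sum.
  + by move=> i s _ _; rewrite lee_fin.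
  + move=> i _; apply/measurable_EFinP; apply: measurable_funM => //.
    exact: measurable_rdist2.
- by move=> s _; exact: rdist2_limit_le.
Qed.

Let mu_fin : (mu setT < +oo)%E. Proof. by rewrite (le_lt_trans mu_le1)// ltry. Qed.

(** The transform of mu is within a square integrable function of that of the
    first term of the sequence. *)
Lemma vague_limit_energy_lty : fe mu.
Proof.
rewrite /energy (mutual_energyE Phi).
have mrr nu : measurable_fun setT (fun s => rtrans Phi nu s * rtrans Phi nu s)%E.
  by apply: emeasurable_funM; exact: measurable_rtrans.
have rr0 nu s : (0 <= rtrans Phi nu s * rtrans Phi nu s)%E by rewrite mule_ge0 ?rtrans_ge0.
have md : measurable_fun setT (fun s => (rdist2 Phi mu (mu_ 0) s)%:E).
  by apply/measurable_EFinP; exact: measurable_rdist2.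
have d0 s : (0 <= (rdist2 Phi mu (mu_ 0) s)%:E)%E by rewrite lee_fin rdist2_ge0.
apply: (@le_lt_trans _ _ (\int[m]_s (2%:E * (rdist2 Phi mu (mu_ 0) s)%:E +
    2%:E * (rtrans Phi (mu_ 0) s * rtrans Phi (mu_ 0) s)))%E).
  apply: ge0_le_integral => //.
  - by apply: emeasurable_funD; apply: emeasurable_funM.
  - move=> s _; have fin nu (h : (nu setT < +oo)%E) := fineK (rtrans_fin_mass s h).
    have f0 : (mu_ 0 setT < +oo)%E by rewrite (le_lt_trans (mu_1 0))// ltry.
    rewrite -(fin _ mu_fin) -(fin _ f0) -!EFinM -EFinD lee_fin /rdist2.
    move: (fine _) (fine _) => a b.
    by have := sqr_ge0 (b - 2 * a); rewrite !expr2; lra.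
rewrite ge0_integralD//; last 4 first.
- by move=> s _; rewrite mule_ge0.
- by apply: emeasurable_funM.
- by move=> s _; rewrite mule_ge0.
- by apply: emeasurable_funM.
rewrite !ge0_integralZl_EFin//; apply: lte_add_pinfty; apply: lte_mul_pinfty => //.
  by apply: (le_lt_trans (integral_rdist2_limit 0)); rewrite ltry.
by rewrite -(mutual_energyE Phi); exact: fe_.
Qed.

(** Integrate the pointwise bound: the sum over i of [2^(i + 1) 4^-(j + i)] is
    [4 * 4^-j]. So the vague limit is a strong limit. *)
Lemma vague_limit_dist j : Q mu (mu_ j) <= 4 * 4^-1 ^+ j.
Proof.
by rewrite -lee_fin -(rdist2_energy Phi vague_limit_energy_lty (fe_ j)); exact: integral_rdist2_limit.
Qed.

End cauchy_sequence.

Lemma mutual_energy_null nu mu : nu setT = 0%E -> mutual_energy alpha nu mu = 0%E.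
Proof.
move=> nu0; rewrite (mutual_energyE Phi); apply: integral0_eq => s _.
rewrite /rtrans null_set_integral ?mul0e//.
by apply/measurable_EFinP; exact: measurable_feat1.
Qed.

Lemma strong_dist_radon mu nu : fe mu -> fe nu ->
  strong_dist alpha (sradon_of_radon mu) (sradon_of_radon nu) = Num.sqrt (Q mu nu).
Proof.
move=> fmu fnu.
have E mu1 nu1 : smutual_energy alpha (sradon_of_radon mu1) (sradon_of_radon nu1)
    = mutual_energy alpha mu1 nu1.
  rewrite /smutual_energy (_ : mutual_energy alpha (sneg _) (sneg _) = 0%E); last exact: mutual_energy_null.
  rewrite (_ : mutual_energy alpha (sneg _) (spos _) = 0%E); last exact: mutual_energy_null.
  rewrite (_ : mutual_energy alpha (spos _) (sneg _) = 0%E) ?adde0 ?sube0//.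
  by rewrite (mutual_energyC Phi); exact: mutual_energy_null.
rewrite /strong_dist !E !ipE//.
Qed.

Lemma finite_energy_radon mu : (mu setT < +oo)%E -> fe mu ->
  finite_energy alpha (sradon_of_radon mu).
Proof.
move=> fm fmu; split.
  apply: tail_finite_of_mass => //.
  have -> : (tvar (sradon_of_radon mu) setT = mu setT + 0)%E.
    exact: (radon_addE mu (sneg (sradon_of_radon mu)) setT).
  by rewrite adde0.
by apply: (energy_lty_add Phi) => //; rewrite /energy mutual_energy_null// ltry.
Qed.

Lemma strongly_closed_limit A mu (mu_ : nat -> radon R n) :
  strongly_closed alpha (Eplus_on alpha A) -> (mu setT < +oo)%E -> fe mu ->
  (forall k, Eplus_on alpha A (mu_ k)) ->
  (forall k, Q mu (mu_ k) <= 4 * 4^-1 ^+ k) -> Eplus_on alpha A mu.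
Proof.
move=> cA fm fmu Emu dmu.
have [] // := cA (sradon_of_radon mu) (finite_energy_radon fm fmu).
move=> e e0.
have e1 : 0 < e ^+ 2 / 8 by rewrite divr_gt0// exprn_gt0.
have : 4^-1 ^+ k @[k --> \oo] --> (0 : R).
  by apply: cvg_expr; rewrite ger0_norm// invf_lt1// ltr1n.
move=> /cvgrPdist_le /(_ _ e1)[N _ /(_ N (leqnn _))].
rewrite /= sub0r normrN ger0_norm ?exprn_ge0// => hN.
exists (mu_ N) => //; rewrite strong_dist_radon//; last exact: (Eplus_on_energy_lty (Emu N)).
rewrite -(ger0_norm (ltW e0)) -sqrtr_sqr ltr_sqrt ?exprn_gt0//.
apply: le_lt_trans (dmu N) _.
by move: hN e1; move: (e ^+ 2) (4^-1 ^+ N); clear; move=> *; lra.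
Qed.

End strong_vague_limit.

(** * Lower semicontinuity of the Gauss functional *)

Section strong_convergence.
Context (R : realType) (n : nat) (alpha : R) (Phi : riesz_features n alpha).
Local Notation T := (Rn R n).
Local Notation ip := (@ip R n alpha).
Local Notation fe mu := (energy alpha mu < +oo)%E.
Local Notation Q := (@energy_dist2 R n alpha).
Implicit Types mu nu sigma : radon R n.

Lemma energy_dist2C mu nu : Q mu nu = Q nu mu.
Proof.
rewrite /energy_dist2 (ipC Phi nu mu).
by move: (ip mu mu) (ip nu nu) (ip mu nu) => *; ring.
Qed.

Fact continuity_arith (d c e i q : R) : 0 < c -> 0 <= i ->
  2 * c * d <= q + c ^+ 2 * i -> q <= c * e -> c * (i + 1) <= e -> d <= e.
Proof.
move=> c0 i0 h hq hc; rewrite -(ler_pM2l c0).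
have ci : c ^+ 2 * i <= c * e.
  rewrite expr2 -mulrA ler_pM2l//; apply: le_trans hc.
  by rewrite ler_pM2l// lerDl.
by move: h hq ci; rewrite -mulrA; move: (c * d) (c * e) (_ * i) => *; lra.
Qed.

(** Strong convergence implies weak convergence, through [ip_cont] with a
    parameter c of order e. *)
Lemma ip_cvg (mu_ : nat -> radon R n) mu sigma :
  (forall k, fe (mu_ k)) -> fe mu -> fe sigma ->
  (forall k, Q mu (mu_ k) <= 4 * 4^-1 ^+ k) ->
  ip (mu_ k) sigma @[k --> \oo] --> ip mu sigma.
Proof.
move=> f_ fmu fs dist; apply/cvgrPdist_le => e e0.
have I1 : 0 < ip sigma sigma + 1 by rewrite ltr_wpDl// (ip_ge0 Phi).
pose c := e / (ip sigma sigma + 1).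
have c0 : 0 < c by rewrite divr_gt0.
have ce : c * (ip sigma sigma + 1) <= e by rewrite /c divfK// gt_eqF.
have ce4 : 0 < c * e / 4 by rewrite divr_gt0// mulr_gt0.
have : 4^-1 ^+ k @[k --> \oo] --> (0 : R).
  by apply: cvg_expr; rewrite ger0_norm// invf_lt1// ltr1n.
move=> /cvgrPdist_le /(_ _ ce4); apply: filterS => k.
rewrite /= sub0r normrN ger0_norm ?exprn_ge0// => hk.
have q : Q mu (mu_ k) <= c * e.
  by apply: (le_trans (dist k)); rewrite mulrC -ler_pdivlMr.
have I0 : 0 <= ip sigma sigma by exact: (ip_ge0 Phi).
have h1 := ip_cont Phi fmu (f_ k) fs c0.
have h2 := ip_cont Phi (f_ k) fmu fs c0.
have q2 := q; rewrite energy_dist2C in q2.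
rewrite ler_norml lerNl opprB.
by rewrite (continuity_arith c0 I0 h2 q2 ce) (continuity_arith c0 I0 h1 q ce).
Qed.

End strong_convergence.

(** Reduces lower semicontinuity of J to convergence of the field integral along
    the ultrafilter. For the energy part, [||mu||^2 - ||mu_k||^2 <= 2 <mu, mu -
    mu_k>], which tends to zero by weak convergence. *)
Lemma weak_limit_of_field (R : realType) (n : nat) (alpha : R)
    (Phi : riesz_features n alpha) (f : Rn R n -> \bar R) (A : set (Rn R n)) :
  alpha <= n%:R -> strongly_closed alpha (Eplus_on alpha A) ->
  (forall (U : set_system nat) (UU : UltraFilter U) mu_ (mu : radon R n),
    (forall N, U [set k | (N <= k)%N]) ->
    (forall k, Eplus_unit alpha A (mu_ k)) ->
    (forall K, compact K -> ((ucontent U mu_ K)%:E <= mu K)%E) ->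
    (forall W, open W -> (mu W <= (ucontent U mu_ W)%:E)%E) ->
    Eplus_on alpha A mu -> (mu setT <= 1)%E ->
    (forall k, energy_dist2 alpha mu (mu_ k) <= 4 * 4^-1 ^+ k) ->
    field_integral f (mu_ k) @[k --> U] --> field_integral f mu) ->
  forall mu_ : nat -> radon R n,
  (forall k, Eplus_unit alpha A (mu_ k)) ->
  (forall k, ip alpha (mu_ k) (mu_ k) + ip alpha (mu_ k.+1) (mu_ k.+1)
             - 2 * ip alpha (mu_ k) (mu_ k.+1) <= 4^-1 ^+ k) ->
  exists mu, [/\ Eplus_on alpha A mu, (mu setT <= 1)%E &
    forall (e : R) N, 0 < e ->
      exists2 k, (N <= k)%N & rgauss alpha f mu <= rgauss alpha f (mu_ k) + e].
Proof.
move=> alpha_le cA Lcvg mu_ U_ dist.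
have [U [UU ooU]] := ultraFilterLemma (@eventually_filter).
have UN N : U [set k | (N <= k)%N] by apply: ooU; exists N.
have mu1 k : (mu_ k setT <= 1)%E by rewrite (U_ k).2.
have E_ k := (U_ k).1; have f_ k := Eplus_on_energy_lty (E_ k).
have [mu [muK muW]] := @vague_limit_exists R n U UU mu_ mu1.
have dist' k : energy_dist2 alpha (mu_ k) (mu_ k.+1) <= 4^-1 ^+ k.
  by rewrite /energy_dist2; have := dist k; rewrite addrAC.
have mass : (mu setT <= 1)%E by exact: (vague_limit_le1 mu1 muW).
have mfin : (mu setT < +oo)%E by rewrite (le_lt_trans mass)// ltry.
have fmu := vague_limit_energy_lty Phi E_ mu1 dist' UU UN muK muW.
have Q_ := vague_limit_dist Phi E_ mu1 dist' UU UN muK muW.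
have Emu := strongly_closed_limit Phi alpha_le cA mfin fmu E_ Q_.
exists mu; split => // e N e0.
have e4 : 0 < e / 4 by rewrite divr_gt0.
have /cvgrPdist_le /(_ _ e4) hI := ip_cvg Phi f_ fmu fmu Q_.
have /cvgrPdist_le /(_ _ e4) hL := Lcvg U UU mu_ mu UN U_ muK muW Emu mass Q_.
have hIU := ooU _ hI.
have [k [[Nk hk1] hk2]] := filter_ex (filterI (filterI (UN N) hIU) hL).
exists k => //; move: hk1 hk2; rewrite /= !ler_norml /rgauss => /andP[_ h1] /andP[_ h2].
have am := ip_amgm Phi fmu (f_ k).
rewrite (ipC Phi) in h1.
have ee : e / 4 + e / 4 + e / 4 + e / 4 <= e by lra.
move: h1 h2 am ee; move: (ip alpha mu mu) (ip alpha mu (mu_ k)) (ip alpha (mu_ k) (mu_ k)).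
by move: (field_integral f mu) (field_integral f (mu_ k)) (e / 4); clear; move=> *; lra.
Qed.

(** * Unit measures of small energy *)

Section small_energy.
Context (R : realType) (n : nat) (alpha : R) (Phi : riesz_features n alpha).
Hypothesis alpha_lt : alpha < n%:R.
Local Notation T := (Rn R n).
Local Notation ip := (@ip R n alpha).
Local Notation fe mu := (energy alpha mu < +oo)%E.
Implicit Types mu nu tau : radon R n.

Lemma potentialD mu nu x :
  (potential alpha (radon_add mu nu) x = potential alpha mu x + potential alpha nu x)%E.
Proof.
apply: ge0_integral_radon_add; last by move=> y; exact: (riesz_kernel_ge0 Phi).
exact: (measurableT_comp (measurable_riesz_kernel Phi) (measurable_pair1 x)).
Qed.

(** A compact subset of A with large capacity carries a unit measure whose
    energy is close to the inverse of the capacity. *)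
Lemma small_energy_unit A (d : R) : inner_capacity alpha A = +oo%E -> 0 < d ->
  exists tau, Eplus_unit alpha A tau /\ ip tau tau <= d.
Proof.
move=> capA d0.
have /ereal_sup_gt[_ [K [cK KA] <-]] : ((d^-1)%:E < inner_capacity alpha A)%E.
  by rewrite capA ltry.
rewrite /capacity => h.
have : (ereal_inf [set energy alpha mu
    | mu in [set mu | Eplus_on alpha K mu /\ mu setT = 1%E]] < d%:E)%E.
  have i0 : (0 <= ereal_inf [set energy alpha mu
      | mu in [set mu | Eplus_on alpha K mu /\ mu setT = 1%E]])%E.
    by apply: le_ereal_inf_tmp => _ [mu _ <-]; exact: (mutual_energy_ge0 Phi).
  move: h i0; case: (ereal_inf _) => [r| |]//.
    rewrite inver lte_fin lee_fin; case: eqP => [->//|/eqP r0] h r1.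
    have rp : 0 < r by rewrite lt_neqAle eq_sym r0.
    by move: h; rewrite lte_fin ltf_pV2.
  by rewrite invey lte_fin ltNge invr_ge0 ltW.
move=> /ereal_inf_lt[_ [tau [[[t1 e1] n1] m1] <-]] ed.
exists tau; split; last by rewrite -lee_fin -(energyE Phi) ?ltW// (lt_le_trans ed) ?leey.
split => //; split; first by split.
by apply: negligibleS n1; exact: subsetC.
Qed.

(** Points of a ball are at distance at most its diameter, and the kernel
    decreases with the distance. *)
Lemma riesz_kernel_ge_ball (x y : T) M : 0 < M -> cball M x -> cball M y ->
  (((2 * M) `^ (alpha - n%:R))%:E <= riesz_kernel alpha x y)%E.
Proof.
move=> M0 xM yM; rewrite /riesz_kernel; case: eqP => [_|/eqP xy]; first exact: leey.
rewrite lee_fin -opprB !powRN.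
have e0 : 0 < enorm (x - y) by rewrite lt_neqAle enorm_ge0 eq_sym enorm_sub_eq0 xy.
have le2 := enorm_sub_le xM yM.
rewrite lef_pV2 ?posrE ?powR_gt0 ?mulr_gt0//.
by apply: ge0_ler_powR; rewrite ?nnegrE ?(ltW e0)// ?subr_ge0 ?(ltW alpha_lt)// ?mulr_ge0// ltW.
Qed.

(** The kernel is bounded below on a ball, so the energy of the part of tau in
    it dominates the square of the mass there: unit measures of small energy
    leave every ball. *)
Lemma ball_mass_le tau M : 0 < M -> (tau setT < +oo)%E -> fe tau ->
  fine (tau (cball M)) ^+ 2 <= (2 * M) `^ (n%:R - alpha) * ip tau tau.
Proof.
move=> M0 tfin ftau; set B := cball M; have mB : measurable B := measurable_cball M.
pose k := (2 * M) `^ (alpha - n%:R).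
have k0 : 0 < k by rewrite powR_gt0// mulr_gt0.
have Bfin : tau B \is a fin_num.
  rewrite ge0_fin_numE//; apply: le_lt_trans tfin.
  by apply: le_measure; rewrite ?inE.
have mp : measurable_fun setT (potential alpha (radon_restr mB tau)).
  exact: (measurable_potential Phi).
suff : ((k * fine (tau B) ^+ 2)%:E <= energy alpha tau)%E.
  rewrite (energyE Phi)// lee_fin -opprB powRN.
  by rewrite -/k -ler_pdivlMl// opprB.
apply: le_trans (energy_restr Phi mB tau).
rewrite /energy -(integral_potentialE Phi) ge0_integral_restr//; last first.
  by move=> x; exact: (potential_ge0 Phi).
have -> : ((k * fine (tau B) ^+ 2)%:E = \int[tau]_(x in B) (k%:E * tau B))%E.
  rewrite integral_cst// -[in RHS](fineK Bfin) -!EFinM.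
  transitivity ((k * fine (tau B))%:E * (fine (tau B))%:E)%E.
    by rewrite -EFinM expr2 mulrA.
  by congr (_ * _)%E; exact: fineK.
apply: ge0_le_integral => //.
- by move=> x _; rewrite mule_ge0// lee_fin ltW.
- exact: measurable_funTS.
move=> x Bx; rewrite /potential ge0_integral_restr//; last 2 first.
- exact: (measurableT_comp (measurable_riesz_kernel Phi) (measurable_pair1 x)).
- by move=> y; exact: (riesz_kernel_ge0 Phi).
rewrite -integral_cst//; apply: ge0_le_integral => //.
- by move=> y _; rewrite lee_fin ltW.
- apply: measurable_funTS.
  exact: (measurableT_comp (measurable_riesz_kernel Phi) (measurable_pair1 x)).
- by move=> y By; exact: riesz_kernel_ge_ball.
Qed.

End small_energy.

(** * Admissible external fields *)

(** The hypotheses of the variational argument are verified for f = - U^omega,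
    when omega has finite energy and when its potentials vanish at infinity
    along A. *)
Section external_potential.
Context (R : realType) (n : nat) (alpha : R) (Phi : riesz_features n alpha).
Hypothesis alpha_lt : alpha < n%:R.
Local Notation T := (Rn R n).
Local Notation Rm := (measurableTypeR R).
Local Notation ip := (@ip R n alpha).
Local Notation fe mu := (energy alpha mu < +oo)%E.
Variables (omega : sradon R n) (A : set T).
Implicit Types mu nu tau : radon R n.
Local Notation wp := (spos omega).
Local Notation wn := (sneg omega).
Local Notation f := (neg_potential alpha omega).
Local Notation L := (field_integral f).

Lemma measurable_neg_potential : measurable_fun setT f.
Proof.
by apply: measurableT_comp => //; apply: emeasurable_funB; exact: (measurable_potential Phi).
Qed.

(** This includes the points where the two potentials are both infinite: there
    the right-hand side is infinite as well. *)
Lemma abs_neg_potential_le x : (`|f x| <= potential alpha (tvar omega) x)%E.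
Proof.
rewrite (potentialD Phi) abseN; apply: le_trans (lee_abs_sub _ _) _.
by rewrite !gee0_abs ?(potential_ge0 Phi).
Qed.

Section finite_energy_charge.
Hypothesis omega_fe : fe (tvar omega).

Let fe_wp : fe wp.
Proof.
apply: le_lt_trans omega_fe; rewrite /energy (mutual_energyDl Phi) !(mutual_energyDr Phi).
have ge := mutual_energy_ge0 Phi.
rewrite -addeA; apply: leeDl.
apply: adde_ge0; first exact: ge.
by apply: adde_ge0; exact: ge.
Qed.

Let fe_wn : fe wn.
Proof.
apply: le_lt_trans omega_fe; rewrite /energy (mutual_energyDl Phi) !(mutual_energyDr Phi).
have ge := mutual_energy_ge0 Phi.
rewrite addeA; apply: leeDr.
apply: adde_ge0; last exact: ge.
by apply: adde_ge0; exact: ge.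
Qed.

Let potential_integrable mu nu : fe mu -> fe nu -> mu.-integrable setT (potential alpha nu).
Proof.
move=> fmu fnu; apply/integrableP; split; first exact: (measurable_potential Phi).
under eq_integral do rewrite gee0_abs ?(potential_ge0 Phi)//.
by rewrite (integral_potentialE Phi) (ipE Phi)// ltry.
Qed.

Lemma finite_energy_field mu : fe mu ->
  mu.-integrable setT f /\ L mu = ip mu wn - ip mu wp.
Proof.
move=> fmu.
have ip_ := potential_integrable fmu fe_wp; have in_ := potential_integrable fmu fe_wn.
have i := integrableB measurableT ip_ in_; split; first exact: integrableN.
have E : (\int[mu]_x spotential alpha omega x = (ip mu wp - ip mu wn)%:E)%E.
  by rewrite integralB// !(integral_potentialE Phi) !(ipE Phi).
rewrite /field_integral /neg_potential integralN; first by rewrite E /= opprB.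
by apply: fin_num_adde_defr; exact: (integrable_pos_fin_num measurableT i).
Qed.

(** The field integral of tau is at most [ip tau wn], which is small with the
    energy of tau by the arithmetic-geometric mean inequality. *)
Lemma finite_energy_spreading e : inner_capacity alpha A = +oo%E -> 0 < e ->
  exists tau, [/\ Eplus_unit alpha A tau, ip tau tau <= e & L tau <= e].
Proof.
move=> capA e0.
have I0 : 0 <= ip wn wn by exact: (ip_ge0 Phi).
pose c := e / (ip wn wn + 1).
have c0 : 0 < c by rewrite divr_gt0// ltr_wpDl.
have cI : c * ip wn wn <= e.
  rewrite /c mulrAC ler_pdivrMr ?ltr_wpDl//.
  by rewrite ler_wpM2l ?(ltW e0)// lerDl.
have d0 : 0 < Num.min e (c * e) by rewrite lt_min e0 mulr_gt0.
have [tau [U1 It]] := small_energy_unit Phi capA d0.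
move: It; rewrite le_min => /andP[I1 I2].
have ftau := Eplus_on_energy_lty U1.1.
exists tau; split => //; have [_ ->] := finite_energy_field ftau.
apply: (@le_trans _ _ (ip tau wn)); first by rewrite gerBl (ip_ge0 Phi).
pose c' : {nonneg R} := NngNum (ltW c0).
have := ip_amgm Phi ftau (energy_lty_scale Phi c' fe_wn).
rewrite (ipZr Phi c' fe_wn ftau) (ipZr Phi c' fe_wn (energy_lty_scale Phi c' fe_wn)) (ipZl Phi c' fe_wn fe_wn).
rewrite /c' /=.
move=> h; rewrite -(ler_pM2l c0).
have : c * (c * ip wn wn) <= c * e by rewrite ler_pM2l.
by move: h I2; move: (c * e) (c * (c * _)) (c * ip tau wn) (ip tau tau) => *; lra.
Qed.

Lemma finite_energy_field_cvg (mu_ : nat -> radon R n) mu :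
  (forall k, fe (mu_ k)) -> fe mu ->
  (forall k, energy_dist2 alpha mu (mu_ k) <= 4 * 4^-1 ^+ k) ->
  L (mu_ k) @[k --> \oo] --> L mu.
Proof.
move=> f_ fmu Q_; rewrite (finite_energy_field fmu).2.
under eq_fun do rewrite (finite_energy_field (f_ _)).2.
by apply: cvgB; apply: (ip_cvg Phi f_ fmu _ Q_).
Qed.

End finite_energy_charge.

Section vanishing.
Hypothesis van : vanishing_field alpha omega A.
Local Notation C := (closure A).

Let S0 : R := fine (ereal_sup [set potential alpha (tvar omega) x | x in A]).
Let S : R := Num.max 0 S0.

Let S_ge0 : 0 <= S. Proof. by rewrite le_max lexx. Qed.

Lemma potential_le_on x : A x -> (potential alpha (tvar omega) x <= S%:E)%E.
Proof.
move=> Ax; have [_ h _ _ _] := van.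
have hx : (potential alpha (tvar omega) x <=
    ereal_sup [set potential alpha (tvar omega) x | x in A])%E.
  by apply: ereal_sup_ubound; exists x.
apply: (le_trans hx); apply: (@le_trans _ _ S0%:E); last by rewrite lee_fin le_max lexx orbT.
rewrite fineK// ge0_fin_numE//; apply: le_trans hx; exact: (potential_ge0 Phi).
Qed.

Lemma ae_on mu : mu.-negligible (~` A) -> \forall x \ae mu, A x.
Proof. by []. Qed.

Lemma vanishing_integrable mu : Eplus_on alpha A mu -> (mu setT < +oo)%E ->
  mu.-integrable setT f.
Proof.
move=> [_ nA] fm; apply/integrableP; split; first exact: measurable_neg_potential.
apply: (@le_lt_trans _ _ (S%:E * mu setT)%E); last by rewrite lte_mul_pinfty// lee_fin.
rewrite -integral_cst//; apply: ae_ge0_le_integral => //.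
- by apply: measurableT_comp => //; exact: measurable_neg_potential.
- apply: filterS (ae_on nA) => x Ax _.
  exact: le_trans (abs_neg_potential_le x) (potential_le_on Ax).
Qed.

Lemma vanishing_far e : 0 < e -> exists2 M, 0 < M & forall x, C x -> M < enorm x ->
  (`|f x| <= e%:E)%E.
Proof.
move=> e0; have [_ _ _ lp ln] := van.
have e2 : 0 < e / 2 by rewrite divr_gt0.
have near0 (g : T -> \bar R) : (forall x, 0 <= g x)%E ->
    g x @[x --> within C (@at_infinity R n)] --> 0%E ->
    exists M : R, forall x, C x -> M < enorm x -> (g x <= (e / 2)%:E)%E.
  move=> g0 gl; have : nbhs (0%E : \bar R) [set y | (y <= (e / 2)%:E)%E].
    exists (e / 2) => //= y /=; rewrite /ball_ /= sub0r normrN => h.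
    by rewrite lee_fin; apply: le_trans (ler_norm _) _; exact: ltW.
  by move=> /gl [M _ hM]; exists M => x Cx xM; exact: (hM x xM Cx).
have [M1 h1] := near0 _ (potential_ge0 Phi wp) lp.
have [M2 h2] := near0 _ (potential_ge0 Phi wn) ln.
exists (Num.max 1 (Num.max M1 M2)); first by rewrite lt_max ltr01.
move=> x Cx; rewrite !gt_max => /and3P[_ x1 x2].
apply: (le_trans (abs_neg_potential_le x)); rewrite (potentialD Phi) (splitr e) EFinD.
by apply: leeD; [exact: h1|exact: h2].
Qed.

(** A unit measure of small energy has most of its mass far away, where the
    field is small, and the field is bounded on A. *)
Lemma vanishing_spreading e : inner_capacity alpha A = +oo%E -> 0 < e ->
  exists tau, [/\ Eplus_unit alpha A tau, ip tau tau <= e & L tau <= e].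
Proof.
move=> capA e0.
have e2 : 0 < e / 2 by rewrite divr_gt0.
have [M M0 far] := vanishing_far e2.
pose p := (2 * M) `^ (n%:R - alpha).
have p0 : 0 < p by rewrite powR_gt0// mulr_gt0.
pose t := e / (2 * (S + 1)).
have S1 : 0 < S + 1 by rewrite ltr_wpDl.
have t0 : 0 < t by rewrite divr_gt0// mulr_gt0.
have St : S * t <= e / 2.
  rewrite /t mulrA ler_pdivrMr ?mulr_gt0// mulrA divfK ?gt_eqF// mulrC.
  by rewrite ler_wpM2l ?(ltW e0)// lerDl.
have d0 : 0 < Num.min e (t ^+ 2 / p) by rewrite lt_min e0 divr_gt0// exprn_gt0.
have [tau [U1 It]] := small_energy_unit Phi capA d0.
move: It; rewrite le_min => /andP[I1 I2].
have [[Etau nA] m1] := U1; have ftau := Etau.2.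
have tfin : (tau setT < +oo)%E by rewrite m1 ltry.
exists tau; split => //.
set B := @cball R n M; have mB : measurable B by exact: measurable_cball.
have Bfin : tau B \is a fin_num.
  by rewrite ge0_fin_numE//; apply: le_lt_trans tfin; apply: le_measure; rewrite ?inE.
have tB : fine (tau B) <= t.
  have := ball_mass_le Phi alpha_lt M0 tfin ftau; rewrite -/p -/B => h.
  rewrite -(ler_pXn2r (ltn0Sn 1)) ?nnegrE ?fine_ge0 ?(ltW t0)//.
  by apply: (le_trans h); rewrite mulrC -ler_pdivlMr.
have int := vanishing_integrable U1.1 tfin.
rewrite -lee_fin -(field_integralE (A := A) (alpha := alpha))//.
apply: (@le_trans _ _ (\int[tau]_x `|f x|)%E).
  apply: le_trans (lee_abs _) _; apply: le_abse_integral => //.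
  exact: measurable_neg_potential.
apply: (@le_trans _ _ (\int[tau]_x (S%:E * (\1_B x)%:E + (e / 2)%:E))%E).
  apply: ae_ge0_le_integral => //.
  - by apply: measurableT_comp => //; exact: measurable_neg_potential.
  - by move=> x _; rewrite adde_ge0 ?lee_fin ?mulr_ge0// ltW.
  - apply: emeasurable_funD => //; apply: emeasurable_funM => //.
    by apply/measurable_EFinP; exact: measurable_indic.
  apply: filterS (ae_on nA) => x Ax _; rewrite indicE.
  have [xM|xM] := leP (enorm x) M.
    rewrite mem_set//= mule1; apply: (@le_trans _ _ S%:E).
      exact: le_trans (abs_neg_potential_le x) (potential_le_on Ax).
    by rewrite -EFinD lee_fin lerDl ltW.
  rewrite memNset/= ?mule0 ?add0e; last by apply/negP; rewrite -ltNge.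
  by apply: far => //; exact: subset_closure.
rewrite ge0_integralD//; last 3 first.
- by move=> x _; rewrite mule_ge0 ?lee_fin.
- by apply: emeasurable_funM => //; apply/measurable_EFinP; exact: measurable_indic.
- by move=> x _; rewrite lee_fin ltW.
rewrite ge0_integralZl_EFin//; last by apply/measurable_EFinP; exact: measurable_indic.
have BE : (\int[tau]_x (\1_B x)%:E = (fine (tau B))%:E)%E.
  by rewrite integral_indic// setIT; symmetry; exact: fineK.
have eE : (\int[tau]__ (e / 2)%:E = (e / 2)%:E)%E.
  rewrite integral_cst//; transitivity ((e / 2)%:E * 1)%E; last by rewrite mule1.
  by congr (_ * _)%E; exact: m1.
rewrite BE eE -EFinM -EFinD lee_fin.
rewrite [leRHS]splitr lerD2r; apply: le_trans St; exact: ler_wpM2l.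
Qed.

Let g : T -> R := fine \o f.
(* the positive and negative parts of g, in a form that is visibly continuous *)
Let gp (x : T) : R := (`|g x| + g x) / 2.
Let gn (x : T) : R := (`|g x| - g x) / 2.

Let fE x : C x -> f x = (g x)%:E.
Proof.
have [_ _ [h _] _ _] := van; move=> /h Cx; rewrite /g/= fineK//.
by rewrite /neg_potential fin_numN.
Qed.

Let g_cont : {within C, continuous g}.
Proof.
have [_ _ [h /subspace_continuousP c] _ _] := van.
rewrite (_ : g = fun y => - fine (spotential alpha omega y)); last first.
  by apply/funext => y; rewrite /g/= /neg_potential fineN.
apply/subspace_continuousP => x Cx.
apply: cvgN; apply: fine_cvg; rewrite fineK; last exact: h.
exact: c.
Qed.

Let parts_continuous : {within C, continuous gp} /\ {within C, continuous gn}.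
Proof.
split=> x; apply: cvgMl.
  by apply: cvgD; [apply: cvg_norm|]; exact: g_cont.
by apply: cvgB; [apply: cvg_norm|]; exact: g_cont.
Qed.

Let parts_ge0 x : 0 <= gp x /\ 0 <= gn x.
Proof.
rewrite /gp /gn; have := ler_norm (g x); have := ler_norm (- g x); rewrite normrN.
by split; lra.
Qed.

Let parts_far e : 0 < e -> exists M, forall x, C x -> M < enorm x -> gp x <= e /\ gn x <= e.
Proof.
move=> /vanishing_far[M _ hM]; exists M => x Cx /(hM x Cx).
rewrite fE// abse_EFin lee_fin /gp /gn => h.
by have := ler_norm (g x); have := ler_norm (- g x); rewrite normrN; split; lra.
Qed.

Let field_parts mu : Eplus_on alpha A mu -> (mu setT < +oo)%E -> mu (~` C) = 0%E ->
  L mu = fine (\int[mu]_(x in C) (gp x)%:E) - fine (\int[mu]_(x in C) (gn x)%:E).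
Proof.
move=> Emu fm mC.
have cC : closed C by exact: closed_closure.
have mCm : measurable C by exact: closed_Rn_measurable.
have i := vanishing_integrable Emu fm.
have iC : mu.-integrable C f by apply: integrableS i.
have max0 (y : R) : Num.max y 0 = (`|y| + y) / 2.
  by case: (leP y 0) => [/ler0_norm|/gtr0_norm] ->; lra.
have pE : (\int[mu]_(x in C) f^\+ x = \int[mu]_(x in C) (gp x)%:E)%E.
  by apply: eq_integral => x /set_mem Cx; rewrite funeposE fE// -EFin_max max0.
have nE : (\int[mu]_(x in C) f^\- x = \int[mu]_(x in C) (gn x)%:E)%E.
  by apply: eq_integral => x /set_mem Cx; rewrite funenegE fE// -EFinN -EFin_max max0 normrN.
rewrite /field_integral (negligible_integral (N := ~` C))//; last exact: measurableC.
rewrite setTD setCK integralE pE nE fineB// -?pE -?nE.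
  exact: integrable_pos_fin_num.
exact: integrable_neg_fin_num.
Qed.

(** Each of the two parts of the field is continuous on the closure of A and
    vanishes at infinity there, and the measures do not charge the complement of
    the closure. *)
Lemma vanishing_field_cvg (U : set_system nat) (UU : UltraFilter U)
    (mu_ : nat -> radon R n) mu :
  (forall k, Eplus_unit alpha A (mu_ k)) ->
  (forall K, compact K -> ((ucontent U mu_ K)%:E <= mu K)%E) ->
  (forall W, open W -> (mu W <= (ucontent U mu_ W)%:E)%E) ->
  Eplus_on alpha A mu -> (mu setT <= 1)%E ->
  L (mu_ k) @[k --> U] --> L mu.
Proof.
move=> U_ muK muW Emu mass.
have cC : closed C by exact: closed_closure.
have mCm : measurable C by exact: closed_Rn_measurable.
have null nu : Eplus_on alpha A nu -> nu (~` C) = 0%E.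
  move=> [_ nA]; apply/negligibleP; first exact: measurableC.
  by apply: negligibleS nA; apply: subsetC; exact: subset_closure.
have mu1 k : (mu_ k setT <= 1)%E by rewrite (U_ k).2.
have fin nu : (nu setT <= 1 -> nu setT < +oo)%E by move=> /le_lt_trans; apply; rewrite ltry.
rewrite (field_parts Emu (fin _ mass) (null _ Emu)).
under eq_fun do rewrite (field_parts (U_ _).1 (fin _ (mu1 _)) (null _ (U_ _).1)).
have nC k := null _ (U_ k).1.
apply: cvgB; apply: (vague_cvg_C0 (UU := UU) mu1 muK muW cC nC).
- exact: parts_continuous.1.
- by move=> x _; exact: (parts_ge0 x).1.
- by move=> e /parts_far[M hM]; exists M => x Cx /(hM x Cx)[].
- exact: parts_continuous.2.
- by move=> x _; exact: (parts_ge0 x).2.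
- by move=> e /parts_far[M hM]; exists M => x Cx /(hM x Cx)[].
Qed.

End vanishing.

End external_potential.

Theorem theorem6p7 (R : realType) (n : nat) (alpha : R) (A : set (Rn R n))
    (omega : sradon R n) (omega_hat : radon R n)
    (n_ge2 : (2 <= n)%N) (alpha_gt0 : 0 < alpha) (alpha_ltn : alpha < n%:R)
    (capA : inner_capacity alpha A = +oo%E)
    (closedA : strongly_closed alpha (Eplus_on alpha A))
    (tail_omega : tail_finite alpha (tvar omega))
    (omegaP : finite_energy alpha omega \/ vanishing_field alpha omega A)
    (omega_hatP : is_pseudo_balayage alpha omega A omega_hat) :
  let f := neg_potential alpha omega in
  ((exists lam : radon R n, is_weighted_minimizer alpha f A lam)
     <-> (1 <= omega_hat setT)%E)
  /\ ((1 < omega_hat setT)%E ->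
      w_unit alpha f A <> w_hat alpha f A
      /\ forall lam : radon R n, is_weighted_minimizer alpha f A lam ->
           ~ radon_eq lam omega_hat
           /\ equilibrium_constant alpha f lam <> 0%E).
Proof.
move=> f; have [Phi] := riesz_features_exist alpha_gt0 alpha_ltn.
have [P_hat hat_min] := omega_hatP; have alpha_le := ltW alpha_ltn.
case: omegaP => [[_ omega_fe]|van].
  apply: (gauss_variational Phi _ _ _ P_hat hat_min).
  - by move=> mu /Eplus_on_energy_lty fmu _; exact: (finite_energy_field Phi omega_fe fmu).1.
  - by move=> e; exact: finite_energy_spreading.
  apply: (weak_limit_of_field Phi alpha_le closedA) => U UU mu_ mu UN U_ _ _ Emu _ Q_.
  have c := finite_energy_field_cvg Phi omega_fe
    (fun k => Eplus_on_energy_lty (U_ k).1) (Eplus_on_energy_lty Emu) Q_.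
  by apply: cvg_trans c; apply: cvg_app => W [N _ NW]; apply: filterS (UN N).
apply: (gauss_variational Phi _ _ _ P_hat hat_min).
- by move=> mu; exact: (vanishing_integrable Phi van).
- by move=> e; exact: vanishing_spreading.
apply: (weak_limit_of_field Phi alpha_le closedA) => U UU mu_ mu _ U_ muK muW Emu mass _.
exact: (vanishing_field_cvg Phi van).
Qed.
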